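(* Let $1\le\beta<\infty$ and let $A$ be a scalar type spectral operator in a complex Banach space $X$. Then $A$ generates a $C_0$-semigroup (of scalar type spectral operators) on $X$ that is $\beta$th-order Roumieu-type Gevrey ultradifferentiable on $(0,\infty)$ if and only if there exist $b>0$ and $a\in\mathbb{R}$ such that $$\sigma(A)\subseteq\{\lambda\in\mathbb{C} : \operatorname{Re}\lambda\le a-b|\operatorname{Im}\lambda|^{1/\beta}\}.$$
   Context: A scalar type spectral operator in a complex Banach space $X$ is a densely defined closed linear operator $A$ in $X$ for which there is a strongly $\sigma$-additive spectral measure $E_A(\cdot)$ (the resolution of the identity), assigning to Borel subsets of $\mathbb{C}$ bounded projection operators on $X$ (with $E_A(\emptyset)=0$, $E_A(\mathbb{C})=I$, $E_A(\delta\cap\delta')=E_A(\delta)E_A(\delta')$), whose support is the spectrum $\sigma(A)$, and such that $A=\int_{\sigma(A)}\lambda\,dE_A(\lambda)$. Here, for a Borel measurable $F:\sigma(A)\to\mathbb{C}$, $F(A)=\int_{\sigma(A)}F(\lambda)\,dE_A(\lambda)$ is the operator $F(A)f=\lim_{n\to\infty}\int_{\{|F|\le n\}}F(\lambda)\,dE_A(\lambda)f$, with domain all $f\in X$ for which the limit exists. A $C_0$-semigroup $\{T(t)\}_{t\ge0}$ on $X$ is $\beta$th-order Roumieu-type Gevrey ultradifferentiable on $(0,\infty)$ if, for every $f\in X$, the orbit $g(t)=T(t)f$ is infinitely differentiable on $(0,\infty)$ and, for every compact interval $[c,d]\subset(0,\infty)$, there exist $\alpha>0$ and $K>0$ such that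 $\max_{c\le t\le d}\|g^{(n)}(t)\|\le K\alpha^n(n!)^\beta$ for all $n=0,1,2,\dots$. *)

(* Defs.v *)
From HB Require Import structures.
From mathcomp Require Import all_boot all_order all_algebra.
From mathcomp Require Import complex.
From mathcomp Require Import all_classical all_reals all_analysis.

Set Implicit Arguments.
Unset Strict Implicit.
Unset Printing Implicit Defensive.

Import Order.TTheory GRing.Theory Num.Theory.
Import numFieldNormedType.Exports.

Local Open Scope classical_set_scope.
Local Open Scope complex_scope.
Local Open Scope ring_scope.

(* An unbounded operator: its values outside [op_dom] are meaningless, hence
   equality of operators is [op_eq]. *)
Record operator (R : realType) (X : completeNormedModType R[i]) := Operator {
  op_dom : set X ;
  op_fun :> X -> X }.

Section Operators.
Context {R : realType} {X : completeNormedModType R[i]}.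
Implicit Types (A B : operator X) (S : X -> X).

Definition op_eq A B : Prop :=
  op_dom A = op_dom B /\ forall f, op_dom A f -> A f = B f.

Definition linear_op A : Prop :=
  op_dom A 0 /\
  forall (c : R[i]) f g, op_dom A f -> op_dom A g ->
    op_dom A (c *: f + g) /\ A (c *: f + g) = c *: A f + A g.

Definition densely_defined A : Prop := dense (op_dom A).

Definition closed_op A : Prop :=
  closed [set p : X * X | op_dom A p.1 /\ p.2 = A p.1].

Definition bounded_linear S : Prop := linear S /\ continuous S.

Definition everywhere_op S : operator X := Operator setT S.

Definition resolvent_set A : set R[i] :=
  [set z | exists S, [/\ bounded_linear S,
     forall f, op_dom A (S f) /\ z *: S f - A (S f) = f &
     forall f, op_dom A f -> S (z *: f - A f) = f]].

Definition spectrum A : set R[i] := ~` resolvent_set A.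

End Operators.

Section SpectralMeasures.
Context {R : realType}.

(* The topology of the complex plane is carried by [R[i]^o]. *)
Definition borelC : set (set R[i]) := <<s [set U : set R[i]^o | open U] >>.

Context {X : completeNormedModType R[i]}.
Implicit Types (E : set R[i] -> X -> X) (F G : R[i] -> R[i]).

(* The values of [E] outside the Borel sets are irrelevant.  Each [E d] is a
   projection by the multiplicativity of [E], taken with [d' = d]. *)
Definition spectral_measure E : Prop :=
  [/\ forall d, borelC d -> bounded_linear (E d),
      forall f, E set0 f = 0,
      forall f, E setT f = f,
      forall d d', borelC d -> borelC d' ->
        forall f, E (d `&` d') f = E d (E d' f) &
      forall d : (set R[i])^nat, (forall n, borelC (d n)) -> trivIset setT d ->
        forall f, series (fun n => E (d n) f) @ \oo --> E (\bigcup_n d n) f].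

Definition spectral_support E : set R[i] :=
  [set z | forall U : set R[i]^o, open U -> U z -> exists f, E U f != 0].

Definition borel_simple (s : {fimfun R[i] >-> R[i]}) : Prop :=
  forall z, borelC (s @^-1` [set z]).

Definition simple_spectral_integral E (s : {fimfun R[i] >-> R[i]}) (f : X) : X :=
  \sum_(z \in range s) z *: E (s @^-1` [set z]) f.

(* The integral of a bounded Borel function, as the limit of the integrals of
   simple Borel functions converging to it uniformly. *)
Definition bounded_spectral_integral E G (f : X) : X :=
  get [set y | exists s : {fimfun R[i] >-> R[i]}^nat,
    [/\ forall n, borel_simple (s n),
        forall e : R, 0 < e ->
          \forall n \near \oo, forall z, `|G z - s n z| < e%:C &
        (fun n => simple_spectral_integral E (s n) f) @ \oo --> y]].

Definition truncation (D : set R[i]) F (n : nat) : R[i] -> R[i] :=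
  fun z => \1_(D `&` [set w | `|F w| <= n%:R]) z * F z.

Definition spectral_integral E (D : set R[i]) F : operator X :=
  Operator
    [set f | cvgn (fun n => bounded_spectral_integral E (truncation D F n) f)]
    (fun f => limn (fun n => bounded_spectral_integral E (truncation D F n) f)).

Definition scalar_type_spectral (A : operator X) : Prop :=
  [/\ linear_op A, densely_defined A, closed_op A &
      exists E, [/\ spectral_measure E, spectral_support E = spectrum A &
        op_eq A (spectral_integral E (spectrum A) id)]].

End SpectralMeasures.

Section Semigroups.
Context {R : realType} {X : completeNormedModType R[i]}.
Implicit Types (T : R -> X -> X) (g : R -> X).

(* Only the values [T t] with [0 <= t] are relevant. *)
Definition C0_semigroup T : Prop :=
  [/\ forall t, 0 <= t -> bounded_linear (T t),
      forall f, T 0 f = f,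
      forall s t, 0 <= s -> 0 <= t -> forall f, T (s + t) f = T s (T t f) &
      forall f, T t f @[t --> 0^'+] --> f].

Definition generator T : operator X :=
  Operator
    [set f | cvg ((t^-1)%:C *: (T t f - f) @[t --> 0^'+])]
    (fun f => lim ((t^-1)%:C *: (T t f - f) @[t --> 0^'+])).

Definition generates (A : operator X) T : Prop :=
  C0_semigroup T /\ op_eq A (generator T).

(* [derive1] for functions of a real variable; the library's version asks for
   values in a normed module over [R], whereas [X] is one over [R[i]]. *)
Definition diff_quot g (t : R) : R -> X :=
  fun h => (h^-1)%:C *: (g (h + t) - g t).

Definition derivR g : R -> X := fun t => lim (diff_quot g t @ 0^').

Definition derivRn (n : nat) g : R -> X := iter n derivR g.

Definition smooth_on_pos g : Prop :=
  forall n t, 0 < t -> cvg (diff_quot (derivRn n g) t @ 0^').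

Definition gevrey_roumieu (beta : R) T : Prop :=
  forall f, let g := fun t => T t f in
    smooth_on_pos g /\
    forall c d : R, 0 < c -> c <= d ->
      exists alpha K : R, [/\ 0 < alpha, 0 < K &
        forall (n : nat) (t : R), c <= t <= d ->
          `|derivRn n g t| <= (K * alpha ^+ n * (n`!%:R `^ beta))%:C].

End Semigroups.

(* Main.v *)
(* The bounded functional calculus [Phi G] of the resolution of the identity [E]
   rests on a uniform bound for the projections [E d], obtained from Baire's
   theorem.

   If the spectrum lies in the region, then [|z|^n e^(t Re z)] is bounded there by
   [K alpha^n n!^beta], locally uniformly in [t > 0], so that [Phi (e^(t z))] is a
   Gevrey semigroup with generator [A].

   Conversely let [T] be a Gevrey semigroup generated by [A].  On the range of
   [E {|z| <= n}] the operator [A] is bounded and [T t] is its exponential, so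
   [E {|z| <= n}] maps the [k]-th derivative of [T t f] at [t = 1] to
   [Phi (1_{|z| <= n} z^k e^z) f].  The Gevrey bounds on these vectors have
   constants depending on [f]; Baire's theorem makes the constants uniform.
   Testing on vectors in the range of [E] of a small disc around a point [l] of the
   spectrum gives [|l|^k e^(Re l) <= K alpha^k k!^beta] for all [k], and optimising
   over [k] gives the region.  Finally [T t = Phi (e^(t z))] is of scalar type, its
   resolution of the identity being the image of [E] under [e^(t z)]. *)

Require Import Defs.
From HB Require Import structures.
From mathcomp Require Import all_boot all_order all_algebra.
From mathcomp Require Import complex.
From mathcomp Require Import all_classical all_reals all_analysis.
From mathcomp Require Import ring lra.

Set Implicit Arguments.
Unset Strict Implicit.
Unset Printing Implicit Defensive.

Import Order.TTheory GRing.Theory Num.Theory.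
Import numFieldNormedType.Exports.
Local Open Scope classical_set_scope.
Local Open Scope complex_scope.
Local Open Scope ring_scope.

(** * Norms and uniform boundedness *)

Section Norm.
Context {R : realType}.

(** The norm of a module over [R[i]] takes values in [R[i]]; its real part carries the same
    information ([nrmE]) and lives in a totally ordered field. *)
Definition nrm {V : normedZmodType R[i]} (x : V) : R := complex.Re `|x|.

Section NormedZmod.
Context {V : normedZmodType R[i]}.
Implicit Types x y : V.

Lemma nrmE x : `|x| = (nrm x)%:C.
Proof.
have := normr_ge0 x; rewrite /nrm; case: (`|x|) => a b /=.
by rewrite lecE /= => /andP[/eqP -> _].
Qed.

Lemma nrm_ge0 x : 0 <= nrm x.
Proof. by rewrite -lecR -nrmE normr_ge0. Qed.

Lemma nrm0 : nrm (0 : V) = 0.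
Proof. by rewrite /nrm normr0. Qed.

Lemma nrm_eq0 x : (nrm x == 0) = (x == 0).
Proof.
apply/eqP/eqP => [h|->]; last exact: nrm0.
by apply/eqP; rewrite -normr_eq0 nrmE h.
Qed.

Lemma nrmN x : nrm (- x) = nrm x.
Proof. by rewrite /nrm normrN. Qed.

Lemma nrm_subC x y : nrm (x - y) = nrm (y - x).
Proof. by rewrite /nrm distrC. Qed.

Lemma nrmD x y : nrm (x + y) <= nrm x + nrm y.
Proof. by rewrite -lecR rmorphD/= -!nrmE ler_normD. Qed.

Lemma nrmB x y : nrm (x - y) <= nrm x + nrm y.
Proof. by rewrite -(nrmN y) nrmD. Qed.

Lemma nrm_sub_sub x y : `|nrm x - nrm y| <= nrm (x - y).
Proof.
have h1 := nrmD (x - y) y; rewrite subrK in h1.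
have h2 := nrmD (y - x) x; rewrite subrK nrm_subC in h2.
by rewrite ler_norml; apply/andP; split; lra.
Qed.

Lemma nrm_tri z x y : nrm (x - y) <= nrm (x - z) + nrm (z - y).
Proof. by rewrite (le_trans _ (nrmD _ _))// addrA subrK. Qed.

Lemma nrm_le0_eq x y : (forall e : R, 0 < e -> nrm (x - y) <= e) -> x = y.
Proof.
move=> h; apply/eqP; rewrite -subr_eq0 -nrm_eq0 eq_le nrm_ge0 andbT.
by apply/ler_addgt0Pr => e e0; rewrite add0r; exact: h.
Qed.

End NormedZmod.

Lemma nrmM (z w : R[i]) : nrm (z * w) = nrm z * nrm w.
Proof. by apply: (@complexI R); rewrite rmorphM/= -!nrmE normrM. Qed.

Lemma nrmX (z : R[i]) n : nrm (z ^+ n) = nrm z ^+ n.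
Proof. by apply: (@complexI R); rewrite rmorphXn/= -!nrmE normrX. Qed.

Lemma nrm1 : nrm (1 : R[i]) = 1.
Proof. by rewrite /nrm normr1. Qed.

Lemma nrmV (z : R[i]) : nrm z^-1 = (nrm z)^-1.
Proof. by apply: (@complexI R); rewrite fmorphV/= -!nrmE normfV. Qed.

Lemma nrm_real (r : R) : nrm r%:C = `|r|.
Proof.
have nn (x : R) : 0 <= x -> nrm x%:C = x.
  by move=> x0; rewrite /nrm ger0_norm// lecR.
have [r0|r0] := leP 0 r; first by rewrite nn// ger0_norm.
by rewrite -nrmN -rmorphN/= nn ?ler0_norm ?oppr_ge0 ?ltW.
Qed.

Lemma nrm_Re (z : R[i]) : `|complex.Re z| <= nrm z.
Proof. by rewrite -lecR -nrmE normc_ge_Re. Qed.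

Lemma nrm_i : nrm ('i%C : R[i]) = 1.
Proof.
have : nrm ('i%C : R[i]) ^+ 2 = 1 by rewrite -nrmX sqr_i nrmN nrm1.
move/eqP; rewrite sqrf_eq1 => /orP[/eqP//|/eqP h].
by have := nrm_ge0 ('i%C : R[i]); rewrite h ler0N1.
Qed.

Lemma nrm_Im (z : R[i]) : `|complex.Im z| <= nrm z.
Proof.
have := nrm_Re (z * - 'i%C); rewrite nrmM nrmN nrm_i.
suff -> : complex.Re (z * - 'i%C) = complex.Im z by rewrite mulr1.
by case: z => a b /=; ring.
Qed.

Lemma nrm_le_ReIm (z : R[i]) : nrm z <= `|complex.Re z| + `|complex.Im z|.
Proof.
rewrite {1}(complexE z); apply: (le_trans (nrmD _ _)); rewrite nrm_real lerD2l.
by rewrite nrmM nrm_real nrm_i mul1r.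
Qed.

Section NormedMod.
Context {V : normedModType R[i]}.

Lemma nrmZ (c : R[i]) (x : V) : nrm (c *: x) = nrm c * nrm x.
Proof. by apply: (@complexI R); rewrite rmorphM/= -!nrmE normrZ. Qed.

Lemma cvg_nrmP {T : Type} {F : set_system T} {FF : Filter F} (u : T -> V) (y : V) :
  u x @[x --> F] --> y <->
  forall e : R, 0 < e -> \forall x \near F, nrm (u x - y) < e.
Proof.
split=> [/cvgrPdist_lt h e e0|h].
  have e0' : 0 < e%:C by rewrite ltcR.
  by near=> x; rewrite -ltcR -nrmE distrC; near: x; exact: h.
apply/cvgrPdist_lt => -[e b] e0.
(* An element of [R[i]] that is positive for the order has zero imaginary part. *)
have b0 : b = 0 by move: e0; rewrite ltcE /= => /andP[/eqP].
rewrite b0 complexr0 in e0 *; rewrite ltcR in e0.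
near=> x; rewrite distrC nrmE ltcR; near: x; exact: h.
Unshelve. all: by end_near. Qed.

Lemma cvg_nrm_le {T : Type} {F : set_system T} {FF : Filter F}
    (u : T -> V) (y : V) (h : T -> R) :
  (\forall x \near F, nrm (u x - y) <= h x) -> h x @[x --> F] --> 0 ->
  u x @[x --> F] --> y.
Proof.
move=> uh /cvgrPdist_lt h0; apply/cvg_nrmP => e e0; near=> x.
apply: (@le_lt_trans _ _ (h x)); first by near: x.
rewrite (le_lt_trans (ler_norm _))//.
by near: x; have := h0 _ e0; apply: filterS => x; rewrite sub0r normrN.
Unshelve. all: by end_near. Qed.

Lemma cvg_nrm0 {T : Type} {F : set_system T} {FF : Filter F} (u : T -> V) (y : V) :
  u x @[x --> F] --> y -> nrm (u x - y) @[x --> F] --> (0 : R).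
Proof.
move=> /cvg_nrmP h; apply/cvgrPdist_lt => e e0; near=> x.
by rewrite sub0r normrN ger0_norm ?nrm_ge0//; near: x; exact: h.
Unshelve. all: by end_near. Qed.

Lemma cvg_near_eq {T : Type} {F : set_system T} {FF : Filter F} (u v : T -> V) (y : V) :
  (\forall x \near F, u x = v x) -> u x @[x --> F] --> y -> v x @[x --> F] --> y.
Proof.
move=> uv /cvg_nrmP h; apply/cvg_nrmP => e /h he.
by apply: filterS2 uv he => x ->.
Qed.

Lemma cvg_uniq {T : Type} {F : set_system T} {FF : ProperFilter F} (u : T -> V) (y y' : V) :
  u x @[x --> F] --> y -> u x @[x --> F] --> y' -> y = y'.
Proof. by apply: cvg_unique; exact: norm_hausdorff. Qed.

Lemma cvg_nrm_bound {T : Type} {F : set_system T} {FF : ProperFilter F}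
    (u : T -> V) (y z : V) (b : R) :
  (\forall x \near F, nrm (u x - z) <= b) -> u x @[x --> F] --> y -> nrm (y - z) <= b.
Proof.
move=> ub /cvg_nrmP uy; apply/ler_addgt0Pr => e e0.
near F => x; apply: (le_trans (nrm_tri (u x) _ _)); rewrite addrC lerD//.
  by near: x.
by rewrite nrm_subC ltW//; near: x; exact: uy.
Unshelve. all: by end_near. Qed.

End NormedMod.

Lemma nrm_cauchy_cvg {X : completeNormedModType R[i]} (u : nat -> X) :
  (forall e : R, 0 < e -> exists N, forall n, (N <= n)%N -> nrm (u n - u N) <= e) ->
  exists y : X, u @ \oo --> y.
Proof.
move=> h; suff /cvg_ex : cvg (u @ \oo) by [].
apply: cauchy_cvg; apply: cauchy_exP => -[e b] e0.
have b0 : b = 0 by move: e0; rewrite ltcE /= => /andP[/eqP].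
rewrite b0 complexr0 in e0 *; rewrite ltcR in e0.
have [N hN] := h (e / 2) ltac:(lra).
exists (u N); rewrite /fmapE -ball_normE; exists N => // n /= Nn.
rewrite /= nrmE ltcR nrm_subC; apply: (le_lt_trans (hN _ Nn)); lra.
Qed.

Section Linear.
Context {V : normedModType R[i]}.
Implicit Types S : V -> V.

Lemma linD S : linear S -> forall x y, S (x + y) = S x + S y.
Proof. by move=> h x y; have := h 1 x y; rewrite !scale1r. Qed.

Lemma lin0 S : linear S -> S 0 = 0.
Proof. by move=> h; apply: (@addrI _ (S 0)); rewrite -linD// !addr0. Qed.

Lemma linZ S : linear S -> forall c x, S (c *: x) = c *: S x.
Proof. by move=> h c x; have := h c x 0; rewrite !addr0 lin0// addr0. Qed.

Lemma linN S : linear S -> forall x, S (- x) = - S x.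
Proof. by move=> h x; rewrite -scaleN1r linZ// scaleN1r. Qed.

Lemma linB S : linear S -> forall x y, S (x - y) = S x - S y.
Proof. by move=> h x y; rewrite linD// linN. Qed.

Lemma lin_sum S (I : Type) (r : seq I) (P : pred I) (F : I -> V) : linear S ->
  S (\sum_(i <- r | P i) F i) = \sum_(i <- r | P i) S (F i).
Proof.
move=> h; elim/big_rec2 : _ => [|i y1 y2 _ <-]; first exact: lin0.
by rewrite linD.
Qed.

End Linear.

Section Bounded.
Context {X : completeNormedModType R[i]}.
Implicit Types S : X -> X.

Lemma bounded_linear_bound S : bounded_linear S ->
  exists2 M : R, 0 < M & forall x, nrm (S x) <= M * nrm x.
Proof.
move=> [lS cS]; have /cvg_nrmP/(_ 1 ltr01) := cS 0.
rewrite lin0// => /nbhs_ballP[[e b] /= e0].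
have b0 : b = 0 by move: e0; rewrite ltcE /= => /andP[/eqP].
rewrite b0 complexr0 in e0 *; rewrite ltcR in e0.
move=> hb; exists (2 / e) => [|x]; first by rewrite divr_gt0.
have [->|x0] := eqVneq x 0; first by rewrite lin0// nrm0 mulr0.
have nx0 : 0 < nrm x by rewrite lt_neqAle nrm_ge0 eq_sym nrm_eq0 x0.
pose c : R := e / 2 / nrm x.
have c0 : 0 < c by rewrite !divr_gt0.
have : nrm (S (c%:C *: x) - 0) < 1.
  apply: hb; rewrite -ball_normE /= sub0r normrN nrmE ltcR nrmZ nrm_real gtr0_norm//.
  by rewrite /c divfK ?gt_eqF//; lra.
rewrite subr0 linZ// nrmZ nrm_real gtr0_norm// => /ltW.
rewrite -ler_pdivlMl// mulr1 /c => /le_trans; apply.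
by rewrite !invfM !invrK mulrC [X in _ <= X]mulrC [X in _ <= _ * X]mulrC.
Qed.

Lemma bound_continuous S (M : R) : linear S ->
  (forall x, nrm (S x) <= M * nrm x) -> bounded_linear S.
Proof.
move=> lS hM; split=> // x; apply: (@cvg_nrm_le _ _ _ _ _ _ (fun y => M * nrm (y - x))).
  by near=> y; rewrite -linB.
rewrite -(mulr0 M); apply: cvgM; first exact: cvg_cst.
exact: (@cvg_nrm0 _ _ _ _ id x).
Unshelve. all: by end_near. Qed.

Lemma bounded_linear_cvg {T : Type} {F : set_system T} {FF : Filter F} S (u : T -> X) y :
  bounded_linear S -> u x @[x --> F] --> y -> S (u x) @[x --> F] --> S y.
Proof. by move=> [_ cS] uy; apply: continuous_cvg => //; exact: cS. Qed.

(** Otherwise there are nested closed balls, ball [n + 1] avoiding [C n]; by completeness the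
    centres converge, and the limit lies in no [C m]. The first hypothesis says that the sets are
    closed. *)
Lemma baire_closed (C : nat -> set X) :
  (forall m x, ~ C m x -> exists2 r : R, 0 < r & forall y, nrm (y - x) < r -> ~ C m y) ->
  (forall x, exists m, C m x) ->
  exists m (x : X) (r : R), 0 < r /\ forall y, nrm (y - x) < r -> C m y.
Proof.
move=> clC covC; apply: contrapT => noball.
(* Halving both the displacement and the new radius keeps the new closed ball inside the old one. *)
have step (a : nat * (X * R)) : exists b : X * R, 0 < a.2.2 -> [/\ 0 < b.2, b.2 <= a.2.2 / 2,
    nrm (b.1 - a.2.1) <= a.2.2 / 2 & forall y, nrm (y - b.1) <= b.2 -> ~ C a.1 y].
  case: a => m [x r] /=; have [r0|] := ltP 0 r; last by exists (x, r).
  have : exists2 y, nrm (y - x) < r / 2 & ~ C m y.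
    apply: contrapT => h; apply: noball; exists m, x, (r / 2); split; first lra.
    by move=> y hy; apply: contrapT => nC; apply: h; exists y.
  case=> y yx /clC[s s0 hs]; exists (y, Num.min (r / 2) (s / 2)) => _ /=.
  split; [by rewrite lt_min; apply/andP; split; lra | by rewrite ge_min lexx | exact: ltW |].
  move=> z; rewrite le_min => /andP[_ zy]; apply: hs; apply: (le_lt_trans zy); lra.
have [f hf] := choice step.
pose fix ar n := if n is p.+1 then f (p, ar p) else (0 : X, 1 : R).
have ar0 n : 0 < (ar n).2.
  by elim: n => //= n ih; have [] := hf (n, ar n) ih.
have arh n : (ar n).2 <= 2^-1 ^+ n.
  elim: n => [|n ih] //=; have [_ h _ _] := hf (n, ar n) (ar0 n).
  by apply: (le_trans h); rewrite exprS /=; lra.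
(* Each move is paid for by a loss of radius, so distances telescope: the centres are Cauchy and the
   limit stays in every closed ball. *)
have ard n k : nrm ((ar (n + k)%N).1 - (ar n).1) <= (ar n).2 - (ar (n + k)%N).2.
  elim: k => [|k ih]; first by rewrite addn0 !subrr nrm0.
  rewrite addnS; have [_ h1 h2 _] := hf ((n + k)%N, ar (n + k)%N) (ar0 _).
  apply: (le_trans (nrm_tri (ar (n + k)%N).1 _ _)); move: h1 h2 ih => /=; lra.
have [y hy] : exists y : X, (fun n => (ar n).1) @ \oo --> y.
  apply: nrm_cauchy_cvg => e e0.
  have /cvgrPdist_lt/(_ e e0)[N _ hN] : (fun n => (2^-1 : R) ^+ n) @ \oo --> (0 : R).
    by apply: cvg_expr; rewrite ger0_norm ?invf_lt1 ?ltr1n// invr_ge0.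
  exists N => n Nn; rewrite -(subnKC Nn); apply: (le_trans (ard _ _)).
  have := hN N (leqnn _); rewrite sub0r normrN ger0_norm ?exprn_ge0 ?invr_ge0//.
  have := arh N; have := ar0 (N + (n - N))%N; lra.
have [m hm] := covC y.
have [_ _ _ /(_ y)] := hf (m, ar m) (ar0 m); apply => //.
apply: (@cvg_nrm_bound _ _ _ _ (fun n => (ar n).1)) hy.
exists m.+1 => // n /= mn; rewrite -(subnKC mn); apply: (le_trans (ard _ _)).
by have := ar0 (m.+1 + (n - m.+1))%N; rewrite /=; lra.
Qed.

(* The constants are allowed to depend on the vector only through one index [m];
   Baire's theorem makes that index uniform. *)
Lemma uniform_bound (J : Type) (L : J -> X -> X) (D : nat -> J -> Prop) (w : nat -> J -> R) :
  (forall m j, D m j -> bounded_linear (L j)) ->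
  (forall x, exists m, forall j, D m j -> nrm (L j x) <= w m j) ->
  exists m (c : R), 0 < c /\ forall j, D m j -> forall x, nrm (L j x) <= c * w m j * nrm x.
Proof.
move=> bL hx.
have [||m [x0 [r [r0 hr]]]] := @baire_closed (fun m => [set x | forall j, D m j -> nrm (L j x) <= w m j]).
- move=> m x /existsNP[j /not_implyP[Dj /negP]]; rewrite -ltNge => hj.
  have [M M0 hM] := bounded_linear_bound (bL _ _ Dj).
  exists ((nrm (L j x) - w m j) / M) => [|y]; first by rewrite divr_gt0// subr_gt0.
  rewrite ltr_pdivlMr// => hy /(_ j Dj) hjy; have := nrm_sub_sub (L j x) (L j y).
  rewrite -linB; last by case: (bL _ _ Dj).
  have := hM (x - y); rewrite nrm_subC mulrC.
  by have := ler_norm (nrm (L j x) - nrm (L j y)); lra.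
- exact: hx.
exists m, (2 / r); split; first by rewrite divr_gt0.
move=> j Dj x; have lL : linear (L j) by case: (bL _ _ Dj).
(* [2 L y = L (x0 + y) - L (x0 - y)] with both points in the ball, so the value at the centre does
   not enter the bound. *)
have small y : nrm y < r -> nrm (L j y) <= w m j.
  move=> yr; have h1 := hr (x0 + y); have h2 := hr (x0 - y).
  rewrite addrC addKr in h1; rewrite addrC addKr nrmN in h2.
  have := le_trans (nrmB (L j (x0 + y)) (L j (x0 - y))) (lerD (h1 yr j Dj) (h2 yr j Dj)).
  rewrite !(linD lL) (linN lL) opprD opprK addrACA subrr add0r -mulr2n -scaler_nat nrmZ.
  rewrite -[2%:R](rmorph_nat (real_complex R)) nrm_real ger0_norm//; lra.
have [->|x0'] := eqVneq x 0; first by rewrite lin0// nrm0 mulr0.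
have nx0 : 0 < nrm x by rewrite lt_neqAle nrm_ge0 eq_sym nrm_eq0 x0'.
pose c : R := r / 2 / nrm x.
have c0 : 0 < c by rewrite !divr_gt0.
have : nrm (c%:C *: x) < r.
  by rewrite nrmZ nrm_real gtr0_norm// /c divfK ?gt_eqF//; lra.
move/small; rewrite linZ// nrmZ nrm_real gtr0_norm// -ler_pdivlMl// => /le_trans; apply.
by rewrite /c !invfM !invrK; lra.
Qed.

(** The scalar theorem is applied to [phi], the distance to the value at [a]. Composing with the
    1-Lipschitz clamp [cl] onto [[a, b]] makes [phi] differentiable on the whole line, with
    derivative 0. *)
Lemma derivative0_constant (w : R -> X) (a b : R) : a <= b ->
  (forall s, a <= s <= b -> forall e : R, 0 < e -> exists2 d : R, 0 < d &
     forall s', a <= s' <= b -> `|s' - s| < d -> nrm (w s' - w s) <= e * `|s' - s|) ->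
  w a = w b.
Proof.
move=> ab h; pose cl s := Num.max a (Num.min b s).
have cl_in s : a <= cl s <= b by rewrite le_max lexx /= ge_max ab ge_min lexx.
have cl_lip s s' : `|cl s - cl s'| <= `|s - s'|.
  rewrite /cl /Num.max /Num.min.
  by do 4 case: ifPn; rewrite -?leNgt => *; rewrite ler_norml; apply/andP; split;
    have := ler_norm (s - s'); have := ler_norm (s' - s); rewrite distrC; lra.
pose phi s := nrm (w (cl s) - w a).
have dphi (s : R) : is_derive (s : R^o) 1 (phi : R^o -> R^o) 0.
  have hc : h^-1 *: (phi (h *: 1 + s) - phi s) @[h --> 0^'] --> (0 : R).
    apply/cvgrPdist_le => e e0.
    have [d d0 hd] := h _ (cl_in s) _ e0.
    near=> t; rewrite sub0r normrN /= -[_ *: _]/(_ * _) normrM normfV.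
    have t0 : t != 0 by near: t; exact: nbhs_dnbhs_neq.
    rewrite ler_pdivrMl ?normr_gt0// -[_ *: 1]/(_ * _) mulr1.
    have ct := cl_lip (t + s) s; rewrite addrK in ct.
    apply: (le_trans (nrm_sub_sub _ _)); rewrite opprB addrA subrK mulrC.
    apply: (@le_trans _ _ (e * `|cl (t + s) - cl s|)); last by rewrite ler_pM2l.
    apply: hd => //; apply: (le_lt_trans ct).
    by near: t; apply: dnbhs0_lt.
  by split; [apply/cvg_ex; exists 0 | exact: cvg_lim hc].
have := is_derive_0_is_cst a b dphi.
have cla : cl a = a by rewrite /cl (min_idPr ab) maxxx.
have clb : cl b = b by rewrite /cl minxx (max_idPr ab).
by rewrite /phi cla clb subrr nrm0 => /esym/eqP; rewrite nrm_eq0 subr_eq0 => /eqP->.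
Unshelve. all: by end_near. Qed.

End Bounded.
End Norm.

(** * Borel and simple functions *)

Section Borel.
Context {R : realType}.
Local Notation C := R[i].
Implicit Types d : set C.

Let borelE : @borelC R = @measurable _ (g_sigma_algebraType [set U : set R[i]^o | open U]).
Proof. by []. Qed.

Lemma borel_open d : open (d : set R[i]^o) -> borelC d.
Proof. by move=> od; apply: sub_sigma_algebra. Qed.

Lemma borel0 : borelC (set0 : set C).
Proof. by rewrite borelE; exact: measurable0. Qed.

Lemma borelT : borelC (setT : set C).
Proof. by rewrite borelE; exact: measurableT. Qed.

Lemma borel_setC d : borelC d -> borelC (~` d).
Proof. by rewrite borelE; exact: measurableC. Qed.

Lemma borel_setU d d' : borelC d -> borelC d' -> borelC (d `|` d').
Proof. by rewrite borelE; exact: measurableU. Qed.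

Lemma borel_setI d d' : borelC d -> borelC d' -> borelC (d `&` d').
Proof. by rewrite borelE; exact: measurableI. Qed.

Lemma borel_setD d d' : borelC d -> borelC d' -> borelC (d `\` d').
Proof. by rewrite borelE; exact: measurableD. Qed.

Lemma borel_bigcup (F : (set C)^nat) : (forall n, borelC (F n)) -> borelC (\bigcup_n F n).
Proof. by rewrite borelE => h; apply: bigcup_measurable. Qed.

Lemma open_nrmP d : (forall z, d z -> exists2 e : R, 0 < e & forall w, nrm (w - z) < e -> d w) ->
  open (d : set R[i]^o).
Proof.
move=> h; rewrite openE => z /h[e e0 he]; apply/nbhs_ballP; exists e%:C; first by rewrite /= ltcR.
by move=> w; rewrite -ball_normE /= nrmE ltcR nrm_subC; exact: he.
Qed.

Lemma nrmP_open d : open (d : set R[i]^o) ->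
  forall z, d z -> exists2 e : R, 0 < e & forall w, nrm (w - z) < e -> d w.
Proof.
rewrite openE => h z /h /nbhs_ballP[[e b] /= e0].
have b0 : b = 0 by move: e0; rewrite ltcE /= => /andP[/eqP].
rewrite b0 complexr0 in e0 *; rewrite ltcR in e0 => hd.
exists e => // w zw; apply: hd.
by rewrite -ball_normE /= nrmE ltcR nrm_subC.
Qed.

Lemma borel_halfplane (g : C -> R) (r : R) : (forall z w, `|g z - g w| <= nrm (z - w)) ->
  borelC [set w | r <= g w].
Proof.
move=> hg; rewrite -[X in borelC X]setCK; apply: borel_setC; apply: borel_open; apply: open_nrmP => z /= /negP.
rewrite -ltNge => gz; exists (r - g z) => [|w wz]; first lra.
by apply/negP; rewrite -ltNge; have := hg w z; have := ler_norm (g w - g z); lra.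
Qed.

Lemma nrm_lip (c z w : C) : `|nrm (z - c) - nrm (w - c)| <= nrm (z - w).
Proof. by rewrite (le_trans (nrm_sub_sub _ _))// opprB addrA subrK. Qed.

Lemma borel_outside (c : C) (r : R) : borelC [set w | r <= nrm (w - c)].
Proof. by apply: borel_halfplane => z w; exact: nrm_lip. Qed.

Lemma borel_ball (c : C) (r : R) : borelC [set w | nrm (w - c) < r].
Proof.
rewrite -[X in borelC X]setCK; apply: borel_setC.
rewrite (_ : ~` _ = [set w | r <= nrm (w - c)]); first exact: borel_outside.
by apply/seteqP; split=> z /=; rewrite leNgt => /negP.
Qed.

Lemma borel_disc (r : R) : borelC [set w : C | nrm w <= r].
Proof.
rewrite (_ : mkset _ = [set w | - r <= - nrm w]).
  by apply: borel_halfplane => z w; rewrite opprK addrC distrC nrm_sub_sub.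
by apply/seteqP; split=> z /=; rewrite lerN2.
Qed.

Definition borel_fun (G : C -> C) := forall d, borelC d -> borelC (G @^-1` d).

Lemma borel_funP (G : C -> C) : (forall d, open (d : set R[i]^o) -> borelC (G @^-1` d)) -> borel_fun G.
Proof.
move=> h d; apply: (@smallest_sub _ _ _ [set d | borelC (G @^-1` d)]) => //.
split=> /=.
- by rewrite preimage_set0; exact: borel0.
- by move=> A hA; rewrite setTD preimage_setC; exact: borel_setC.
- by move=> F hF; rewrite preimage_bigcup; exact: borel_bigcup.
Qed.

Definition ccont (F : C -> C) := forall z (e : R), 0 < e ->
  exists2 r : R, 0 < r & forall w, nrm (w - z) < r -> nrm (F w - F z) < e.

Lemma borel_fun_cont (G : C -> C) : ccont G -> borel_fun G.
Proof.
move=> hG; apply: borel_funP => d /nrmP_open hd; apply: borel_open; apply: open_nrmP => z /hd[e e0 he].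
by have [r r0 hr] := hG z e e0; exists r => // w /hr /he.
Qed.

Lemma ccont_mul F G : ccont F -> ccont G -> ccont (fun z => F z * G z).
Proof.
move=> cF cG z e e0; have Fz := nrm_ge0 (F z); have Gz := nrm_ge0 (G z).
have K0 : 0 < nrm (F z) + nrm (G z) + 2 by lra.
pose e1 := Num.min 1 (e / (nrm (F z) + nrm (G z) + 2)).
have e10 : 0 < e1 by rewrite lt_min ltr01 divr_gt0.
have e11 : e1 <= 1 by rewrite ge_min lexx.
have e1e : e1 * (nrm (F z) + nrm (G z) + 2) <= e by rewrite -ler_pdivlMr// ge_min lexx orbT.
have [r r0 hr] := cF z e1 e10; have [s s0 hs] := cG z e1 e10.
exists (Num.min r s) => [|w]; first by rewrite lt_min r0.
rewrite lt_min => /andP[/hr Fw /hs Gw].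
have -> : F w * G w - F z * G z = (F w - F z) * (G w - G z + G z) + F z * (G w - G z) by ring.
apply: (le_lt_trans (nrmD _ _)); rewrite !nrmM.
have h1 : nrm (F w - F z) * nrm (G w - G z + G z) <= e1 * (1 + nrm (G z)).
  apply: ler_pM; rewrite ?nrm_ge0//; first exact: ltW.
  by apply: (le_trans (nrmD _ _)); rewrite lerD2r; apply: le_trans e11; exact: ltW.
have h2 : nrm (F z) * nrm (G w - G z) <= nrm (F z) * e1 by rewrite ler_wpM2l// ltW.
lra.
Qed.

Lemma ccont_id : ccont id.
Proof. by move=> z e e0; exists e. Qed.

Lemma ccont_exprn n : ccont (fun z => z ^+ n).
Proof.
elim: n => [|n ih]; first by move=> z e e0; exists 1 => // w _; rewrite !expr0 subrr nrm0.
have -> : (fun z : C => z ^+ n.+1) = (fun z => z * z ^+ n) by apply/funext => z; rewrite exprS.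
by apply: ccont_mul => //; exact: ccont_id.
Qed.

(** Integrals run over the whole plane, so a function that is bounded only on [d] is extended by 0
    before it is integrated. The truncations that define [A] have this form. *)
Definition cut d (F : C -> C) : C -> C := fun z => \1_d z * F z.

Lemma cutT d F z : d z -> cut d F z = F z.
Proof. by move=> dz; rewrite /cut indicE mem_set// mul1r. Qed.

Lemma cutF d F z : ~ d z -> cut d F z = 0.
Proof. by move=> dz; rewrite /cut indicE memNset// mul0r. Qed.

Lemma borel_fun_cut d (F : C -> C) : borelC d -> borel_fun F -> borel_fun (cut d F).
Proof.
move=> hd hF A hA.
rewrite (_ : _ @^-1` _ = (d `&` F @^-1` A) `|` (~` d `&` [set z | A 0])).
  apply: borel_setU; first by apply: borel_setI => //; exact: hF.
  apply: borel_setI; first exact: borel_setC.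
  have [A0|A0] := pselect (A 0).
    by rewrite (_ : mkset _ = setT); [exact: borelT | by apply/seteqP; split].
  by rewrite (_ : mkset _ = set0); [exact: borel0 | by apply/seteqP; split].
apply/seteqP; split=> z /=; have [dz|dz] := pselect (d z).
- by rewrite cutT//; left.
- by rewrite cutF//; right.
- by rewrite cutT// => -[[]|[]].
- by rewrite cutF// => -[[]|[]].
Qed.

(* A Borel partition of the plane indexed by a finite type is a function
   [p : C -> I] with Borel fibres; a simple function is [h \o p]. *)
Definition bpart (I : finType) (p : C -> I) := forall i, borelC (p @^-1` [set i]).

Lemma bpart_pair (I J : finType) (p : C -> I) (q : C -> J) : bpart p -> bpart q ->
  bpart (fun z => (p z, q z)).
Proof.
move=> hp hq [i j]; rewrite (_ : _ @^-1` _ = p @^-1` [set i] `&` q @^-1` [set j]).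
  exact: borel_setI.
by apply/seteqP; split=> z /= [-> ->].
Qed.

Lemma bpart_pred (I : finType) (p : C -> I) (P : pred I) : bpart p -> borelC [set z | P (p z)].
Proof.
move=> hp; rewrite (_ : mkset _ = \big[setU/set0]_(i | P i) p @^-1` [set i]).
  by elim/big_ind : _ => [|A B|i _]; [exact: borel0 | exact: borel_setU | exact: hp].
by rewrite -bigcup_pred; apply/seteqP; split=> [z Pz|z [i Pi /= ->]//]; exists (p z).
Qed.

(** The uniform limits of Borel step functions, that is, the functions for which the integral
    exists. Closure under sums and products is easy here; bounded Borel functions qualify by
    [approx_borel]. *)
Definition approximable (G : C -> C) := forall e : R, 0 < e ->
  exists (I : finType) (p : C -> I) (h : I -> C), bpart p /\ forall z, nrm (G z - h (p z)) <= e.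

Lemma approx_bounded G : approximable G -> exists2 c : R, 0 < c & forall z, nrm (G z) <= c.
Proof.
move=> /(_ 1 ltr01)[I [p [h [_ hp]]]].
exists (1 + \sum_i nrm (h i)) => [|z].
  by rewrite ltr_pwDl// sumr_ge0// => i _; exact: nrm_ge0.
rewrite -(subrK (h (p z)) (G z)); apply: (le_trans (nrmD _ _)); apply: lerD => //.
by rewrite (bigD1 (p z))//= lerDl sumr_ge0// => i _; exact: nrm_ge0.
Qed.

Lemma approx_add G H : approximable G -> approximable H -> approximable (fun z => G z + H z).
Proof.
move=> hG hH e e0; have e2 : 0 < e / 2 by rewrite divr_gt0.
have [I [p [h [bp hp]]]] := hG _ e2; have [J [q [k [bq hq]]]] := hH _ e2.
exists (I * J)%type, (fun z => (p z, q z)), (fun ij => h ij.1 + k ij.2); split; first exact: bpart_pair.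
move=> z /=; rewrite opprD addrACA; apply: (le_trans (nrmD _ _)).
by rewrite (splitr e); apply: lerD.
Qed.

Lemma approx_mul G H : approximable G -> approximable H -> approximable (fun z => G z * H z).
Proof.
move=> hG hH e e0; have [c c0 hc] := approx_bounded hG; have [c' c'0 hc'] := approx_bounded hH.
pose e1 := Num.min 1 (e / (c + c' + 1)).
have e10 : 0 < e1 by rewrite lt_min ltr01 divr_gt0//; lra.
have e11 : e1 <= 1 by rewrite ge_min lexx.
have e1e : e1 * (c + c' + 1) <= e by rewrite -ler_pdivlMr ?ge_min ?lexx ?orbT//; lra.
have [I [p [h [bp hp]]]] := hG _ e10; have [J [q [k [bq hq]]]] := hH _ e10.
exists (I * J)%type, (fun z => (p z, q z)), (fun ij => h ij.1 * k ij.2); split; first exact: bpart_pair.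
move=> z /=.
have -> : G z * H z - h (p z) * k (q z) =
    (G z - h (p z)) * H z + (h (p z) - G z + G z) * (H z - k (q z)) by ring.
apply: (le_trans (nrmD _ _)); rewrite !nrmM.
have h1 : nrm (G z - h (p z)) * nrm (H z) <= e1 * c' by apply: ler_pM; rewrite ?nrm_ge0.
have h2 : nrm (h (p z) - G z + G z) * nrm (H z - k (q z)) <= (e1 + c) * e1.
  apply: ler_pM; rewrite ?nrm_ge0//; apply: (le_trans (nrmD _ _)); apply: lerD => //.
  by rewrite nrm_subC.
have : e1 * e1 <= e1 * 1 by rewrite ler_pM2l.
lra.
Qed.

Lemma approx_const (c : C) : approximable (fun=> c).
Proof.
move=> e e0; exists unit, (fun=> tt), (fun=> c); split => [[]|z]; last by rewrite subrr nrm0 ltW.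
by rewrite (_ : _ @^-1` _ = setT); [exact: borelT | by apply/seteqP; split].
Qed.

Lemma approx_indic d : borelC d -> approximable \1_d.
Proof.
move=> hd e e0; exists bool, (fun z => z \in d), (fun b : bool => (nat_of_bool b)%:R); split; last first.
  by move=> z; rewrite indicE subrr nrm0 ltW.
case; first by rewrite (_ : _ @^-1` _ = d)//; apply/seteqP; split=> z /=; [exact: set_mem | exact: mem_set].
rewrite (_ : _ @^-1` _ = ~` d); first exact: borel_setC.
by apply/seteqP; split=> z /=; [move=> zd /mem_set; rewrite zd | exact: memNset].
Qed.

(** To be used with [g] the real or the imaginary part. The range [[- c, c]] is cut into strips of
    height [e], and each value is replaced by the lower edge of its strip. *)
Lemma approx_coord (g : C -> R) (G : C -> C) (c e : R) :
  (forall z w, `|g z - g w| <= nrm (z - w)) -> borel_fun G -> 0 < c -> 0 < e ->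
  (forall z, `|g (G z)| <= c) ->
  exists (K : nat) (p : C -> 'I_K.+1) (h : 'I_K.+1 -> R), bpart p /\ forall z, `|g (G z) - h (p z)| <= e.
Proof.
move=> lg bG c0 e0 hc.
(* The integer part of [x w] is the number of the strip that contains [g w], counted upwards from
   [- c]. *)
pose x w := (g w + c) / e; pose K := Num.truncn (2 * c / e).
have x_ge0 z : 0 <= x (G z) by apply: divr_ge0; [have := hc z; rewrite ler_norml => /andP[]; lra | exact: ltW].
have xK z : (Num.truncn (x (G z)) < K.+1)%N.
  rewrite ltnS; apply: le_truncn; rewrite ler_pM2r ?invr_gt0//.
  by have := hc z; rewrite ler_norml => /andP[]; lra.
exists K, (fun z => Ordinal (xK z)), (fun i => (i : nat)%:R * e - c); split.
  move=> i; rewrite (_ : _ @^-1` _ = G @^-1` ([set w | i%:R * e - c <= g w] `\` [set w | i.+1%:R * e - c <= g w])).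
    by apply: bG; apply: borel_setD; exact: borel_halfplane.
  have xE (n : nat) w : (n%:R * e - c <= g w) = (n%:R <= x w).
    by rewrite /x ler_pdivlMr// lerBlDr.
  apply/seteqP; split=> z /=; rewrite !xE.
    move=> /(congr1 val) /= <-; have /andP[h1 h2] := truncn_itv (x_ge0 z).
    by split=> //; apply/negP; rewrite -ltNge.
  move=> [h1 /negP]; rewrite -ltNge => h2; apply/val_inj => /=; apply/eqP.
  by rewrite truncn_eq// h1.
move=> z /=; have /andP[h1 h2] := truncn_itv (x_ge0 z).
have gE : g (G z) = x (G z) * e - c by rewrite /x divfK ?gt_eqF// addrK.
rewrite gE opprB addrA subrK -mulrBl normrM (gtr0_norm e0) ger_pMl// ger0_norm ?subr_ge0//.
by rewrite lerBlDr -natr1 addrC in h2 *; exact: ltW.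
Qed.

Lemma approx_borel (G : C -> C) (c : R) : borel_fun G -> (forall z, nrm (G z) <= c) -> approximable G.
Proof.
move=> bG hc e e0; have e2 : 0 < e / 2 by rewrite divr_gt0.
have c0 : 0 < `|c| + 1 by rewrite ltr_pwDr.
have hc' z : nrm (G z) <= `|c| + 1 by have := hc z; have := ler_norm c; lra.
have [|z|K [p [h [bp hp]]]] := @approx_coord (@complex.Re R) G _ _ _ bG c0 e2.
- by move=> z w; rewrite -raddfB; exact: nrm_Re.
- exact: (le_trans (nrm_Re _)).
have [|z|L [q [k [bq hq]]]] := @approx_coord (@complex.Im R) G _ _ _ bG c0 e2.
- by move=> z w; rewrite -raddfB; exact: nrm_Im.
- exact: (le_trans (nrm_Im _)).
exists ('I_K.+1 * 'I_L.+1)%type, (fun z => (p z, q z)), (fun ij => h ij.1 +i* k ij.2).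
split; first exact: bpart_pair.
move=> z /=; apply: (le_trans (nrm_le_ReIm _)); rewrite (splitr e).
by apply: lerD; have := hp z; have := hq z; case: (G z).
Qed.

End Borel.

(** * Boundedness of a spectral measure *)

Section SpectralMeasure.
Context {R : realType} {X : completeNormedModType R[i]}.
Local Notation C := R[i].
Variable E : set C -> X -> X.
Hypothesis hE : spectral_measure E.
Implicit Types (d : set C) (f x : X).

Lemma E_bounded d : borelC d -> bounded_linear (E d).
Proof. by case: hE => h _ _ _ _; exact: h. Qed.

Lemma E_linear d : borelC d -> linear (E d).
Proof. by move=> /E_bounded[]. Qed.

Lemma E0 f : E set0 f = 0.
Proof. by case: hE. Qed.

Lemma ET f : E setT f = f.
Proof. by case: hE. Qed.

Lemma EI d d' f : borelC d -> borelC d' -> E (d `&` d') f = E d (E d' f).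
Proof. by case: hE => _ _ _ h _ hd hd'; exact: h. Qed.

Lemma E_bigcup (d : (set C)^nat) f : (forall n, borelC (d n)) -> trivIset setT d ->
  series (fun n => E (d n) f) @ \oo --> E (\bigcup_n d n) f.
Proof. by case: hE => _ _ _ _ h hd td; exact: h. Qed.

Lemma EU d d' f : borelC d -> borelC d' -> d `&` d' = set0 -> E (d `|` d') f = E d f + E d' f.
Proof.
move=> hd hd' dd'; rewrite -bigcup2E.
have hb n : borelC (bigcup2 d d' n) by case: n => [|[|n]] //=; exact: borel0.
have tb : trivIset setT (bigcup2 d d') by rewrite -trivIset_bigcup2.
apply: (cvg_uniq (E_bigcup (f := f) hb tb)); apply: cvg_near_cst; exists 2%N => // n /= n2.
rewrite /series /= (big_cat_nat (n := 2)) //= [X in _ + X]big_nat [X in _ + X]big1 ?addr0.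
  by rewrite big_mkord !big_ord_recl big_ord0 addr0.
by move=> [|[|i]] //= _; rewrite E0.
Qed.

Lemma ED d d' f : borelC d -> borelC d' -> d' `<=` d -> E (d `\` d') f = E d f - E d' f.
Proof.
move=> hd hd' dd'; rewrite -{2}(setDUK dd') addrC EU ?addKr//; first exact: borel_setD.
by rewrite setDIK.
Qed.

Lemma EC d f : borelC d -> E (~` d) f = f - E d f.
Proof. by move=> hd; rewrite -setTD ED ?ET//; exact: borelT. Qed.

Lemma E_null_sub d d' f : borelC d -> borelC d' -> d' `<=` d -> (forall f, E d f = 0) -> E d' f = 0.
Proof. by move=> hd hd' /setIidr <- h; rewrite EI. Qed.

(* If the range were unbounded, one could repeatedly split an unbounded set [S]
   into two halves carrying measure of norm at least 1, one of which is again
   unbounded; the discarded halves would contradict sigma-additivity. *)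
Lemma E_orbit_bounded f : exists K : R, forall d, borelC d -> nrm (E d f) <= K.
Proof.
apply: contrapT => unb.
pose bad S := borelC S /\ forall K : R, exists d, [/\ borelC d, d `<=` S & K < nrm (E d f)].
have badT : bad setT.
  split=> [|K]; first exact: borelT.
  apply: contrapT => h; apply: unb; exists K => d hd; rewrite leNgt; apply/negP => Kd.
  by apply: h; exists d.
have step S : exists S', bad S -> [/\ bad S', S' `<=` S & 1 <= nrm (E (S `\` S') f)].
  have [[hS bS]|nb] := pselect (bad S); last by exists S => /nb.
  (* The excess 1 over the norm of [E S f] forces both [d] and its complement in [S] to carry
     measure of norm at least 1, so either may be discarded. *)
  have [d [hd dS Ed]] := bS (nrm (E S f) + 1).
  have hSd : borelC (S `\` d) by exact: borel_setD.
  have d1 : 1 <= nrm (E d f) by have := nrm_ge0 (E S f); lra.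
  have Sd1 : 1 <= nrm (E (S `\` d) f).
    by rewrite ED// nrm_subC; have := nrm_sub_sub (E d f) (E S f); rewrite ler_norml => /andP[]; lra.
  have [bd|nbd] := pselect (bad d); first by exists d.
  (* If [d] is not bad, the other half is: bounds on both halves of the subsets of [S] would add up
     to a bound on [S]. *)
  exists (S `\` d) => _; split; [|exact: subDsetl|by rewrite setDD setIidr].
  split=> // K; apply: contrapT => nK; apply: nbd; split=> // K'.
  have [c [hc cS Ec]] := bS (K + K'); exists (c `&` d); split; [exact: borel_setI|exact: subIsetr|].
  have : nrm (E (c `\` d) f) <= K.
    rewrite leNgt; apply/negP => h; apply: nK; exists (c `\` d); split=> //; first exact: borel_setD.
    exact: setSD.
  have cE : E c f = E (c `\` d) f + E (c `&` d) f.
    rewrite addrC -EU ?setUIDK//; [exact: borel_setI|exact: borel_setD|].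
    by apply/seteqP; split=> // z [[_ zd] [_]].
  by have := nrmD (E (c `\` d) f) (E (c `&` d) f); rewrite -cE; lra.
have [g hg] := choice step.
pose S n := iter n g setT.
have bS n : bad (S n) by elim: n => //= n /hg[].
have SS n k : S (n + k)%N `<=` S n.
  elim: k => [|k ih]; first by rewrite addn0.
  by rewrite addnS; have [_ h _] := hg _ (bS (n + k)%N); exact: subset_trans ih.
have hd n : borelC (S n `\` S n.+1) by apply: borel_setD; case: (bS n); case: (bS n.+1).
have tS : trivIset setT (fun n => S n `\` S n.+1).
  apply/trivIsetP => i j _ _ /eqP ij.
  wlog lij : i j ij / (i < j)%N.
    move=> h; have [/h->//|ji|/ij//] := ltngtP i j; rewrite setIC; apply: h => //; exact: nesym.
  apply/seteqP; split=> // z [[_ nz] [zj _]]; apply: nz.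
  by apply: (SS i.+1 (j - i.+1)%N); rewrite subnKC.
have : cvgn (series (fun n => E (S n `\` S n.+1) f)).
  by apply/cvg_ex; exists (E (\bigcup_n (S n `\` S n.+1)) f); exact: E_bigcup.
move/cvg_series_cvg_0/cvg_nrmP/(_ 1 ltr01) => -[N _ /(_ N (leqnn _))] /=.
by rewrite subr0; have [_ _] := hg _ (bS N); rewrite leNgt => /negP.
Qed.

Lemma E_uniform_bound : exists M : R, 0 < M /\ forall d, borelC d -> forall f, nrm (E d f) <= M * nrm f.
Proof.
have [||m [c [c0 hm]]] := @uniform_bound _ _ (set C) E (fun=> borelC) (fun m _ => m%:R).
- by move=> _ d; exact: E_bounded.
- move=> f; have [K hK] := E_orbit_bounded f; exists (Num.truncn K).+1 => d /hK hd.
  by apply: (le_trans hd); exact/ltW/truncnS_gt.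
exists (c * m%:R + 1); split; first by rewrite ltr_wpDl// mulr_ge0// ltW.
move=> d hd f; apply: (le_trans (hm d hd f)); rewrite ler_wpM2r ?nrm_ge0//; lra.
Qed.

Definition mbound : R := projT1 (cid E_uniform_bound).

Lemma mbound_gt0 : 0 < mbound.
Proof. by rewrite /mbound; case: cid => M /= []. Qed.

Lemma mboundP d f : borelC d -> nrm (E d f) <= mbound * nrm f.
Proof. by move=> hd; rewrite /mbound; case: cid => M /= [_ h]; exact: h. Qed.

Section Simple.
Variables (I : finType) (p : C -> I).
Hypothesis bp : bpart p.

Lemma E_bpart d f : borelC d -> E d f = \sum_(i : I) E (d `&` p @^-1` [set i]) f.
Proof.
move=> hd; suff h (s : seq I) : uniq s ->
    E (d `&` [set z | p z \in s]) f = \sum_(i <- s) E (d `&` p @^-1` [set i]) f.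
  rewrite -h ?index_enum_uniq//; congr (E _ f).
  by apply/seteqP; split=> z /= => [zd|[]//]; split=> //; rewrite mem_index_enum.
elim: s => [_|i s ih /= /andP[iS us]].
  by rewrite big_nil (_ : _ `&` _ = set0) ?E0//; apply/seteqP; split=> // z [].
rewrite big_cons -ih// -EU; last 3 first.
- by apply: borel_setI => //; exact: bp.
- by apply: borel_setI => //; exact: (@bpart_pred _ _ p (mem s) bp).
- by apply/seteqP; split=> // z /= [[_ ->] [_]]; exact/negP.
congr (E _ f); apply/seteqP; split=> z /=; rewrite inE.
  by move=> [zd /orP[/eqP|]]; [left|right].
by move=> [[zd ->]|[zd ->]]; rewrite ?eqxx ?orbT.
Qed.

Definition simple_int (h : I -> C) f : X := \sum_(i : I) h i *: E (p @^-1` [set i]) f.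

Lemma simple_int_linear h : linear (simple_int h).
Proof.
move=> c x y; rewrite /simple_int scaler_sumr -big_split; apply: eq_bigr => i _ /=.
by rewrite E_linear// scalerDr !scalerA mulrC.
Qed.

(* The norm of [\sum_i a i *: E (p = i) f] is convex in each [a i], hence at most
   its value at some [a] with entries in {0, 1}, where the sum is some [E d f]. *)
Lemma convex_sum_bound (a : I -> R) f : (forall i, 0 <= a i <= 1) ->
  nrm (\sum_(i : I) (a i)%:C *: E (p @^-1` [set i]) f) <= mbound * nrm f.
Proof.
move=> ha.
suff h (s : seq I) d : uniq s -> borelC d -> (forall z, d z -> p z \notin s) ->
    nrm (E d f + \sum_(i <- s) (a i)%:C *: E (p @^-1` [set i]) f) <= mbound * nrm f.
  by have := h _ set0 (index_enum_uniq I) borel0; rewrite E0 add0r; apply.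
elim: s d => [|i s ih] d; first by rewrite big_nil addr0 => _ hd _; exact: mboundP.
move=> /= /andP[iS us] hd ds; rewrite big_cons.
set S := \sum_(j <- s) _.
have h1 : nrm (E d f + S) <= mbound * nrm f.
  by apply: ih => // z /ds; rewrite inE negb_or => /andP[].
have h2 : nrm (E d f + E (p @^-1` [set i]) f + S) <= mbound * nrm f.
  rewrite -EU//; last first.
    by apply/seteqP; split=> // z /= [/ds + zi]; rewrite zi inE eqxx.
  apply: ih => //; first exact: borel_setU.
  by move=> z /= [/ds|->//]; rewrite inE negb_or => /andP[].
have /andP[a0 a1] := ha i.
have -> : E d f + ((a i)%:C *: E (p @^-1` [set i]) f + S) =
    (1 - a i)%:C *: (E d f + S) + (a i)%:C *: (E d f + E (p @^-1` [set i]) f + S).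
  rewrite (addrAC (E d f) (E _ f) S) rmorphB rmorph1 scalerBl scale1r.
  rewrite [in RHS](scalerDr _ (E d f + S)).
  by rewrite [RHS]addrA subrK addrA addrAC.
apply: (le_trans (nrmD _ _)); rewrite !nrmZ !nrm_real (ger0_norm a0) ger0_norm ?subr_ge0//.
have : (1 - a i) * nrm (E d f + S) <= (1 - a i) * (mbound * nrm f) by rewrite ler_wpM2l// subr_ge0.
have : a i * nrm (E d f + E (p @^-1` [set i]) f + S) <= a i * (mbound * nrm f) by rewrite ler_wpM2l.
lra.
Qed.

(** The factor 4 counts the positive and negative parts of the real and imaginary parts of [h];
    divided by the bound they have values in [0, 1], where [convex_sum_bound] applies. *)
Lemma simple_int_bound (h : I -> C) (c : R) f : (forall z, nrm (h (p z)) <= c) ->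
  nrm (simple_int h f) <= 4 * mbound * c * nrm f.
Proof.
move=> hc.
have c0 : 0 <= c by rewrite (le_trans (nrm_ge0 _) (hc 0)).
(* The division needs a positive bound and [c] may be 0, so the estimate is proved for every [e > c]
   and [e] then decreases to [c]. *)
suff main (e : R) : 0 < e -> c < e -> nrm (simple_int h f) <= 4 * mbound * e * nrm f.
  apply/ler_addgt0Pr => e e0; pose K := 4 * mbound * nrm f + 1.
  have K0 : 0 < K by rewrite ltr_wpDl// !mulr_ge0 ?nrm_ge0 ?ltW// mbound_gt0.
  have eK : 0 < e / K by rewrite divr_gt0.
  apply: (le_trans (main (c + e / K) _ _)); [by rewrite ltr_wpDl|by rewrite ltrDl|].
  have : e / K * K = e by rewrite divfK ?gt_eqF.
  by rewrite /K; nra.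
move=> e0 ce.
(* On an index with empty fibre [h] is not bounded by the hypothesis; its coefficient is set to 0,
   which is harmless as [E set0] vanishes. *)
pose k (g : C -> R) (i : I) : R := if `[< exists z, p z = i >] then Num.max 0 (g (h i)) / e else 0.
have kP (g : C -> R) : (forall z, g z <= nrm z) -> forall i, 0 <= k g i <= 1.
  move=> gn i; rewrite /k; case: asboolP => [[z <-]|_]; last by rewrite lexx ler01.
  rewrite divr_ge0 ?le_max ?lexx ?(ltW e0)//= ler_pdivrMr// mul1r ge_max (ltW e0)/=.
  by apply: (le_trans (gn _)); apply: (le_trans (hc _)); exact: ltW.
have kE (i : I) z : p z = i -> h i = e%:C * ((k (@complex.Re R) i)%:C - (k (fun w => - complex.Re w) i)%:C
    + 'i%C * (k (@complex.Im R) i)%:C - 'i%C * (k (fun w => - complex.Im w) i)%:C).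
  move=> pz; rewrite /k asboolT; last by exists z.
  have maxE (r : R) : r = e * (Num.max 0 r / e - Num.max 0 (- r) / e).
    rewrite -mulrBl mulrC divfK ?gt_eqF// /Num.max; case: ifPn; case: ifPn; rewrite -?leNgt; lra.
  rewrite {1}(complexE (h i)) {1}(maxE (complex.Re (h i))) {1}(maxE (complex.Im (h i))).
  by rewrite !rmorphM !rmorphB /=; ring.
pose S g := \sum_(i : I) (k g i)%:C *: E (p @^-1` [set i]) f.
have SP (g : C -> R) : (forall z, g z <= nrm z) -> nrm (S g) <= mbound * nrm f.
  by move=> gn; apply: convex_sum_bound; exact: kP.
have -> : simple_int h f = e%:C *: (S (@complex.Re R) - S (fun w => - complex.Re w)
    + 'i%C *: S (@complex.Im R) - 'i%C *: S (fun w => - complex.Im w)).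
  rewrite /simple_int /S !scaler_sumr -!sumrN -!big_split /= scaler_sumr; apply: eq_bigr => i _.
  have [[z pz]|nz] := pselect (exists z, p z = i).
    by rewrite {1}(kE i z pz) !scalerA -!scaleNr -!scalerDl scalerA.
  rewrite (_ : p @^-1` _ = set0) ?E0 ?scaler0 ?subr0 ?addr0 ?scaler0//.
  by apply/seteqP; split=> // z pz; apply: nz; exists z.
rewrite nrmZ nrm_real (gtr0_norm e0).
have -> : 4 * mbound * e * nrm f = e * (4 * (mbound * nrm f)) by ring.
rewrite ler_pM2l//.
have h1 : nrm (S (@complex.Re R)) <= mbound * nrm f.
  by apply: SP => z; apply: le_trans (nrm_Re z); exact: ler_norm.
have h2 : nrm (S (fun w => - complex.Re w)) <= mbound * nrm f.
  by apply: SP => z; apply: le_trans (nrm_Re z); rewrite -normrN; exact: ler_norm.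
have h3 : nrm (S (@complex.Im R)) <= mbound * nrm f.
  by apply: SP => z; apply: le_trans (nrm_Im z); exact: ler_norm.
have h4 : nrm (S (fun w => - complex.Im w)) <= mbound * nrm f.
  by apply: SP => z; apply: le_trans (nrm_Im z); rewrite -normrN; exact: ler_norm.
apply: (le_trans (nrmB _ _)); rewrite nrmZ nrm_i mul1r.
have := nrmD (S (@complex.Re R) - S (fun w => - complex.Re w)) ('i%C *: S (@complex.Im R)).
rewrite nrmZ nrm_i mul1r; have := nrmB (S (@complex.Re R)) (S (fun w => - complex.Re w)).
lra.
Qed.

End Simple.
End SpectralMeasure.

(** * Bounded functional calculus *)

(** The composition gets its own name so that the finite-range structure required by the definition
    of the integral can be attached to it. *)
Definition step_fun {R : realType} (I : finType) (p : R[i] -> I) (h : I -> R[i]) : R[i] -> R[i] :=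
  h \o p.

Lemma finite_range_step_fun {R : realType} (I : finType) (p : R[i] -> I) (h : I -> R[i]) :
  finite_set (range (step_fun p h)).
Proof.
apply: (@sub_finite_set _ _ (h @` setT)); first by move=> w [z _ <-]; exists (p z).
by apply: finite_image; exact: finite_finset.
Qed.

HB.instance Definition _ {R : realType} (I : finType) (p : R[i] -> I) (h : I -> R[i]) :=
  FiniteImage.Build R[i] R[i] (step_fun p h) (finite_range_step_fun p h).

Section FunctionalCalculus.
Context {R : realType} {X : completeNormedModType R[i]}.
Local Notation C := R[i].
Variable E : set C -> X -> X.
Hypothesis hE : spectral_measure E.
Implicit Types (d : set C) (f x : X) (G H : C -> C) (I J : finType).
Local Notation M := (mbound hE).
Local Notation SI p h f := (simple_int E p h f).

Section Pair.
Variables (I J : finType) (p : C -> I) (q : C -> J).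
Hypotheses (bp : bpart p) (bq : bpart q).

Lemma simple_int_pair (k : I * J -> C) f :
  SI (fun z => (p z, q z)) k f = \sum_i \sum_j k (i, j) *: E (p @^-1` [set i] `&` q @^-1` [set j]) f.
Proof.
rewrite /simple_int pair_big; apply: eq_bigr => -[i j] _ /=; congr (_ *: E _ f).
by apply/seteqP; split=> z /= [-> ->].
Qed.

Lemma simple_int_fst (h : I -> C) f : SI p h f = SI (fun z => (p z, q z)) (fun ij => h ij.1) f.
Proof.
rewrite simple_int_pair; apply: eq_bigr => i _.
by rewrite (E_bpart hE bq f (bp i)) scaler_sumr.
Qed.

Lemma simple_int_snd (h : J -> C) f : SI q h f = SI (fun z => (p z, q z)) (fun ij => h ij.2) f.
Proof.
rewrite simple_int_pair exchange_big; apply: eq_bigr => j _ /=.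
rewrite (E_bpart hE bp f (bq j)) scaler_sumr; apply: eq_bigr => i _.
by rewrite setIC.
Qed.

Lemma simple_int_comb (c : C) (h : I -> C) (k : J -> C) f :
  c *: SI p h f + SI q k f = SI (fun z => (p z, q z)) (fun ij => c * h ij.1 + k ij.2) f.
Proof.
rewrite simple_int_fst simple_int_snd /simple_int scaler_sumr -big_split.
by apply: eq_bigr => ij _ /=; rewrite scalerA scalerDl.
Qed.

(** Multiplicativity of the calculus starts here, from [E (d & d') = E d E d'] on intersections of
    fibres. *)
Lemma simple_int_mul (h : I -> C) (k : J -> C) f :
  SI p h (SI q k f) = SI (fun z => (p z, q z)) (fun ij => h ij.1 * k ij.2) f.
Proof.
rewrite simple_int_pair; apply: eq_bigr => i _.
rewrite lin_sum ?scaler_sumr; last exact: E_linear.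
apply: eq_bigr => j _; rewrite linZ; last exact: E_linear.
by rewrite -EI// scalerA.
Qed.

(** On the common refinement the difference is again a simple integral. This also gives independence
    of the partition. *)
Lemma simple_int_dist (h : I -> C) (k : J -> C) (c : R) f :
  (forall z, nrm (h (p z) - k (q z)) <= c) -> nrm (SI p h f - SI q k f) <= 4 * M * c * nrm f.
Proof.
move=> hc; rewrite simple_int_fst simple_int_snd /simple_int -sumrB.
under eq_bigr do rewrite -scalerBl.
apply: (@simple_int_bound _ _ _ hE _ (fun z => (p z, q z)) _ (fun ij => h ij.1 - k ij.2)) => //.
exact: bpart_pair.
Qed.

End Pair.

Lemma fimfun_step (s : {fimfun C >-> C}) : borel_simple s ->
  exists I (p : C -> I) (h : I -> C), [/\ bpart p, forall z, h (p z) = s z &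
    forall f, simple_spectral_integral E s f = SI p h f].
Proof.
move=> bs; have fs : finite_set (range s) by exact: fimfunP.
pose r : seq C := finmap.enum_fset (fset_set (range s)).
have ur : uniq r by exact: finmap.fset_uniq.
have sr z : (index (s z) r < size r)%N.
  by rewrite index_mem /r in_fset_set// mem_set//; exists z.
pose p z := Ordinal (sr z); pose h (i : 'I_(size r)) := r`_i.
have pE i : p @^-1` [set i] = s @^-1` [set r`_i].
  apply/seteqP; split=> z /=.
    by move=> /(congr1 val) /= <-; rewrite nth_index// -index_mem.
  by move=> sz; apply/val_inj; rewrite /= sz index_uniq.
exists 'I_(size r), p, h; split.
- by move=> i; rewrite pE; exact: bs.
- by move=> z; rewrite /h nth_index// -index_mem.
move=> f; rewrite /simple_spectral_integral fsbig_finite//= -/r (big_nth 0) big_mkord.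
by apply: eq_bigr => i _; rewrite pE.
Qed.

Lemma step_fun_borel I (p : C -> I) (h : I -> C) : bpart p -> borel_simple (step_fun p h).
Proof.
move=> bp z; rewrite (_ : _ @^-1` _ = [set w | h (p w) == z]).
  exact: (@bpart_pred _ _ p (fun i => h i == z)).
by apply/seteqP; split=> w /eqP.
Qed.

(** For approximable [G] these estimates determine [y], and they let later proofs pick any
    convenient step function instead of handling a limit of a sequence. *)
Definition is_integral G f (y : X) := forall I (p : C -> I) (h : I -> C) (e : R),
  bpart p -> (forall z, nrm (G z - h (p z)) <= e) -> nrm (y - SI p h f) <= 4 * M * e * nrm f.

Lemma integral_mass_gt0 f : 0 < 4 * M * nrm f + 1.
Proof. by rewrite ltr_wpDl// !mulr_ge0 ?nrm_ge0 ?ltW// mbound_gt0. Qed.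

Lemma integral_step_le (e : R) f : 0 < e -> exists2 e' : R, 0 < e' & 4 * M * e' * nrm f <= e.
Proof.
move=> e0; have K0 := integral_mass_gt0 f; exists (e / (4 * M * nrm f + 1)); first by rewrite divr_gt0.
have : e / (4 * M * nrm f + 1) * (4 * M * nrm f + 1) = e by rewrite divfK ?gt_eqF.
have : 0 < e / (4 * M * nrm f + 1) by rewrite divr_gt0.
lra.
Qed.

Local Notation Phi := (bounded_spectral_integral E).

(** The integral is defined by [get]. First its defining set is shown to be inhabited; then the
    estimate is proved for an arbitrary element of the set, so the choice made by [get] is
    irrelevant. *)
Lemma PhiP G f : approximable G -> is_integral G f (Phi G f).
Proof.
move=> aG; rewrite /bounded_spectral_integral; set P := (P in get P).
have : P (get P).
  apply: getPex.
  have inv_gt0 n : 0 < (n.+1%:R : R)^-1 by [].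
  have /choice[t ht] n : exists s : {fimfun C >-> C}, borel_simple s /\ forall z, nrm (G z - s z) <= n.+1%:R^-1.
    have [I [p [h [bp hp]]]] := aG _ (inv_gt0 n).
    by exists (step_fun p h); split=> //; exact: step_fun_borel.
  have small (e : R) : 0 < e -> exists N, forall n, (N <= n)%N -> n.+1%:R^-1 < e.
    move=> e0; exists (Num.truncn e^-1) => n Nn; rewrite invf_plt ?posrE//.
    by apply: (lt_le_trans (truncnS_gt _)); rewrite ler_nat ltnS.
  have [y hy] : exists y : X, (fun n => simple_spectral_integral E (t n) f) @ \oo --> y.
    apply: nrm_cauchy_cvg => e e0; have [e' e'0 he] := integral_step_le f e0.
    have [N hN] := small _ (divr_gt0 e'0 (ltr0n R 2)); exists N => n Nn.
    have [bN tN] := ht N; have [bn tn] := ht n.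
    have [I [p [h [bp hp ->]]]] := fimfun_step bn; have [J [q [k [bq hq ->]]]] := fimfun_step bN.
    apply: (le_trans _ he); apply: simple_int_dist => // z; rewrite hp hq.
    apply: (le_trans (nrm_tri (G z) _ _)); rewrite [X in X + _]nrm_subC.
    rewrite (splitr e'); apply: lerD.
      exact: le_trans (tn z) (ltW (hN _ Nn)).
    exact: le_trans (tN z) (ltW (hN _ (leqnn N))).
  exists y, t; split=> // [n|e e0]; first by case: (ht n).
  have [N hN] := small e e0; exists N => // n /= Nn z.
  by rewrite nrmE ltcR; have [_ /(_ z)/le_lt_trans] := ht n; apply; exact: hN.
(* From here on [y] is any limit of simple integrals along a uniformly convergent sequence. *)
move: (get P) => y [s [bs sG sy]] I p h e bp hp.
apply/ler_addgt0Pr => e1 e10; have [e' e'0 he] := integral_step_le f e10.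
apply: (@le_trans _ _ (4 * M * (e + e') * nrm f)); last by lra.
apply: cvg_nrm_bound sy; have := sG e' e'0; apply: filterS => n hn.
have [J [q [k [bq hq ->]]]] := fimfun_step (bs n).
apply: simple_int_dist => // z; rewrite hq; apply: (le_trans (nrm_tri (G z) _ _)).
by have := hn z; have := hp z; rewrite nrmE ltcR nrm_subC; lra.
Qed.

Lemma Phi_approx G : approximable G -> forall e : R, 0 < e ->
  exists I (p : C -> I) (h : I -> C), [/\ bpart p, forall z, nrm (G z - h (p z)) <= e &
    forall f, nrm (Phi G f - SI p h f) <= 4 * M * e * nrm f].
Proof.
move=> aG e e0; have [I [p [h [bp hp]]]] := aG e e0; exists I, p, h; split=> // f.
exact: PhiP.
Qed.

Lemma Phi_step I (p : C -> I) (h : I -> C) f : bpart p -> Phi (h \o p) f = SI p h f.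
Proof.
move=> bp; have aG : approximable (h \o p).
  by move=> e e0; exists I, p, h; split=> // z; rewrite subrr nrm0 ltW.
apply: nrm_le0_eq => e e0; have [e' e'0 he] := integral_step_le f e0.
by apply: (le_trans _ he); apply: PhiP => // z; rewrite subrr nrm0 ltW.
Qed.

Lemma Phi_indic d f : borelC d -> Phi \1_d f = E d f.
Proof.
move=> hd; pose p z : bool := z \in d; pose h (b : bool) : C := (nat_of_bool b)%:R.
have pT : p @^-1` [set true] = d by apply/seteqP; split=> z; [exact: set_mem | exact: mem_set].
have pF : p @^-1` [set false] = ~` d.
  by apply/seteqP; split=> z; [move=> /= zd /mem_set; rewrite -/(p z) zd | exact: memNset].
have bp : bpart p by case; rewrite ?pT ?pF//; exact: borel_setC.
have -> : \1_d = h \o p by apply/funext => z; rewrite indicE.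
by rewrite Phi_step// /simple_int big_bool /= pT pF /h /= scale1r scale0r addr0.
Qed.

Lemma Phi_linear G : approximable G -> linear (Phi G).
Proof.
move=> aG c x y; apply: nrm_le0_eq => e e0.
pose K := 4 * M * (nrm (c *: x + y) + nrm c * nrm x + nrm y) + 1.
have K0 : 0 < K.
  rewrite ltr_wpDl//; apply: mulr_ge0; first by rewrite mulr_ge0// ltW// mbound_gt0.
  by rewrite !addr_ge0 ?mulr_ge0 ?nrm_ge0.
have eK : 0 < e / K by rewrite divr_gt0.
have [I [p [h [bp _ hp]]]] := Phi_approx aG eK.
have -> : Phi G (c *: x + y) - (c *: Phi G x + Phi G y) =
    (Phi G (c *: x + y) - SI p h (c *: x + y)) - (c *: (Phi G x - SI p h x) + (Phi G y - SI p h y)).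
  rewrite (simple_int_linear hE bp) scalerBr addrACA -opprD opprB.
  by rewrite [RHS]addrA subrK.
apply: (le_trans (nrmB _ _)); have := nrmD (c *: (Phi G x - SI p h x)) (Phi G y - SI p h y).
rewrite nrmZ; have h1 := hp (c *: x + y); have h2 := hp x; have h3 := hp y.
have : nrm c * nrm (Phi G x - SI p h x) <= nrm c * (4 * M * (e / K) * nrm x).
  by rewrite ler_wpM2l ?nrm_ge0.
have : e / K * K = e by rewrite divfK ?gt_eqF.
by rewrite {2}/K; lra.
Qed.

(** [G] is compared with the zero step function on the partition with a single block. *)
Lemma Phi_bound G (c : R) f : approximable G -> (forall z, nrm (G z) <= c) ->
  nrm (Phi G f) <= 4 * M * c * nrm f.
Proof.
move=> aG hc; have bp : bpart (fun _ : C => tt).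
  by case; rewrite (_ : _ @^-1` _ = setT); [exact: borelT | apply/seteqP].
have := @PhiP G f aG _ _ (fun=> 0) c bp; rewrite {1}/simple_int big1 ?subr0; last first.
  by move=> i _; rewrite scale0r.
by apply=> z; rewrite subr0.
Qed.

Lemma Phi_bounded_linear G : approximable G -> bounded_linear (Phi G).
Proof.
move=> aG; have [c c0 hc] := approx_bounded aG.
by apply: (@bound_continuous _ _ _ (4 * M * c)) => [|x]; [exact: Phi_linear | exact: Phi_bound].
Qed.

Lemma Phi_comb (c : C) G H f : approximable G -> approximable H ->
  Phi (fun z => c * G z + H z) f = c *: Phi G f + Phi H f.
Proof.
move=> aG aH; apply: nrm_le0_eq => e e0; have [e' e'0 he] := integral_step_le f e0.
have acG : approximable (fun z => c * G z + H z).
  by apply: approx_add => //; apply: approx_mul => //; exact: approx_const.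
pose e1 := e' / (2 * (nrm c + 1)).
have nc := nrm_ge0 c.
have e10 : 0 < e1 by rewrite divr_gt0//; lra.
have e1E : 2 * e1 * (nrm c + 1) = e' by rewrite /e1; field; lra.
have [I [p [h [bp hp hp']]]] := Phi_approx aG e10.
have [J [q [k [bq hq hq']]]] := Phi_approx aH e10.
apply: (le_trans (nrm_tri (SI (fun z => (p z, q z)) (fun ij => c * h ij.1 + k ij.2) f) _ _)).
have h1 : nrm (Phi (fun z => c * G z + H z) f -
    SI (fun z => (p z, q z)) (fun ij => c * h ij.1 + k ij.2) f) <= 4 * M * ((nrm c + 1) * e1) * nrm f.
  apply: PhiP => //; first exact: bpart_pair.
  move=> z /=; rewrite opprD addrACA -mulrBr; apply: (le_trans (nrmD _ _)); rewrite nrmM.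
  have := ler_wpM2l nc (hp z); have := hq z; lra.
have h2 : nrm (SI (fun z => (p z, q z)) (fun ij => c * h ij.1 + k ij.2) f -
    (c *: Phi G f + Phi H f)) <= 4 * M * ((nrm c + 1) * e1) * nrm f.
  rewrite -simple_int_comb// nrm_subC opprD addrACA -scalerBr; apply: (le_trans (nrmD _ _)).
  by rewrite nrmZ; have := ler_wpM2l nc (hp' f); have := hq' f; lra.
by move: he; rewrite -e1E; lra.
Qed.

Lemma Phi_mul G H f : approximable G -> approximable H ->
  Phi (fun z => G z * H z) f = Phi G (Phi H f).
Proof.
move=> aG aH; have aGH := approx_mul aG aH; apply: nrm_le0_eq => e e0.
have [c c0 hc] := approx_bounded aG; have [c' c'0 hc'] := approx_bounded aH.
pose u := c + c' + 1; have [e1 e10 he1] := integral_step_le f (divr_gt0 e0 (ltr0n R 2)).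
have M0 : 0 < M by exact: mbound_gt0.
(* The first three summands are, per unit of [e2], the errors [h1], [h2] and [h3] below; the last
   keeps [K] positive. *)
pose K := 4 * M * nrm f * u + 4 * M * (4 * M * c' * nrm f) + 4 * M * (c + 1) * (4 * M * nrm f) + 1.
have fn := nrm_ge0 f.
have [M1 c1 c'1] : [/\ 0 <= M, 0 <= c & 0 <= c'] by rewrite !ltW.
have K0 : 0 < K.
  by rewrite ltr_wpDl// !addr_ge0 ?mulr_ge0 ?addr_ge0 ?ler01.
pose e2 := Num.min 1 (e / K).
have e20 : 0 < e2 by rewrite lt_min ltr01 divr_gt0.
have e21 : e2 <= 1 by rewrite ge_min lexx.
have e2K : e2 * K <= e by rewrite -ler_pdivlMr// ge_min lexx orbT.
have [I [p [h [bp hp hp']]]] := Phi_approx aG e20.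
have [J [q [k [bq hq hq']]]] := Phi_approx aH e20.
apply: (le_trans (nrm_tri (SI p h (SI q k f)) _ _)).
have h1 : nrm (Phi (fun z => G z * H z) f - SI p h (SI q k f)) <= 4 * M * (u * e2) * nrm f.
  rewrite simple_int_mul//; apply: PhiP => //; first exact: bpart_pair.
  move=> z /=.
  have -> : G z * H z - h (p z) * k (q z) =
      (G z - h (p z)) * H z + (h (p z) - G z + G z) * (H z - k (q z)) by ring.
  apply: (le_trans (nrmD _ _)); rewrite !nrmM.
  have g1 : nrm (G z - h (p z)) * nrm (H z) <= e2 * c' by apply: ler_pM; rewrite ?nrm_ge0.
  have g2 : nrm (h (p z) - G z + G z) * nrm (H z - k (q z)) <= (1 + c) * e2.
    apply: ler_pM; rewrite ?nrm_ge0//; apply: (le_trans (nrmD _ _)); apply: lerD => //.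
    by rewrite nrm_subC; apply: le_trans e21.
  by rewrite /u; lra.
have h2 : nrm (Phi G (Phi H f) - SI p h (Phi H f)) <= 4 * M * e2 * (4 * M * c' * nrm f).
  apply: (le_trans (hp' _)); apply: ler_wpM2l; last exact: Phi_bound.
  by rewrite !mulr_ge0 ?ltW.
have h3 : nrm (SI p h (Phi H f) - SI p h (SI q k f)) <= 4 * M * (c + 1) * (4 * M * e2 * nrm f).
  rewrite -linB; last exact: simple_int_linear.
  apply: (@le_trans _ _ (4 * M * (c + 1) * nrm (Phi H f - SI q k f))).
    apply: simple_int_bound => // z; rewrite -(subrK (G z) (h (p z))); apply: (le_trans (nrmD _ _)).
    by rewrite nrm_subC; have := hp z; have := hc z; lra.
  by apply: ler_wpM2l => //; rewrite !mulr_ge0 ?addr_ge0 ?ltW.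
have h4 := nrm_tri (SI p h (Phi H f)) (SI p h (SI q k f)) (Phi G (Phi H f)).
rewrite [X in _ <= X + _]nrm_subC [X in _ <= _ + X]nrm_subC in h4.
apply: le_trans e2K; rewrite /K; lra.
Qed.

Lemma Phi_comm G H f : approximable G -> approximable H -> Phi G (Phi H f) = Phi H (Phi G f).
Proof. by move=> aG aH; rewrite -!Phi_mul//; congr (Phi _ f); apply/funext => z; rewrite mulrC. Qed.

Lemma Phi0 f : Phi (fun=> 0) f = 0.
Proof.
apply/eqP; rewrite -nrm_eq0 eq_le nrm_ge0 andbT.
have := @Phi_bound (fun=> 0) 0 f (approx_const 0); rewrite mulr0 mul0r; apply=> _.
by rewrite nrm0.
Qed.

Lemma PhiZ (c : C) G f : approximable G -> Phi (fun z => c * G z) f = c *: Phi G f.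
Proof.
move=> aG; rewrite -[RHS]addr0 -[X in _ = _ + X](Phi0 f) -Phi_comb//; last exact: approx_const.
by congr (Phi _ f); apply/funext => z; rewrite addr0.
Qed.

Lemma PhiB G H f : approximable G -> approximable H ->
  Phi (fun z => G z - H z) f = Phi G f - Phi H f.
Proof.
move=> aG aH; rewrite addrC -scaleN1r -Phi_comb//.
by congr (Phi _ f); apply/funext => z; rewrite mulN1r addrC.
Qed.

End FunctionalCalculus.

(** * The complex exponential *)

Section ComplexExponential.
Context {R : realType}.
Implicit Types (x y : R) (z w : R[i]).

(** Source of the Taylor estimates for [sin] and [cos] and of the second-order one for [expR]: each
    integrates a bound of lower order on the derivative. *)
Lemma mean_value_bound (f df : R -> R) (B y : R) :
  (forall x : R, is_derive x 1 f (df x)) -> (forall x, `|x| <= `|y| -> `|df x| <= B) ->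
  `|f y - f 0| <= B * `|y|.
Proof.
move=> hf hB.
have cf : continuous f.
  by move=> x; apply: differentiable_continuous; apply/derivable1_diffP; have [] := hf x.
have [y0|y0] := leP 0 y.
  have [c] := MVT_segment y0 (fun x _ => hf x) (continuous_subspaceT cf).
  rewrite in_itv /= subr0 => /andP[c0 cy] ->; rewrite normrM ler_wpM2r//; apply: hB.
  by rewrite !ger0_norm.
have [c] := MVT_segment (ltW y0) (fun x _ => hf x) (continuous_subspaceT cf).
rewrite in_itv /= sub0r => /andP[c0 cy] h; rewrite distrC h normrM normrN ler_wpM2r//; apply: hB.
by rewrite !ler0_norm ?lerN2// ltW.
Qed.

Lemma sin_bound y : `|sin y| <= `|y|.
Proof.
have := @mean_value_bound sin cos 1 y (@is_derive_sin R).
by rewrite sin0 subr0 mul1r; apply=> x _; exact: cos_max.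
Qed.

Lemma cos_bound1 y : `|cos y - 1| <= `|y|.
Proof.
have := @mean_value_bound cos (fun x => - sin x) 1 y (@is_derive_cos R).
by rewrite cos0 mul1r; apply=> x _; rewrite normrN; exact: sin_max.
Qed.

Lemma cos_bound2 y : `|cos y - 1| <= y ^+ 2.
Proof.
have := @mean_value_bound cos (fun x => - sin x) `|y| y (@is_derive_cos R).
rewrite cos0 -expr2 real_normK ?num_real//; apply=> x xy; rewrite normrN.
exact: le_trans (sin_bound x) xy.
Qed.

Lemma sin_bound2 y : `|sin y - y| <= y ^+ 2.
Proof.
have h x : is_derive x 1 (fun x => sin x - x) (cos x - 1).
  by apply: is_deriveB.
have := @mean_value_bound _ _ `|y| y h.
rewrite sin0 subrr subr0 -expr2 real_normK ?num_real//; apply=> x xy.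
exact: le_trans (cos_bound1 x) xy.
Qed.

Lemma expR_bound1 x : `|expR x - 1| <= `|x| * expR (Num.max 0 x).
Proof.
have [x0|x0] := leP 0 x.
  have e1 : 1 <= expR x by rewrite -expR0 ler_expR.
  rewrite !ger0_norm ?subr_ge0//.
  have h : expR x * expR (- x) = 1 by rewrite -expRD subrr expR0.
  have := ler_wpM2l (expR_ge0 x) (expR_ge1Dx (- x)); rewrite h; lra.
have e1 : expR x <= 1 by rewrite expR_le1 ltW.
rewrite expR0 mulr1 ler0_norm ?subr_le0// (ltr0_norm x0).
by have := expR_ge1Dx x; lra.
Qed.

Lemma expR_bound1' x : `|expR x - 1| <= `|x| * expR `|x|.
Proof.
apply: (le_trans (expR_bound1 x)); rewrite ler_wpM2l// ler_expR ge_max normr_ge0/=.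
exact: ler_norm.
Qed.

Lemma expR_bound2 x : `|expR x - 1 - x| <= x ^+ 2 * expR `|x|.
Proof.
have h (t : R) : is_derive t 1 (fun x => expR x - 1 - x) (expR t - 1).
  by apply: is_deriveB; rewrite -[X in is_derive _ _ _ X]subr0; apply: is_deriveB.
have := @mean_value_bound _ _ (`|x| * expR `|x|) x h.
rewrite expR0 subrr subr0 subr0 mulrAC -expr2 real_normK ?num_real//; apply=> t tx.
by apply: (le_trans (expR_bound1' t)); rewrite ler_pM// ?expR_ge0// ler_expR.
Qed.

Definition cexp (z : R[i]) : R[i] :=
  (expR (complex.Re z))%:C * (cos (complex.Im z) +i* sin (complex.Im z)).

Lemma cexpD z w : cexp (z + w) = cexp z * cexp w.
Proof.
rewrite /cexp !raddfD /= expRD cosD sinD; apply/eqP; rewrite eq_complex /=.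
by apply/andP; split; apply/eqP; ring.
Qed.

Lemma cexp0 : cexp 0 = 1.
Proof. by rewrite /cexp /= expR0 cos0 sin0 mul1r. Qed.

Lemma nrm_cexp z : nrm (cexp z) = expR (complex.Re z).
Proof.
rewrite /cexp nrmM nrm_real ger0_norm ?expR_ge0//.
by rewrite /nrm normc_def /= cos2Dsin2 sqrtr1 mulr1.
Qed.

(** The growth factor involves only the positive part of the real part, because a spectrum bounded
    on the right may still extend to the left without bound. *)
Lemma cexp_bound1 z : nrm (cexp z - 1) <= 3 * nrm z * expR (Num.max 0 (complex.Re z)).
Proof.
case: z => x y /=; set e := expR (Num.max 0 x).
have -> : cexp (x +i* y) - 1 = (expR x)%:C * ((cos y - 1) +i* sin y) + (expR x - 1)%:C.
  by apply/eqP; rewrite eq_complex /=; apply/andP; split; apply/eqP; ring.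
have hx := nrm_Re (x +i* y); have hy := nrm_Im (x +i* y); rewrite /= in hx hy.
apply: (le_trans (nrmD _ _)); rewrite nrmM !nrm_real (ger0_norm (expR_ge0 _)).
have h1 : nrm ((cos y - 1) +i* sin y) <= 2 * nrm (x +i* y).
  apply: (le_trans (nrm_le_ReIm _)) => /=; have := cos_bound1 y; have := sin_bound y; lra.
have h2 : expR x <= e by rewrite ler_expR le_max lexx orbT.
have h3 : `|x| * e <= nrm (x +i* y) * e by rewrite ler_wpM2r ?expR_ge0.
have h4 : expR x * nrm ((cos y - 1) +i* sin y) <= e * (2 * nrm (x +i* y)).
  by apply: ler_pM; rewrite ?expR_ge0 ?nrm_ge0.
have := expR_bound1 x; rewrite -/e; lra.
Qed.

Lemma cexp_bound2 z : nrm (cexp z - 1 - z) <= 4 * nrm z ^+ 2 * expR `|complex.Re z|.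
Proof.
case: z => x y /=; set e := expR `|x|; set r := nrm (x +i* y).
(* The three pieces contribute 2, 1 and 1 to the constant 4. *)
have -> : cexp (x +i* y) - 1 - (x +i* y) = (expR x)%:C * ((cos y - 1) +i* (sin y - y)) +
    (expR x - 1 - x)%:C + 'i%C * (y * (expR x - 1))%:C.
  by apply/eqP; rewrite eq_complex /=; apply/andP; split; apply/eqP; ring.
have hx := nrm_Re (x +i* y); have hy := nrm_Im (x +i* y); rewrite /= -/r in hx hy.
have e0 : 0 < e by exact: expR_gt0.
have sq t : `|t| <= r -> t ^+ 2 <= r ^+ 2.
  by move=> tr; rewrite -[t ^+ 2]real_normK ?num_real// lerXn2r// nnegrE ?nrm_ge0.
have h1 : nrm ((cos y - 1) +i* (sin y - y)) <= 2 * r ^+ 2.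
  apply: (le_trans (nrm_le_ReIm _)) => /=; have := cos_bound2 y; have := sin_bound2 y.
  have := sq y hy; lra.
have h2 : expR x <= e by rewrite ler_expR ler_norm.
have h3 : `|expR x - 1 - x| <= r ^+ 2 * e.
  by apply: (le_trans (expR_bound2 x)); rewrite ler_pM2r//; exact: sq.
have h4 : `|y * (expR x - 1)| <= r ^+ 2 * e.
  rewrite normrM expr2 -mulrA; apply: ler_pM => //.
  by apply: (le_trans (expR_bound1' x)); rewrite ler_pM2r.
have h5 : expR x * nrm ((cos y - 1) +i* (sin y - y)) <= e * (2 * r ^+ 2).
  by apply: ler_pM; rewrite ?expR_ge0 ?nrm_ge0.
apply: (le_trans (nrmD _ _)); rewrite [nrm ('i%C * _)]nrmM nrm_i mul1r nrm_real.
have := nrmD ((expR x)%:C * ((cos y - 1) +i* (sin y - y))) (expR x - 1 - x)%:C.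
rewrite nrmM !nrm_real (ger0_norm (expR_ge0 _)); lra.
Qed.

Lemma ccont_cexp_scale (t : R) : ccont (fun z => cexp (t%:C * z)).
Proof.
move=> z e e0; set x := expR (complex.Re (t%:C * z)).
have x0 : 0 < x by exact: expR_gt0.
pose K : R := x * (3 * `|t| * expR `|t|) + 1.
have K0 : 0 < K by rewrite ltr_wpDl// !mulr_ge0// ?expR_ge0 ?ltW.
exists (Num.min 1 (e / K)); first by rewrite lt_min ltr01 divr_gt0.
move=> w; rewrite lt_min => /andP[w1]; rewrite ltr_pdivlMr// => wK.
have -> : cexp (t%:C * w) - cexp (t%:C * z) = cexp (t%:C * z) * (cexp (t%:C * (w - z)) - 1).
  by rewrite mulrBr mulr1 -cexpD; congr (cexp _ - _); ring.
rewrite nrmM nrm_cexp -/x; apply: le_lt_trans wK.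
have h1 := cexp_bound1 (t%:C * (w - z)).
have h2 : expR (Num.max 0 (complex.Re (t%:C * (w - z)))) <= expR `|t|.
  rewrite ler_expR ge_max normr_ge0/=; apply: (le_trans (ler_norm _)).
  by apply: (le_trans (nrm_Re _)); rewrite nrmM nrm_real ler_piMr// ltW.
have n0 := nrm_ge0 (w - z).
apply: (@le_trans _ _ (x * (3 * (`|t| * nrm (w - z)) * expR `|t|))).
  rewrite ler_pM2l//; apply: (le_trans h1); rewrite nrmM nrm_real ler_wpM2l//.
  by rewrite !mulr_ge0.
by rewrite /K; lra.
Qed.

Lemma borel_fun_cexp_scale (t : R) : borel_fun (fun z => cexp (t%:C * z)).
Proof. by apply: borel_fun_cont; exact: ccont_cexp_scale. Qed.

(** [v^n / n!] is one term of the exponential series. Raised to the power [beta], this is where the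
    factor [n!^beta] comes from. *)
Lemma exprn_le_fact_expR (v : R) n : 0 <= v -> v ^+ n <= n`!%:R * expR v.
Proof.
move=> v0; case: n => [|n].
  by rewrite expr0 fact0 mul1r; have := expR_ge1Dx v; lra.
have := expR_ge1Dxn n v0; have f0 : 0 < ((n.+1)`!%:R : R) by rewrite ltr0n fact_gt0.
move=> h; rewrite mulrC -ler_pdivrMr//; lra.
Qed.

Lemma powR_expR x (r : R) : expR x `^ r = expR (x * r).
Proof. by rewrite /powR gt_eqF ?expR_gt0// expRK mulrC. Qed.

Lemma powR_exprn x (r : R) n : 0 <= x -> (x `^ r) ^+ n = (x ^+ n) `^ r.
Proof. by move=> x0; rewrite -!powR_mulrn ?powR_ge0// -!powRrM mulrC. Qed.

Lemma powR_le_mono x y (r : R) : 0 <= r -> 0 <= x -> x <= y -> x `^ r <= y `^ r.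
Proof. by move=> r0 x0 xy; apply: ge0_ler_powR; rewrite ?nnegrE// (le_trans x0). Qed.

(** With [u = a - Re z] the region gives [|Im z| <= (u / b)^beta], hence [|z| <= C (1 + u)^beta].
    The [n]-th power of this costs [n!^beta] and an exponential of [1 + u], which [e^(t Re z)]
    absorbs since [t >= c]. *)
Lemma parabola_moment (beta b a c d : R) : 1 <= beta -> 0 < b -> 0 < c -> c <= d ->
  exists alpha K : R, [/\ 0 < alpha, 0 < K & forall n t z, c <= t <= d ->
    complex.Re z <= a - b * `|complex.Im z| `^ beta^-1 ->
    nrm z ^+ n * expR (t * complex.Re z) <= K * alpha ^+ n * (n`!%:R `^ beta)].
Proof.
move=> beta1 b0 c0 cd; have beta0 : 0 < beta by lra.
pose C : R := `|a| + 1 + b^-1 `^ beta.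
have C0 : 0 < C by rewrite ltr_pwDl ?powR_ge0// ltr_wpDl.
(* Chosen so that [e^((1 + u) / g)] raised to the power [beta] is exactly [e^(c (1 + u))], to be
   cancelled against [e^(- c u)]. *)
pose g : R := beta / c; have g0 : 0 < g by rewrite divr_gt0.
exists (C * g `^ beta), (expR (c + d * `|a|)); split; first by rewrite mulr_gt0// powR_gt0.
  exact: expR_gt0.
move=> n t z /andP[ct td] hz.
set x := complex.Re z in hz *; pose u := a - x.
have u0 : 0 <= u by rewrite /u; have := mulr_ge0 (ltW b0) (powR_ge0 `|complex.Im z| beta^-1); lra.
have hIm : `|complex.Im z| <= (u / b) `^ beta.
  have h : `|complex.Im z| `^ beta^-1 <= u / b by rewrite ler_pdivlMr// mulrC /u; lra.
  rewrite -[leLHS]powRr1// -(mulVf (lt0r_neq0 beta0)) powRrM.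
  by apply: powR_le_mono; rewrite ?powR_ge0// ltW.
have v1 : 1 <= 1 + u by rewrite lerDl.
(* By [1 <= beta] the real part, of size at most [|a| + u], grows no faster than the bound on the
   imaginary part. *)
have V1 : 1 + u <= (1 + u) `^ beta by exact: le1r_powR.
have nz : nrm z <= C * (1 + u) `^ beta.
  apply: (le_trans (nrm_le_ReIm _)).
  have h1 : `|x| <= `|a| + u.
    by rewrite (_ : x = a - u); [apply: (le_trans (ler_normB _ _)); rewrite (ger0_norm u0)|rewrite /u; ring].
  have h2 : (u / b) `^ beta <= (1 + u) `^ beta * b^-1 `^ beta.
    have b1 : 0 <= b^-1 by rewrite invr_ge0 ltW.
    rewrite powRM// ler_wpM2r ?powR_ge0//.
    by apply: powR_le_mono; lra.
  have h3 : `|a| * 1 <= `|a| * (1 + u) `^ beta by rewrite ler_wpM2l//; lra.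
  rewrite -/x /C; lra.
have hn : nrm z ^+ n <= C ^+ n * ((1 + u) ^+ n) `^ beta.
  rewrite -powR_exprn -?exprMn; last lra.
  by rewrite lerXn2r// nnegrE ?nrm_ge0// mulr_ge0 ?powR_ge0 ?ltW.
have hv : ((1 + u) ^+ n) `^ beta <= n`!%:R `^ beta * (g `^ beta) ^+ n * expR (c * (1 + u)).
  have cg : c * g = beta by rewrite /g mulrC divfK ?gt_eqF.
  have v0 : 0 <= (1 + u) / g by rewrite divr_ge0//; lra.
  have vE : 1 + u = g * ((1 + u) / g) by rewrite mulrC divfK ?gt_eqF.
  have h : (1 + u) ^+ n <= n`!%:R * g ^+ n * expR ((1 + u) / g).
    rewrite {1}vE exprMn [leRHS]mulrAC [leRHS]mulrC.
    by rewrite ler_wpM2l ?exprn_le_fact_expR// exprn_ge0// ltW.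
  have g0n : 0 <= g ^+ n by rewrite exprn_ge0// ltW.
  have f0n : 0 <= (n`!%:R : R) by [].
  have -> : c * (1 + u) = (1 + u) / g * beta by rewrite -cg; field; lra.
  rewrite -powR_expR powR_exprn ?(ltW g0)// -!powRM ?mulr_ge0 ?expR_ge0//.
  by apply: powR_le_mono; rewrite ?exprn_ge0//; lra.
have he : expR (t * x) * expR (c * (1 + u)) <= expR (c + d * `|a|).
  rewrite -expRD ler_expR /u.
  have : t * a <= d * `|a|.
    apply: (@le_trans _ _ (t * `|a|)); first by rewrite ler_wpM2l ?ler_norm//; lra.
    by rewrite ler_wpM2r.
  have : (t - c) * u >= 0 by rewrite mulr_ge0//; lra.
  rewrite /u; lra.
apply: (@le_trans _ _ (C ^+ n * (n`!%:R `^ beta * (g `^ beta) ^+ n * expR (c * (1 + u))) * expR (t * x))).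
  rewrite ler_wpM2r ?expR_ge0//; apply: (le_trans hn).
  by rewrite ler_wpM2l// exprn_ge0// ltW.
rewrite exprMn; set p := C ^+ n; set q := _ ^+ n; set r := _ `^ _.
have pqr : 0 <= p * q * r by rewrite !mulr_ge0 ?powR_ge0 ?exprn_ge0 ?powR_ge0 ?ltW.
by have := ler_wpM2l pqr he; lra.
Qed.

End ComplexExponential.

(** * The support of a spectral measure *)

Section Support.
Context {R : realType} {X : completeNormedModType R[i]}.
Local Notation C := R[i].
Variable E : set C -> X -> X.
Hypothesis hE : spectral_measure E.
Implicit Types (d : set C) (f x : X) (F G H : C -> C).
Local Notation M := (mbound hE).
Local Notation Phi := (bounded_spectral_integral E).
Local Notation D := (spectral_support E).

Lemma borel_fun_id : borel_fun (@id C).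
Proof. by []. Qed.

(** As [0^-1 = 0], the function is total and continuous except at [c]. A preimage is the union of an
    open set avoiding [c] and a subset of the point [c]. *)
Lemma borel_fun_inv (c : C) : borel_fun (fun z => (z - c)^-1).
Proof.
apply: borel_funP => d od; set P := _ @^-1` d.
have hc : borelC (~` [set w | 0 < nrm (w - c)]).
  apply: borel_setC; apply: borel_open; apply: open_nrmP => z /= zc.
  exists (nrm (z - c)) => // w wz; have := nrm_tri w z c.
  by rewrite [X in _ <= X + _]nrm_subC; lra.
have PcE : P = (P `&` [set w | 0 < nrm (w - c)]) `|` (~` [set w | 0 < nrm (w - c)] `&` [set _ | d 0]).
  have z0 z : ~ (0 < nrm (z - c)) -> (z - c)^-1 = 0.
    move/negP; rewrite -leNgt => h; have /eqP : nrm (z - c) = 0 by apply/eqP; rewrite eq_le h nrm_ge0.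
    by rewrite nrm_eq0 => /eqP ->; rewrite invr0.
  apply/seteqP; split=> z /=.
    move=> Pz; have [h|h] := pselect (0 < nrm (z - c)); first by left.
    by right; split=> //; rewrite -(z0 z).
  by move=> [[]//|[/z0 h d0]]; rewrite /P /= h.
rewrite PcE; apply: borel_setU; last first.
  apply: borel_setI => //; have [d0|d0] := pselect (d 0).
    by rewrite (_ : mkset _ = setT); [exact: borelT | by apply/seteqP; split].
  by rewrite (_ : mkset _ = set0); [exact: borel0 | by apply/seteqP; split].
apply: borel_open; apply: open_nrmP => z [Pz /= zc].
have [e e0 he] := nrmP_open od Pz; set r := nrm (z - c) in zc.
(* [m <= r / 2] keeps [w] at distance more than [r / 2] from [c], so the difference of the inverses
   is below [2 m / r^2 <= e / 2]. *)
have [m [m0 m1 m2]] : exists m : R, [/\ 0 < m, m <= r / 2 & m <= e * r ^+ 2 / 4].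
  exists (Num.min (r / 2) (e * r ^+ 2 / 4)); split; [|by rewrite ge_min lexx|by rewrite ge_min lexx orbT].
  by rewrite lt_min; apply/andP; split; rewrite divr_gt0// mulr_gt0// exprn_gt0.
exists m => // w wz.
have wr : r / 2 < nrm (w - c).
  have := nrm_tri w z c; rewrite -/r [X in _ <= X + _]nrm_subC; lra.
split; last by apply: lt_trans wr; lra.
apply: he; have w0 : w - c != 0 by rewrite -nrm_eq0 gt_eqF//; lra.
have z0 : z - c != 0 by rewrite -nrm_eq0 gt_eqF.
have -> : (w - c)^-1 - (z - c)^-1 = (z - w) / ((w - c) * (z - c)) by field; rewrite w0 z0.
rewrite nrmM nrmV nrmM -/r ltr_pdivrMr; last by rewrite mulr_gt0//; lra.
rewrite nrm_subC; apply: (lt_le_trans wz); apply: (le_trans m2).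
have : r / 2 * r <= nrm (w - c) * r by rewrite ler_wpM2r// ltW.
move=> h; have := ler_wpM2l (ltW e0) h; rewrite expr2; nra.
Qed.

Lemma E_bigcup_null (V : (set C)^nat) f : (forall n, borelC (V n)) ->
  (forall n f, E (V n) f = 0) -> E (\bigcup_n V n) f = 0.
Proof.
move=> bV nV; rewrite seqDU_bigcup_eq.
have bU n : borelC (seqDU V n).
  by apply: borel_setD => //; apply: big_ind => [|A B|i _]; [exact: borel0|exact: borel_setU|exact: bV].
apply: (cvg_uniq (E_bigcup hE (f := f) bU (trivIset_seqDU V))).
apply: cvg_near_cst; near=> n; rewrite /series /= big1// => i _.
by apply: (@E_null_sub _ _ _ hE (V i)) => //; exact: subset_seqDU.
Unshelve. all: by end_near. Qed.

Lemma support_complP z : ~ D z -> exists2 e : R, 0 < e & forall f, E [set w | nrm (w - z) < e] f = 0.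
Proof.
move=> nD; apply: contrapT => h; apply: nD => U oU Uz; apply: contrapT => nU; apply: h.
have [e e0 he] := nrmP_open oU Uz; exists e => // f.
apply: (@E_null_sub _ _ _ hE U) => //; first exact: borel_open.
- exact: borel_ball.
- by move=> g; apply: contrapT => Eg; apply: nU; exists g; apply/eqP.
Qed.

Lemma supportP z : D z -> forall e : R, 0 < e -> exists f, E [set w | nrm (w - z) < e] f != 0.
Proof.
move=> Dz e e0; apply: Dz; last by rewrite /= subrr nrm0.
apply: open_nrmP => w /= we; exists (e - nrm (w - z)) => [|v vw]; first lra.
by have := nrm_tri w v z; lra.
Qed.

Lemma borel_support : borelC D.
Proof.
rewrite -[X in borelC X]setCK; apply: borel_setC; apply: borel_open; apply: open_nrmP.
move=> z /support_complP[e e0 he]; exists (e / 2) => [|w wz]; first lra.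
move=> /supportP/(_ (e / 2)) [|f /eqP]; [lra|apply].
apply: (@E_null_sub _ _ _ hE [set w | nrm (w - z) < e]); [exact: borel_ball|exact: borel_ball| |exact: he].
by move=> v /= vw; have := nrm_tri w v z; lra.
Qed.

(** A Lindelof argument: the complement of the support is covered by countably many null discs, with
    rational centres and radii [1 / (k + 1)]. *)
Lemma E_support f : E D f = f.
Proof.
suff h : E (~` D) f = 0 by have := EC hE f borel_support; rewrite h => /esym/eqP; rewrite subr_eq0 => /eqP.
pose U (q : rat * rat * nat) := [set w | nrm (w - (ratr q.1.1 +i* ratr q.1.2)) < (q.2.+1%:R : R)^-1].
(* An enumeration of the rational discs in which those that are not null, and the numbers that code
   no disc, are replaced by the empty set. *)
pose V n := if unpickle n is Some q then (if `[< forall f, E (U q) f = 0 >] then U q else set0) else set0.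
have bV n : borelC (V n).
  by rewrite /V; case: unpickle => [q|]; [case: ifP => _; [exact: borel_ball|exact: borel0]|exact: borel0].
have nV n g : E (V n) g = 0.
  by rewrite /V; case: unpickle => [q|]; [case: asboolP => // _|]; exact: E0.
apply: (@E_null_sub _ _ _ hE (\bigcup_n V n)).
- exact: borel_bigcup.
- by apply: borel_setC; exact: borel_support.
- move=> z /support_complP[e e0 he].
  have [k hk] : exists k : nat, (k.+1%:R : R)^-1 < e / 2.
    exists (Num.truncn (e / 2)^-1); rewrite invf_plt ?posrE ?divr_gt0//; exact: truncnS_gt.
  set r := (k.+1%:R : R)^-1 in hk; have r0 : 0 < r by rewrite /r invr_gt0.
  have [q1] := @rat_in_itvoo R (complex.Re z) (complex.Re z + r / 2) ltac:(lra).
  rewrite in_itv /= => /andP[q1a q1b].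
  have [q2] := @rat_in_itvoo R (complex.Im z) (complex.Im z + r / 2) ltac:(lra).
  rewrite in_itv /= => /andP[q2a q2b].
  have zU : nrm (z - (ratr q1 +i* ratr q2)) < r.
    apply: (le_lt_trans (nrm_le_ReIm _)); case: z q1a q1b q2a q2b {he} => x y /= q1a q1b q2a q2b.
    by rewrite (ltr0_norm (x := x - _)) ?(ltr0_norm (x := y - _)); lra.
  exists (pickle (q1, q2, k)); first exact: I.
  rewrite /V pickleK asboolT; first exact: zU.
  move=> g.
  apply: (@E_null_sub _ _ _ hE [set w | nrm (w - z) < e]) => //; [exact: borel_ball|exact: borel_ball|].
  move=> w; rewrite /U /= -/r => wq; have := nrm_tri (ratr q1 +i* ratr q2) w z.
  by rewrite [X in _ <= _ + X]nrm_subC; lra.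
- by move=> g; exact: E_bigcup_null.
Qed.

Definition disc (n : nat) : set C := [set w | nrm w <= n%:R].

Lemma borel_discn n : borelC (disc n).
Proof. exact: borel_disc. Qed.

(** Sigma-additivity on the annuli between consecutive discs. This density statement is what reduces
    unbounded functions of [z] to bounded ones. *)
Lemma disc_cvg f : E (disc n) f @[n --> \oo] --> f.
Proof.
have ndd : nondecreasing_seq disc.
  apply/nondecreasing_seqP => n; apply/subsetPset => z /= h; apply: (le_trans h).
  by rewrite ler_nat.
have bd n : borelC (seqD disc n).
  by case: n => [|n]; [exact: borel_discn | apply: borel_setD; exact: borel_discn].
have dT : \bigcup_n seqD disc n = setT.
  rewrite eq_bigcup_seqD; apply/seteqP; split=> // z _.
  exists (Num.truncn (nrm z)).+1 => //; exact/ltW/truncnS_gt.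
have := E_bigcup hE (f := f) bd (trivIset_seqD ndd); rewrite dT ET// => h.
apply/cvg_nrmP => e e0; have /cvg_nrmP/(_ e e0)[N _ hN] := h.
exists N => // n /= Nn; have := hN n.+1 (leqW Nn).
suff -> : \sum_(0 <= k < n.+1) E (seqD disc k) f = E (disc n) f by [].
elim: n {Nn} => [|n ih]; first by rewrite big_nat1.
rewrite big_nat_recr//= ih ED//; [by rewrite addrC subrK|exact: borel_discn|exact: borel_discn|].
by move=> z /= zn; apply: (le_trans zn); rewrite ler_nat.
Qed.

Lemma approx_cut d F (c : R) : borelC d -> borel_fun F -> (forall z, d z -> nrm (F z) <= c) ->
  approximable (cut d F).
Proof.
move=> bd bF hc; apply: (@approx_borel _ _ `|c|); first exact: borel_fun_cut.
move=> z; have [dz|dz] := pselect (d z); last by rewrite cutF// nrm0.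
by rewrite cutT//; apply: (le_trans (hc _ dz)); exact: ler_norm.
Qed.

Lemma Phi_cut_bound d F (c : R) f : approximable (cut d F) -> 0 <= c ->
  (forall z, d z -> nrm (F z) <= c) -> nrm (Phi (cut d F) f) <= 4 * M * c * nrm f.
Proof.
move=> aF c0 hc; apply: Phi_bound => // z; have [dz|dz] := pselect (d z); last by rewrite cutF// nrm0.
by rewrite cutT//; exact: hc.
Qed.

Lemma eq_approx G H : (forall z, G z = H z) -> approximable G -> approximable H.
Proof. by move=> /funext ->. Qed.

Lemma approx_cut_mul d F G : approximable (cut d F) -> approximable (cut d G) ->
  approximable (cut d (fun z => F z * G z)).
Proof.
move=> aF aG; apply: eq_approx (approx_mul aF aG) => z.
by rewrite -[in RHS](setIid d) /cut indicI /=; ring.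
Qed.

Lemma approx_cut_comb d (c : C) F G : approximable (cut d F) -> approximable (cut d G) ->
  approximable (cut d (fun z => c * F z + G z)).
Proof.
move=> aF aG; apply: eq_approx (approx_add (approx_mul (approx_const c) aF) aG) => z.
by rewrite /cut; ring.
Qed.

Lemma approx_cut_sub d d' F : borelC d' -> approximable (cut d F) -> approximable (cut (d `&` d') F).
Proof.
move=> bd' aF; apply: eq_approx (approx_mul aF (approx_indic bd')) => z.
by rewrite /cut indicI /=; ring.
Qed.

Lemma approx_cut1 d : borelC d -> approximable (cut d (fun=> 1)).
Proof.
by move=> bd; apply: eq_approx (approx_indic bd) => z; rewrite /cut mulr1.
Qed.

Lemma Phi_cut_comb d (c : C) F G f : approximable (cut d F) -> approximable (cut d G) ->
  Phi (cut d (fun z => c * F z + G z)) f = c *: Phi (cut d F) f + Phi (cut d G) f.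
Proof.
move=> aF aG; rewrite -Phi_comb//; congr (Phi _ f); apply/funext => z.
by rewrite /cut; ring.
Qed.

Lemma Phi_cutB d F G f : approximable (cut d F) -> approximable (cut d G) ->
  Phi (cut d (fun z => F z - G z)) f = Phi (cut d F) f - Phi (cut d G) f.
Proof.
by move=> aF aG; rewrite -PhiB//; congr (Phi _ f); apply/funext => z; rewrite /cut mulrBr.
Qed.

Lemma Phi_cutZ d (c : C) F f : approximable (cut d F) ->
  Phi (cut d (fun z => c * F z)) f = c *: Phi (cut d F) f.
Proof.
by move=> aF; rewrite -PhiZ//; congr (Phi _ f); apply/funext => z; rewrite /cut mulrCA.
Qed.

Lemma Phi_cut1 d f : borelC d -> Phi (cut d (fun=> 1)) f = E d f.
Proof.
by move=> bd; rewrite -(Phi_indic hE)//; congr (Phi _ f); apply/funext => z; rewrite /cut mulr1.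
Qed.

Lemma cut_mul d d' F G z : cut d F z * cut d' G z = cut (d `&` d') (fun z => F z * G z) z.
Proof. by rewrite /cut indicI /=; ring. Qed.

Lemma cut1 d : cut d (fun=> 1) = \1_d.
Proof. by apply/funext => z; rewrite /cut mulr1. Qed.

Lemma eq_cut d F G : (forall z, d z -> F z = G z) -> cut d F = cut d G.
Proof.
move=> h; apply/funext => z; have [dz|dz] := pselect (d z); last by rewrite !cutF.
by rewrite !cutT// h.
Qed.

Lemma Phi_cut_mul d d' F G f : approximable (cut d F) -> approximable (cut d' G) ->
  Phi (cut d F) (Phi (cut d' G) f) = Phi (cut (d `&` d') (fun z => F z * G z)) f.
Proof.
by move=> aF aG; rewrite -Phi_mul//; congr (Phi _ f); apply/funext => z; exact: cut_mul.
Qed.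

Lemma Phi_cut_E d d' F f : approximable (cut d F) -> borelC d' ->
  Phi (cut d F) (E d' f) = Phi (cut (d `&` d') F) f.
Proof.
move=> aF bd'; rewrite -(Phi_indic hE)// -cut1 Phi_cut_mul//; last by rewrite cut1; exact: approx_indic.
by congr (Phi _ f); apply: eq_cut => z _; rewrite mulr1.
Qed.

Lemma E_Phi_cut d d' F f : approximable (cut d F) -> borelC d' ->
  E d' (Phi (cut d F) f) = Phi (cut (d' `&` d) F) f.
Proof.
move=> aF bd'; rewrite -(Phi_indic hE)// -cut1 Phi_cut_mul//; last by rewrite cut1; exact: approx_indic.
by congr (Phi _ f); apply: eq_cut => z _; rewrite mul1r.
Qed.

(** The easy half of the Banach-Steinhaus theorem: a uniformly bounded family converges once it does
    on the vectors [E (disc n) f], where Taylor estimates are uniform in [z]. *)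
Lemma strong_cvg {T : Type} {F : set_system T} {FF : Filter F} (L : T -> X -> X) (L0 : X -> X) (K : R) f :
  0 <= K -> linear L0 -> (forall x, nrm (L0 x) <= K * nrm x) ->
  (\forall t \near F, linear (L t) /\ forall x, nrm (L t x) <= K * nrm x) ->
  (forall n, L t (E (disc n) f) @[t --> F] --> L0 (E (disc n) f)) ->
  L t f @[t --> F] --> L0 f.
Proof.
move=> K0 lL0 bL0 bL hn; apply/cvg_nrmP => e e0.
have K1 : 0 < 2 * K + 1 by lra.
have e2 : 0 < e / 2 by lra.
have eK : 0 < e / 2 / (2 * K + 1) by rewrite divr_gt0.
have /cvg_nrmP/(_ _ eK)[N _ /(_ N (leqnn _)) /= hN] := @disc_cvg f.
have /cvg_nrmP/(_ _ e2) hN' := hn N.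
near=> t; have [lL bLt] : linear (L t) /\ forall x, nrm (L t x) <= K * nrm x by near: t.
have ht : nrm (L t (E (disc N) f) - L0 (E (disc N) f)) < e / 2 by near: t.
apply: (le_lt_trans (nrm_tri (L t (E (disc N) f)) _ _)).
apply: (le_lt_trans (lerD (lexx _) (nrm_tri (L0 (E (disc N) f)) _ _))).
have h1 := bLt (f - E (disc N) f); rewrite linB// nrm_subC in h1.
have h2 := bL0 (E (disc N) f - f); rewrite linB// in h2.
rewrite nrm_subC [X in _ <= _ * X]nrm_subC in h1.
rewrite ltr_pdivlMr// in hN.
have := nrm_ge0 (E (disc N) f - f); lra.
Unshelve. all: by end_near. Qed.

End Support.

(** * Generation of the semigroup *)

Section Generation.
Context {R : realType} {X : completeNormedModType R[i]}.
Local Notation C := R[i].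
Variables (A : operator X) (E : set C -> X -> X).
Hypothesis hE : spectral_measure E.
Hypothesis hsupp : spectral_support E = spectrum A.
Hypothesis hA : op_eq A (spectral_integral E (spectrum A) id).
Implicit Types (d : set C) (f x : X) (F G H : C -> C).
Local Notation M := (mbound hE).
Local Notation Phi := (bounded_spectral_integral E).
Local Notation D := (spectral_support E).
Local Notation B n := (D `&` disc n).

Lemma cvg0_right (c : R) : c * t @[t --> 0^'+] --> (0 : R).
Proof.
apply/cvgrPdist_lt => e e0; have K0 : 0 < `|c| + 1 by rewrite ltr_wpDl.
near=> t; have t0 : 0 < t by near: t; exact: nbhs_right_gt.
have : t < e / (`|c| + 1) by near: t; apply: nbhs_right_lt; rewrite divr_gt0.
by rewrite ltr_pdivlMr// sub0r normrN normrM (gtr0_norm t0); lra.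
Unshelve. all: by end_near. Qed.

Lemma borel_band n : borelC (B n).
Proof. by apply: borel_setI; [exact: borel_support hE | exact: borel_discn]. Qed.

Lemma E_disc_band n f : E (disc n) f = Phi (cut (B n) (fun=> 1)) f.
Proof.
rewrite Phi_cut1//; last exact: borel_band.
by rewrite setIC EI// ?(E_support hE)//; [exact: borel_discn | exact: borel_support hE].
Qed.

Lemma approx_band_id n : approximable (cut (B n) id).
Proof. by apply: (@approx_cut _ _ _ n%:R); [exact: borel_band | exact: borel_fun_id | move=> z []]. Qed.

Lemma truncation_id n : truncation (spectrum A) id n = cut (B n) id.
Proof.
rewrite /truncation /cut -hsupp; apply/funext => z; congr (\1_(D `&` _) z * z).
apply/seteqP; split=> w /=; rewrite nrmE -(@rmorph_nat _ _ (real_complex R)) lecR//.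
Qed.

Lemma A_graphP f y : (op_dom A f /\ A f = y) <-> Phi (cut (B n) id) f @[n --> \oo] --> y.
Proof.
have [domE valE] := hA.
have trE : (fun n => Phi (truncation (spectrum A) id n) f) = (fun n => Phi (cut (B n) id) f).
  by apply/funext => n; rewrite truncation_id.
split=> [[fA <-]|fy].
  by rewrite valE//; move: fA; rewrite domE /= trE.
have fA : op_dom A f by rewrite domE /= trE; apply/cvg_ex; exists y.
by split=> //; rewrite valE//= trE; apply: cvg_lim => //; exact: norm_hausdorff.
Qed.

(** On the range of [E (disc n)] the truncated integrals are constant from index [n] on. *)
Lemma A_disc n f : op_dom A (E (disc n) f) /\ A (E (disc n) f) = Phi (cut (B n) id) f.
Proof.
apply/A_graphP; apply: cvg_near_cst; exists n => // m /= nm.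
rewrite Phi_cut_E//; [|exact: approx_band_id|exact: borel_discn].
congr (Phi (cut _ id) f); rewrite -setIA; congr (D `&` _); apply/setIidr.
by move=> z /= zn; apply: (le_trans zn); rewrite ler_nat.
Qed.

Definition semigroup (t : R) : X -> X := Phi (cut D (fun z => cexp (t%:C * z))).
Local Notation S := semigroup.

Variable a : R.
Hypothesis ha : forall z, D z -> complex.Re z <= a.

Lemma nrm_cexp_scale t z : 0 <= t -> D z -> nrm (cexp (t%:C * z)) <= expR (t * `|a|).
Proof.
move=> t0 Dz; rewrite nrm_cexp ler_expR; case: z Dz => x y /ha /= xa.
by rewrite mul0r subr0 ler_wpM2l// (le_trans xa)// ler_norm.
Qed.

Lemma approx_cexp t : 0 <= t -> approximable (cut D (fun z => cexp (t%:C * z))).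
Proof.
move=> t0; apply: (@approx_cut _ _ _ (expR (t * `|a|))); [exact: borel_support hE| |].
  exact: borel_fun_cexp_scale.
by move=> z; exact: nrm_cexp_scale.
Qed.

Lemma semigroup_bounded t : 0 <= t -> bounded_linear (S t).
Proof. by move=> t0; apply: (Phi_bounded_linear hE); exact: approx_cexp. Qed.

Lemma semigroup_bound t f : 0 <= t -> nrm (S t f) <= 4 * M * expR (t * `|a|) * nrm f.
Proof.
move=> t0; apply: Phi_cut_bound; [exact: approx_cexp|exact: expR_ge0|].
by move=> z; exact: nrm_cexp_scale.
Qed.

Lemma semigroup0 f : S 0 f = f.
Proof.
rewrite /semigroup (_ : cut D _ = cut D (fun=> 1)).
  by rewrite Phi_cut1 ?E_support//; exact: borel_support hE.
by apply: eq_cut => z _; rewrite mul0r cexp0.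
Qed.

Lemma semigroupD s t f : 0 <= s -> 0 <= t -> S (s + t) f = S s (S t f).
Proof.
move=> s0 t0; rewrite /semigroup Phi_cut_mul//; [|exact: approx_cexp|exact: approx_cexp].
rewrite setIid; congr (Phi _ f); apply: eq_cut => z _.
by rewrite -cexpD -mulrDl -rmorphD.
Qed.

Lemma semigroup_cvg0 f : S t f @[t --> 0^'+] --> f.
Proof.
have M0 := mbound_gt0 hE; have K0 : 0 <= 4 * M * expR `|a| + 1.
  by rewrite addr_ge0// !mulr_ge0 ?expR_ge0// ltW.
have M4e : 4 * M * expR `|a| <= 4 * M * expR `|a| + 1 by rewrite lerDl.
(* The added constants make the same bound valid for the limit operator [id]. *)
apply: (@strong_cvg _ _ _ hE _ _ _ S id (4 * M * expR `|a| + 1 + 1)) => //.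
- by rewrite addr_ge0.
- by move=> x; rewrite ler_peMl ?nrm_ge0// lerDr.
- near=> t; have t0 : 0 <= t by apply: ltW; near: t; exact: nbhs_right_gt.
  have t1 : t <= 1 by apply: ltW; near: t; exact: nbhs_right_lt.
  split=> [|x]; first by have [] := semigroup_bounded t0.
  apply: (le_trans (semigroup_bound _ t0)); rewrite ler_wpM2r ?nrm_ge0//.
  have : expR (t * `|a|) <= expR `|a| by rewrite ler_expR ler_piMl.
  by move=> /(ler_wpM2l (ltW M0)); lra.
move=> n; apply: (@cvg_nrm_le _ _ _ _ _ _ _ (fun t => 4 * M * (3 * n%:R * expR n%:R) * nrm f * t)); last exact: cvg0_right.
near=> t; have t0 : 0 <= t by apply: ltW; near: t; exact: nbhs_right_gt.
have t1 : t <= 1 by apply: ltW; near: t; exact: nbhs_right_lt.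
have aD : approximable (cut (B n) (fun z => cexp (t%:C * z))).
  by apply: approx_cut_sub; [exact: borel_discn | exact: approx_cexp].
have a1 : approximable (cut (B n) (fun=> 1)) by apply: approx_cut1; exact: borel_band.
rewrite /semigroup Phi_cut_E//; [|exact: approx_cexp|exact: borel_discn].
rewrite E_disc_band -Phi_cutB//.
have -> : 4 * M * (3 * n%:R * expR n%:R) * nrm f * t = 4 * M * (3 * (t * n%:R) * expR n%:R) * nrm f by ring.
apply: Phi_cut_bound; [|by rewrite !mulr_ge0 ?expR_ge0|].
  apply: eq_approx (approx_cut_comb (-1) a1 aD) => z.
  by rewrite /cut; ring.
move=> z [_ zn]; apply: (le_trans (cexp_bound1 _)); rewrite nrmM nrm_real (ger0_norm t0).
have tz : t * nrm z <= t * n%:R by rewrite ler_wpM2l.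
apply: ler_pM; rewrite ?mulr_ge0 ?nrm_ge0 ?expR_ge0//; first by rewrite ler_wpM2l.
rewrite ler_expR ge_max ler0n/=; apply: (le_trans (ler_norm _)); apply: (le_trans (nrm_Re _)).
rewrite nrmM nrm_real (ger0_norm t0); apply: (le_trans tz); rewrite ler_piMl//.
Unshelve. all: by end_near. Qed.

Lemma semigroup_C0 : C0_semigroup S.
Proof.
split; [exact: semigroup_bounded|exact: semigroup0| |exact: semigroup_cvg0].
by move=> s t s0 t0 f; exact: semigroupD.
Qed.

(** A point at distance at least 1 to the right of the half plane [Re z <= a], so that the resolvent
    function is bounded by 1 on the support. *)
Local Notation c0 := ((`|a| + 1)%:C : C).
Local Notation rz := (fun z : C => (z - c0)^-1).

Lemma resolvent_ge1 z : D z -> 1 <= nrm (z - c0).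
Proof.
move=> /ha za; apply: le_trans (nrm_Re _); case: z za => x y /= xa.
by rewrite ler0_norm; have := ler_norm a; lra.
Qed.

Lemma resolvent_neq0 z : D z -> z - c0 != 0.
Proof. by move=> /resolvent_ge1 h; rewrite -nrm_eq0 gt_eqF//; lra. Qed.

Lemma resolvent_le1 z : D z -> nrm (rz z) <= 1.
Proof. by move=> /resolvent_ge1 h; rewrite nrmV invf_le1//; lra. Qed.

Lemma approx_resolvent : approximable (cut D rz).
Proof.
apply: (@approx_cut _ _ _ 1); [exact: borel_support hE|exact: borel_fun_inv|exact: resolvent_le1].
Qed.

(** [A f - c0 f] is the limit of the integrals of [z - c0] over the bands, and the bounded operator
    [Phi (cut D rz)] may be applied before the limit, where it cancels that factor. *)
Lemma resolventK f : op_dom A f -> Phi (cut D rz) (A f - c0 *: f) = f.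
Proof.
move=> fA; have /A_graphP hf : op_dom A f /\ A f = A f by [].
have bR := Phi_bounded_linear hE approx_resolvent.
have lim1 : Phi (cut (B n) id) f - c0 *: E (disc n) f @[n --> \oo] --> A f - c0 *: f.
  by apply: cvgB => //; apply: cvgZr; exact: (disc_cvg hE).
apply: (cvg_uniq (bounded_linear_cvg bR lim1)); apply: cvg_near_eq (disc_cvg hE (f := f)).
near=> n; have a1 : approximable (cut (B n) (fun=> 1)) by apply: approx_cut1; exact: borel_band.
have ai := approx_band_id n; rewrite E_disc_band.
have -> : Phi (cut (B n) id) f - c0 *: Phi (cut (B n) (fun=> 1)) f =
    Phi (cut (B n) (fun z => - c0 * 1 + z)) f.
  by rewrite (Phi_cut_comb hE (- c0) f a1 ai) scaleNr [RHS]addrC.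
rewrite Phi_cut_mul//; [|exact: approx_resolvent|exact: approx_cut_comb].
rewrite setIA setIid; congr (Phi _ f); apply: eq_cut => z [Dz _].
by rewrite mulr1 [_ + z]addrC mulVf// resolvent_neq0.
Unshelve. all: by end_near. Qed.

(* Writing [f] as a resolvent turns the difference quotient of the semigroup, an
   unbounded function of [z], into a bounded one. *)
Lemma semigroup_derivative f : op_dom A f ->
  (t^-1)%:C *: (S t f - f) @[t --> 0^'+] --> A f.
Proof.
move=> fA; set g := A f - c0 *: f.
have aR := approx_resolvent; have M0 := mbound_gt0 hE.
have bD : borelC D by exact: borel_support hE.
have aD1 : approximable (cut D (fun=> 1)) by exact: approx_cut1.
have aL0 : approximable (cut D (fun z => c0 * rz z + 1)) by exact: approx_cut_comb.
(* Writing [z rz z] as a combination of [rz] and 1 exhibits it as an approximable function on the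
   support. *)
have L0E z : D z -> c0 * rz z + 1 = z * rz z.
  by move=> /resolvent_neq0 z0; rewrite -[X in _ + X](divff z0) -mulrDl [_ + (z - _)]addrC subrK.
have fE : f = Phi (cut D rz) g by rewrite resolventK.
have AfE : A f = Phi (cut D (fun z => c0 * rz z + 1)) g.
  by rewrite Phi_cut_comb// -fE Phi_cut1// E_support// /g addrC subrK.
pose Q (t : R) := fun z : C => (t^-1)%:C * (cexp (t%:C * z) * rz z - rz z).
have aQ (t : R) : 0 <= t -> approximable (cut D (Q t)).
  move=> t0; have aE := approx_cut_mul (approx_cexp t0) aR.
  have ac : approximable (cut D (fun=> (t^-1)%:C)).
    apply: eq_approx (approx_mul (approx_const (t^-1)%:C) aD1) => z; by rewrite /cut; ring.
  apply: eq_approx (approx_cut_mul ac (approx_cut_comb (-1) aR aE)) => z.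
  by rewrite /cut /Q; ring.
have QE (t : R) : 0 <= t -> (t^-1)%:C *: (S t f - f) = Phi (cut D (Q t)) g.
  move=> t0; have aE := approx_cut_mul (approx_cexp t0) aR.
  rewrite {1 2}fE /semigroup Phi_cut_mul//; last exact: approx_cexp.
  rewrite setIid -Phi_cutB// -Phi_cutZ//.
  by apply: eq_approx (approx_cut_comb (-1) aR aE) => z; rewrite /cut; ring.
have rz2 z : D z -> nrm (z * rz z) <= `|a| + 2.
  move=> Dz; rewrite -L0E//; apply: (le_trans (nrmD _ _)); rewrite nrmM nrm1 nrm_real.
  have := ler_wpM2l (normr_ge0 (`|a| + 1)) (resolvent_le1 Dz).
  by rewrite ger0_norm ?addr_ge0//; lra.
have bQ (t : R) z : 0 < t -> t <= 1 -> D z -> nrm (Q t z) <= 3 * expR `|a| * (`|a| + 2).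
  move=> t0 t1 Dz; rewrite /Q.
  have -> : cexp (t%:C * z) * rz z - rz z = (cexp (t%:C * z) - 1) * rz z by ring.
  have ti : 0 <= t^-1 by rewrite invr_ge0 ltW.
  rewrite !nrmM nrm_real (ger0_norm ti) ler_pdivrMl//.
  have h1 := cexp_bound1 (t%:C * z); rewrite nrmM nrm_real gtr0_norm// in h1.
  have h2 : expR (Num.max 0 (complex.Re (t%:C * z))) <= expR `|a|.
    rewrite ler_expR ge_max normr_ge0/=; case: z Dz {h1} => x y /ha /= xa.
    rewrite mul0r subr0; apply: (@le_trans _ _ (t * `|a|)); last by rewrite ler_piMl.
    by rewrite ler_pM2l// (le_trans xa)// ler_norm.
  apply: (@le_trans _ _ (3 * (t * nrm z) * expR `|a| * nrm (rz z))).
    rewrite ler_wpM2r ?nrm_ge0//; apply: (le_trans h1); rewrite ler_wpM2l//.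
    by rewrite !mulr_ge0 ?nrm_ge0// ltW.
  have -> : 3 * (t * nrm z) * expR `|a| * nrm (rz z) = t * (3 * expR `|a|) * nrm (z * rz z) by rewrite nrmM; ring.
  have -> : t * (3 * expR `|a| * (`|a| + 2)) = t * (3 * expR `|a|) * (`|a| + 2) by ring.
  by rewrite ler_wpM2l ?rz2// !mulr_ge0 ?expR_ge0// ltW.
pose c1 : R := 3 * expR `|a| * (`|a| + 2).
have c1_ge0 : 0 <= c1 by rewrite !mulr_ge0 ?expR_ge0 ?addr_ge0.
have K0 : 0 <= 4 * M * c1 by rewrite !mulr_ge0// ltW.
rewrite AfE; apply: (@cvg_near_eq _ _ _ _ _ (fun t => Phi (cut D (Q t)) g)).
  by near=> t; rewrite -QE//; apply: ltW; near: t; exact: nbhs_right_gt.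
apply: (@strong_cvg _ _ _ hE _ _ _ (fun t => Phi (cut D (Q t)))
  (Phi (cut D (fun z => c0 * rz z + 1))) (4 * M * c1)) => //.
- exact: Phi_linear.
- move=> x; apply: (Phi_cut_bound hE) => //.
  move=> z Dz; rewrite L0E//; apply: (le_trans (rz2 _ Dz)); rewrite /c1 ler_peMl ?addr_ge0//.
  have : 1 <= expR `|a| by rewrite -expR0 ler_expR.
  lra.
- near=> t; have t0 : 0 < t by near: t; exact: nbhs_right_gt.
  have t1 : t <= 1 by apply: ltW; near: t; exact: nbhs_right_lt.
  split=> [|x]; first by apply: (Phi_linear hE); exact/aQ/ltW.
  apply: Phi_cut_bound; [exact/aQ/ltW|exact: c1_ge0|].
  by move=> z; exact: bQ.
(* On the range of [E (disc n)] the second-order Taylor estimate gives convergence at rate [t]. *)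
move=> n; apply: (@cvg_nrm_le _ _ _ _ _ _ _ (fun t => 4 * M * (4 * n%:R ^+ 2 * expR n%:R) * nrm g * t)); last exact: cvg0_right.
near=> t; have t0 : 0 < t by near: t; exact: nbhs_right_gt.
have t1 : t <= 1 by apply: ltW; near: t; exact: nbhs_right_lt.
rewrite !Phi_cut_E//; [|exact: borel_discn|exact/aQ/ltW|exact: borel_discn].
have aQB : approximable (cut (B n) (Q t)) by apply: approx_cut_sub; [exact: borel_discn|exact/aQ/ltW].
have aLB : approximable (cut (B n) (fun z => c0 * rz z + 1)) by apply: approx_cut_sub => //; exact: borel_discn.
rewrite -Phi_cutB//.
have -> : 4 * M * (4 * n%:R ^+ 2 * expR n%:R) * nrm g * t = 4 * M * (4 * n%:R ^+ 2 * expR n%:R * t) * nrm g by ring.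
apply: Phi_cut_bound; [|by rewrite !mulr_ge0 ?expR_ge0// ltW|].
  by apply: eq_approx (approx_cut_comb (-1) aLB aQB) => z; rewrite /cut; ring.
move=> z [Dz zn]; rewrite L0E// /Q.
have -> : (t^-1)%:C * (cexp (t%:C * z) * rz z - rz z) - z * rz z =
    (t^-1)%:C * (cexp (t%:C * z) - 1 - t%:C * z) * rz z.
  have tt : (t^-1)%:C * t%:C = 1 :> C by rewrite -rmorphM mulVf ?gt_eqF// rmorph1.
  rewrite (_ : z * rz z = (t^-1)%:C * t%:C * z * rz z); first by ring.
  by rewrite tt mul1r.
have ti : 0 <= t^-1 by rewrite invr_ge0 ltW.
rewrite !nrmM nrm_real (ger0_norm ti).
apply: (@le_trans _ _ (t^-1 * nrm (cexp (t%:C * z) - 1 - t%:C * z))).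
  by rewrite ler_piMr ?resolvent_le1// mulr_ge0 ?nrm_ge0.
rewrite ler_pdivrMl//; apply: (le_trans (cexp_bound2 _)); rewrite nrmM nrm_real gtr0_norm// exprMn.
have zn2 : nrm z ^+ 2 <= n%:R ^+ 2 by rewrite lerXn2r// nnegrE ?nrm_ge0.
have h2 : expR `|complex.Re (t%:C * z)| <= expR n%:R.
  rewrite ler_expR; apply: (le_trans (nrm_Re _)); rewrite nrmM nrm_real gtr0_norm//.
  by apply: le_trans zn; rewrite ler_piMl ?nrm_ge0.
have -> : t * (4 * n%:R ^+ 2 * expR n%:R * t) = 4 * (t ^+ 2 * n%:R ^+ 2) * expR n%:R by ring.
apply: ler_pM; rewrite ?expR_ge0 ?mulr_ge0 ?nrm_ge0 ?(ltW t0)//.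
by rewrite ler_wpM2l// ler_wpM2l// sqr_ge0.
Unshelve. all: by end_near. Qed.

(** The generator of the semigroup is no larger than [A]: applying [E (disc n)] to the difference
    quotient and letting [t] tend to 0 gives the integral of [z] over the band at [f] equal to
    [E (disc n) g], which tends to [g]. *)
Lemma semigroup_derivative_dom f g :
  (t^-1)%:C *: (S t f - f) @[t --> 0^'+] --> g -> op_dom A f /\ A f = g.
Proof.
move=> fg; apply/A_graphP; apply: cvg_near_eq (disc_cvg hE (f := g)).
near=> n; apply: (cvg_uniq (bounded_linear_cvg (E_bounded hE (borel_discn n)) fg)).
pose Q (t : R) := fun z : C => (t^-1)%:C * (cexp (t%:C * z) - 1).
have a1 : approximable (cut (B n) (fun=> 1)) by apply: approx_cut1; exact: borel_band.
have aE (t : R) : 0 <= t -> approximable (cut (B n) (fun z => cexp (t%:C * z))).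
  by move=> t0; apply: approx_cut_sub; [exact: borel_discn | exact: approx_cexp].
have aB (t : R) : 0 <= t -> approximable (cut (B n) (fun z => cexp (t%:C * z) - 1)).
  by move=> t0; apply: eq_approx (approx_cut_comb (-1) a1 (aE t t0)) => z; rewrite /cut; ring.
have aQ (t : R) : 0 <= t -> approximable (cut (B n) (Q t)).
  move=> t0; apply: eq_approx (approx_mul (approx_const (t^-1)%:C) (aB t t0)) => z.
  by rewrite /cut /Q; ring.
apply: (@cvg_nrm_le _ _ _ _ _ _ _ (fun t => 4 * M * (4 * n%:R ^+ 2 * expR n%:R) * nrm f * t)); last exact: cvg0_right.
near=> t; have t0 : 0 < t by near: t; exact: nbhs_right_gt.
have t1 : t <= 1 by apply: ltW; near: t; exact: nbhs_right_lt.
have t0' := ltW t0; have lE := E_linear hE (borel_discn n).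
rewrite (linZ lE) (linB lE) E_Phi_cut//; [|exact: approx_cexp|exact: borel_discn].
rewrite (setIC (disc n)) E_disc_band -Phi_cutB//; last exact: aE.
rewrite -(Phi_cutZ hE _ _ (aB _ t0')) -(Phi_cutB hE _ (aQ _ t0') (approx_band_id n)).
have -> : 4 * M * (4 * n%:R ^+ 2 * expR n%:R) * nrm f * t = 4 * M * (4 * n%:R ^+ 2 * expR n%:R * t) * nrm f by ring.
apply: Phi_cut_bound; [|by rewrite !mulr_ge0 ?expR_ge0|].
  by apply: eq_approx (approx_cut_comb (-1) (approx_band_id n) (aQ t t0')) => z; rewrite /cut /Q; ring.
move=> z [Dz zn].
have -> : (t^-1)%:C * (cexp (t%:C * z) - 1) - z = (t^-1)%:C * (cexp (t%:C * z) - 1 - t%:C * z).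
  have tt : (t^-1)%:C * t%:C = 1 :> C by rewrite -rmorphM mulVf ?gt_eqF// rmorph1.
  by rewrite [in RHS]mulrBr [in RHS]mulrA tt mul1r.
rewrite nrmM nrm_real ger0_norm ?invr_ge0// ler_pdivrMl//.
apply: (le_trans (cexp_bound2 _)); rewrite nrmM nrm_real gtr0_norm// exprMn.
have zn2 : nrm z ^+ 2 <= n%:R ^+ 2 by rewrite lerXn2r// nnegrE ?nrm_ge0.
have h2 : expR `|complex.Re (t%:C * z)| <= expR n%:R.
  rewrite ler_expR; apply: (le_trans (nrm_Re _)); rewrite nrmM nrm_real gtr0_norm//.
  by apply: le_trans zn; rewrite ler_piMl ?nrm_ge0.
have -> : t * (4 * n%:R ^+ 2 * expR n%:R * t) = 4 * (t ^+ 2 * n%:R ^+ 2) * expR n%:R by ring.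
apply: ler_pM; rewrite ?expR_ge0 ?mulr_ge0 ?nrm_ge0 ?(ltW t0)//.
by rewrite ler_wpM2l// ler_wpM2l// sqr_ge0.
Unshelve. all: by end_near. Qed.

Lemma generator_graphP (T : R -> X -> X) f y :
  (op_dom (generator T) f /\ generator T f = y) <-> (t^-1)%:C *: (T t f - f) @[t --> 0^'+] --> y.
Proof.
split=> [[/= fT <-]|fy]; first exact: fT.
by split; [apply/cvg_ex; exists y | apply: cvg_lim => //; exact: norm_hausdorff].
Qed.

Lemma semigroup_generates : generates A S.
Proof.
split; first exact: semigroup_C0.
split=> [|f /semigroup_derivative/generator_graphP[]//].
apply/seteqP; split=> f /=; first by move=> /semigroup_derivative/generator_graphP[].
by move=> fS; have /generator_graphP/semigroup_derivative_dom[] : op_dom (generator S) f /\ generator S f = generator S f by [].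
Qed.

End Generation.

(** * Gevrey regularity *)

Section Smooth.
Context {R : realType} {X : completeNormedModType R[i]}.
Local Notation C := R[i].

(** Iterated derivatives are functions on all of [R] with arbitrary values at [t <= 0]. At [t > 0]
    the quotients with [|h| < t] see positive times only, so candidates [u n] known there
    suffice. *)
Lemma derivRn_unique (g : R -> X) (u : nat -> R -> X) :
  (forall t : R, 0 < t -> g t = u 0%N t) ->
  (forall n (t : R), 0 < t -> diff_quot (u n) t h @[h --> 0^'] --> u n.+1 t) ->
  (forall n (t : R), 0 < t -> derivRn n g t = u n t) /\ smooth_on_pos g.
Proof.
move=> gu hu.
have step n (v : R -> X) (t : R) : 0 < t -> (forall t : R, 0 < t -> v t = u n t) ->
    diff_quot v t h @[h --> 0^'] --> u n.+1 t.
  move=> t0 vu; apply: cvg_near_eq (hu n t t0); near=> h.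
  rewrite /diff_quot !vu//; have : `|h| < t by near: h; exact: dnbhs0_lt.
  by rewrite ltr_norml => /andP[]; lra.
have H n (t : R) : 0 < t -> derivRn n g t = u n t.
  elim: n t => [|n ih] t t0; first exact: gu.
  by apply: cvg_lim; [exact: norm_hausdorff | exact: step ih].
split=> // n t t0; apply/cvg_ex; exists (u n.+1 t).
by apply: (step n) => // s s0; exact: H.
Unshelve. all: by end_near. Qed.

Lemma cvg0_punctured (c : R) : c * `|h| @[h --> (0 : R)^'] --> (0 : R).
Proof.
apply/cvgrPdist_lt => e e0; have K0 : 0 < `|c| + 1 by rewrite ltr_wpDl.
near=> h; have : `|h| < e / (`|c| + 1) by near: h; apply: dnbhs0_lt; rewrite divr_gt0.
by rewrite ltr_pdivlMr// sub0r normrN normrM normr_id; have := normr_ge0 h; lra.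
Unshelve. all: by end_near. Qed.

Variables (E : set C -> X -> X).
Hypothesis hE : spectral_measure E.
Local Notation M := (mbound hE).
Local Notation Phi := (bounded_spectral_integral E).
Local Notation D := (spectral_support E).

(** What differentiation of [e^(t z)] under the integral to every order requires. It holds on each
    band, and on the whole support under the spectral condition. *)
Definition bounded_moments (d : set C) := forall n (s t : R), 0 < s -> s <= t ->
  exists2 K : R, 0 <= K & forall u z, s <= u <= t -> d z ->
    nrm z ^+ n * expR (u * complex.Re z) <= K.

Section OrbitDerivative.
Variable d : set C.
Hypotheses (bd : borelC d) (hd : bounded_moments d).

Definition orbit_derivative n (t : R) : X -> X := Phi (cut d (fun z => z ^+ n * cexp (t%:C * z))).

Lemma nrm_moment n (t : R) z : nrm (z ^+ n * cexp (t%:C * z)) = nrm z ^+ n * expR (t * complex.Re z).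
Proof. by rewrite nrmM nrmX nrm_cexp; case: z => x y /=; rewrite mul0r subr0. Qed.

Lemma approx_moment n (t : R) : 0 < t -> approximable (cut d (fun z => z ^+ n * cexp (t%:C * z))).
Proof.
move=> t0; have [K K0 hK] := hd n t0 (lexx t).
apply: (@approx_cut _ _ _ K) => //.
  by apply: borel_fun_cont; apply: ccont_mul; [exact: ccont_exprn | exact: ccont_cexp_scale].
by move=> z dz; rewrite nrm_moment; apply: hK; rewrite ?lexx.
Qed.

(** The Taylor remainder of [e^(h z)] costs [|z|^2] and [e^(|h Re z|)]; for [|h| < t / 2] both are
    absorbed by the moments of order [n + 2] on [[t / 2, 3 t / 2]]. *)
Lemma orbit_derivativeP n (t : R) f : 0 < t ->
  diff_quot (orbit_derivative n ^~ f) t h @[h --> 0^'] --> orbit_derivative n.+1 t f.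
Proof.
move=> t0; have t2 : 0 < t / 2 by lra.
have t23 : t / 2 <= 3 * t / 2 by lra.
have [Km Km0 hKm] := hd n.+2 t2 t23.
apply: (@cvg_nrm_le _ _ _ _ _ _ _ (fun h => 4 * M * (8 * Km) * nrm f * `|h|)); last exact: cvg0_punctured.
near=> h; have h0 : h != 0 by near: h; exact: nbhs_dnbhs_neq.
have ht : `|h| < t / 2 by near: h; exact: dnbhs0_lt.
have ht' := ht; rewrite ltr_norml in ht'; have /andP[h1 h2] := ht'.
have th : 0 < h + t by lra.
have a1 := approx_moment n th; have a2 := approx_moment n t0; have a3 := approx_moment n.+1 t0.
have a12 : approximable (cut d (fun z => z ^+ n * cexp ((h + t)%:C * z) - z ^+ n * cexp (t%:C * z))).
  by apply: eq_approx (approx_cut_comb (-1) a2 a1) => z; rewrite /cut; ring.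
have a12' : approximable (cut d (fun z => (h^-1)%:C *
    (z ^+ n * cexp ((h + t)%:C * z) - z ^+ n * cexp (t%:C * z)))).
  by apply: eq_approx (approx_mul (approx_const (h^-1)%:C) a12) => z; rewrite /cut; ring.
rewrite /diff_quot /orbit_derivative -(Phi_cutB hE _ a1 a2) -(Phi_cutZ hE _ _ a12) -(Phi_cutB hE _ a12' a3).
have -> : 4 * M * (8 * Km) * nrm f * `|h| = 4 * M * (8 * Km * `|h|) * nrm f by ring.
apply: Phi_cut_bound; [|by apply: mulr_ge0 => //; exact: mulr_ge0|].
  by apply: eq_approx (approx_cut_comb (-1) a3 a12') => z; rewrite /cut; ring.
move=> z dz.
have -> : (h^-1)%:C * (z ^+ n * cexp ((h + t)%:C * z) - z ^+ n * cexp (t%:C * z)) -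
    z ^+ n.+1 * cexp (t%:C * z) =
    (h^-1)%:C * (z ^+ n * cexp (t%:C * z)) * (cexp (h%:C * z) - 1 - h%:C * z).
  have hh : (h^-1)%:C * h%:C = 1 :> C by rewrite -rmorphM mulVf// rmorph1.
  have -> : cexp ((h + t)%:C * z) = cexp (h%:C * z) * cexp (t%:C * z).
    by rewrite -cexpD -mulrDl -rmorphD.
  have -> : z ^+ n.+1 * cexp (t%:C * z) = ((h^-1)%:C * h%:C) * z * z ^+ n * cexp (t%:C * z).
    by rewrite hh mul1r exprS.
  by ring.
rewrite nrmM nrmM nrm_moment nrm_real normfV.
have -> : `|h|^-1 * (nrm z ^+ n * expR (t * complex.Re z)) * nrm (cexp (h%:C * z) - 1 - h%:C * z) =
  `|h|^-1 * (nrm z ^+ n * expR (t * complex.Re z) * nrm (cexp (h%:C * z) - 1 - h%:C * z)) by ring.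
have nh : 0 < `|h| by rewrite normr_gt0.
rewrite ler_pdivrMl//.
have e2 := cexp_bound2 (h%:C * z); rewrite nrmM nrm_real exprMn in e2.
have ReE : complex.Re (h%:C * z) = h * complex.Re z by case: (z) => x y /=; rewrite mul0r subr0.
rewrite ReE normrM in e2; set x := complex.Re z in e2 *.
(* The factor [e^(|h x|)] moves the time [t] at worst to [3 t / 2] if [x >= 0] and to [t / 2] if
   [x < 0]. The sum covers both cases and turns the constant 4 into 8. *)
have ex : expR (t * x) * expR (`|h| * `|x|) <= expR (t / 2 * x) + expR (3 * t / 2 * x).
  rewrite -expRD; have [x0|x0] := leP 0 x.
    apply: (@le_trans _ _ (expR (3 * t / 2 * x))); last by rewrite lerDr expR_ge0.
    rewrite ler_expR (ger0_norm x0); have : `|h| * x <= t / 2 * x by rewrite ler_wpM2r// ltW.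
    lra.
  apply: (@le_trans _ _ (expR (t / 2 * x))); last by rewrite lerDl expR_ge0.
  rewrite ler_expR (ltr0_norm x0); have : `|h| * (- x) <= t / 2 * (- x) by rewrite ler_wpM2r ?oppr_ge0 // ltW.
  lra.
have k1 := hKm (t / 2) z; have k2 := hKm (3 * t / 2) z; rewrite -/x in k1 k2.
have k1' : nrm z ^+ n.+2 * expR (t / 2 * x) <= Km by apply: k1 => //; lra.
have k2' : nrm z ^+ n.+2 * expR (3 * t / 2 * x) <= Km by apply: k2 => //; lra.
have p0 : 0 <= nrm z ^+ n by rewrite exprn_ge0 ?nrm_ge0.
apply: (@le_trans _ _ (nrm z ^+ n * expR (t * x) * (4 * (`|h| ^+ 2 * nrm z ^+ 2) * expR (`|h| * `|x|)))).
  by rewrite ler_wpM2l// mulr_ge0 ?expR_ge0.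
have -> : nrm z ^+ n * expR (t * x) * (4 * (`|h| ^+ 2 * nrm z ^+ 2) * expR (`|h| * `|x|)) =
  4 * `|h| ^+ 2 * (nrm z ^+ n.+2 * (expR (t * x) * expR (`|h| * `|x|))) by rewrite -(addn2 n) exprD; ring.
have -> : `|h| * (8 * Km * `|h|) = 4 * `|h| ^+ 2 * (Km + Km) by ring.
rewrite ler_wpM2l ?mulr_ge0 ?sqr_ge0//.
apply: (@le_trans _ _ (nrm z ^+ n.+2 * (expR (t / 2 * x) + expR (3 * t / 2 * x)))).
  by rewrite ler_wpM2l// exprn_ge0// nrm_ge0.
by rewrite mulrDr lerD.
Unshelve. all: by end_near. Qed.

End OrbitDerivative.

Variables (beta a b : R).
Hypotheses (beta1 : 1 <= beta) (b0 : 0 < b).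
Hypothesis hD : forall z, D z -> complex.Re z <= a - b * `|complex.Im z| `^ beta^-1.

Lemma support_moments : bounded_moments D.
Proof.
move=> n s t s0 st; have [al [K [al0 K0 hK]]] := parabola_moment a beta1 b0 s0 st.
exists (K * al ^+ n * n`!%:R `^ beta).
  by apply: mulr_ge0 (powR_ge0 _ _); apply: mulr_ge0 (ltW K0) (exprn_ge0 _ (ltW al0)).
by move=> u z hu Dz; apply: hK; rewrite ?hD.
Qed.

Lemma semigroup_gevrey : gevrey_roumieu beta (semigroup E).
Proof.
move=> f g; have [||dE sm] := @derivRn_unique g (fun n t => orbit_derivative D n t f).
- by move=> t _; rewrite /g /semigroup /orbit_derivative; congr (Phi _ f); apply: eq_cut => z _; rewrite expr0 mul1r.
- by move=> n t t0; exact: (orbit_derivativeP (borel_support hE) support_moments).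
split=> // c d c0 cd; have [al [K [al0 K0 hK]]] := parabola_moment a beta1 b0 c0 cd.
have M0 := mbound_gt0 hE; have f0 := nrm_ge0 f.
exists al, (4 * M * K * (nrm f + 1)); split=> //; first by rewrite !mulr_gt0//; lra.
move=> n t /[dup] tcd /andP[ct td]; have t0 : 0 < t by exact: lt_le_trans ct.
rewrite dE// nrmE lecR /orbit_derivative.
have p0 : 0 <= K * al ^+ n * n`!%:R `^ beta by apply: mulr_ge0 (powR_ge0 _ _); apply: mulr_ge0 (ltW K0) (exprn_ge0 _ (ltW al0)).
apply: (@le_trans _ _ (4 * M * (K * al ^+ n * n`!%:R `^ beta) * nrm f)).
  apply: Phi_cut_bound => //; first exact: (approx_moment (borel_support hE) support_moments).
  by move=> z Dz; rewrite nrm_moment; apply: hK; rewrite ?hD.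
have : 0 <= 4 * M * (K * al ^+ n * n`!%:R `^ beta) by apply: mulr_ge0 => //; rewrite mulr_ge0// ltW.
lra.
Qed.

End Smooth.

(** * Semigroups with a given spectral generator *)

Section Uniqueness.
Context {R : realType} {X : completeNormedModType R[i]}.
Local Notation C := R[i].
Implicit Types (d : set C) (f x y : X) (F G H : C -> C).

(** The regrouping behind the product rule for [T s (V (- s) f)] in [T_band_exp_inv]. *)
Lemma telescope_sub (V : zmodType) (p q y u w : V) :
  p - y = p - q + u + (q - y - w) - (u - w).
Proof. by rewrite opprB [X in _ = X + _]addrA [RHS]addrA subrK addrAC addrK addrA subrK. Qed.

Lemma right_nearP (P : R -> Prop) : (\forall t \near 0^'+, P t) ->
  exists2 d : R, 0 < d & forall h : R, 0 < h -> h < d -> P h.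
Proof.
case/nbhs_ballP => d /= d0 hd; exists d => // h h0 hd'.
by apply: hd => //; rewrite -ball_normE /= sub0r normrN gtr0_norm.
Qed.

(** Strong continuity bounds each orbit on an interval, both depending on [x]. One index [m]
    controls the length of the interval and the bound, and Baire's theorem makes it uniform. *)
Lemma C0_bounded_near0 (T : R -> X -> X) : C0_semigroup T ->
  exists (d K : R), [/\ 0 < d, 1 <= K & forall (t : R) x, 0 <= t <= d -> nrm (T t x) <= K * nrm x].
Proof.
move=> [bT T0 _ cT].
have [||m [c [c0 hm]]] := @uniform_bound _ X R T (fun m t => 0 <= t <= m.+1%:R^-1) (fun m _ => m%:R).
- by move=> m t /andP[t0 _]; exact: bT.
- move=> x; have /cvg_nrmP/(_ 1 ltr01)/right_nearP[d d0 hd] := cT x.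
  (* This index exceeds both [nrm x + 1], the bound on the orbit, and [d^-1], so that
     [t <= 1 / (m + 1)] implies [t < d]. *)
  exists (Num.truncn (nrm x + 1 + d^-1)).+1 => t /andP[t0 tm].
  set m := (Num.truncn _).+1 in tm *.
  have mb : nrm x + 1 + d^-1 < m%:R by exact: truncnS_gt.
  have d'0 : 0 < d^-1 by rewrite invr_gt0.
  have [t0'|t0'] := leP t 0.
    have -> : t = 0 by apply/eqP; rewrite eq_le t0 t0'.
    by rewrite T0; lra.
  have td : t < d.
    apply: (le_lt_trans tm); rewrite invf_plt ?posrE//; apply: (@lt_trans _ _ m%:R); last by rewrite ltr_nat.
    by have := nrm_ge0 x; lra.
  have := nrmD (T t x - x) x; rewrite subrK; have := hd t t0' td; lra.
exists (m.+1%:R^-1), (c * m%:R + 1); split; [by rewrite invr_gt0| |].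
  by rewrite lerDr mulr_ge0// ltW.
move=> t x ht; apply: (le_trans (hm t ht x)).
by rewrite ler_wpM2r ?nrm_ge0// lerDl.
Qed.

Lemma C0_bounded_on (T : R -> X -> X) (b : R) : C0_semigroup T ->
  exists2 K : R, 1 <= K & forall (t : R) x, 0 <= t <= b -> nrm (T t x) <= K * nrm x.
Proof.
move=> hT; have [d [K [d0 K1 hK]]] := C0_bounded_near0 hT; have [_ _ TD _] := hT.
have K0 : 0 <= K by lra.
suff h n : forall (t : R) x, 0 <= t <= n%:R * d -> nrm (T t x) <= K ^+ n.+1 * nrm x.
  exists (K ^+ (Num.truncn (b / d)).+2) => [|t x /andP[t0 tb]]; first exact: exprn_ege1.
  apply: h; rewrite t0/= (le_trans tb)// -ler_pdivrMr//; exact/ltW/truncnS_gt.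
elim: n => [|n ih] t x /andP[t0 tn].
  by rewrite expr1; apply: hK; rewrite t0 /=; rewrite mul0r in tn; lra.
have [td|td] := leP t d.
  apply: (le_trans (hK _ _ _)); first by rewrite t0.
  by rewrite ler_wpM2r ?nrm_ge0// ler_eXnr.
have -> : t = d + (t - d) by ring.
rewrite TD; [|exact: ltW|lra].
apply: (le_trans (hK _ _ _)); first by rewrite lexx ltW.
rewrite exprS -mulrA ler_wpM2l//; apply: ih; rewrite -natr1 in tn.
by apply/andP; split; lra.
Qed.

Variables (A : operator X) (E : set C -> X -> X) (T : R -> X -> X).
Hypothesis hE : spectral_measure E.
Hypothesis hsupp : spectral_support E = spectrum A.
Hypothesis hA : op_eq A (spectral_integral E (spectrum A) id).
Hypothesis hT : generates A T.
Local Notation M := (mbound hE).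
Local Notation Phi := (bounded_spectral_integral E).
Local Notation D := (spectral_support E).
Local Notation B n := (D `&` disc n).

Lemma T_bounded_linear (t : R) : 0 <= t -> bounded_linear (T t).
Proof. by case: hT => -[bT _ _ _] _; exact: bT. Qed.

Lemma T_derivative f : op_dom A f -> (t^-1)%:C *: (T t f - f) @[t --> 0^'+] --> A f.
Proof.
case: hT => _ [domE valE] fA; apply/generator_graphP; rewrite valE//; split=> //.
by rewrite -domE.
Qed.

Lemma T_expansion f (e : R) : op_dom A f -> 0 < e -> exists2 d : R, 0 < d &
  forall h : R, 0 < h -> h < d -> nrm (T h f - f - h%:C *: A f) <= e * h.
Proof.
move=> /T_derivative/cvg_nrmP h e0; have /right_nearP[d d0 hd] := h e e0.
exists d => // t t0 /(hd t t0) td.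
have -> : T t f - f - t%:C *: A f = t%:C *: ((t^-1)%:C *: (T t f - f) - A f).
  by rewrite scalerBr scalerA -rmorphM mulfV ?gt_eqF// rmorph1 scale1r.
by rewrite nrmZ nrm_real gtr0_norm// mulrC ler_pM2r// ltW.
Qed.

Section Band.
Variable n : nat.

(** On a band [z] is bounded, so this is defined for negative [s] as well and gives a group on the
    range of [E (disc n)]; [T_band_exp_inv] relies on negative times. *)
Definition band_exp (s : R) : X -> X := Phi (cut (B n) (fun z => cexp (s%:C * z))).
Local Notation V := band_exp.

Lemma Re_scale_le (s : R) (z : C) : disc n z -> `|complex.Re (s%:C * z)| <= `|s| * n%:R.
Proof.
by move=> zn; apply: (le_trans (nrm_Re _)); rewrite nrmM nrm_real ler_wpM2l.
Qed.

Lemma approx_band_exp s : approximable (cut (B n) (fun z => cexp (s%:C * z))).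
Proof.
apply: (@approx_cut _ _ _ (expR (`|s| * n%:R))); [exact: borel_band|exact: borel_fun_cexp_scale|].
move=> z [_ zn]; rewrite nrm_cexp ler_expR; apply: le_trans (Re_scale_le s zn).
exact: ler_norm.
Qed.

Lemma band_expD s t f : V (s + t) f = V s (V t f).
Proof.
rewrite /V Phi_cut_mul//; [|exact: approx_band_exp|exact: approx_band_exp].
rewrite setIid; congr (Phi _ f); apply: eq_cut => z _.
by rewrite -cexpD -mulrDl -rmorphD.
Qed.

Lemma band_exp0 f : V 0 f = E (disc n) f.
Proof.
rewrite (E_disc_band hE) /V; congr (Phi _ f); apply: eq_cut => z _.
by rewrite mul0r cexp0.
Qed.

Lemma E_band_exp s f : E (disc n) (V s f) = V s f.
Proof. by rewrite -band_exp0 -band_expD add0r. Qed.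

Lemma A_band_exp s f : op_dom A (V s f) /\ A (V s f) = Phi (cut (B n) id) (V s f).
Proof. by rewrite -[in op_dom A _]E_band_exp -[in A _]E_band_exp; exact: (A_disc hE hsupp hA). Qed.

Lemma band_expansion s f (e : R) : 0 < e -> exists2 d : R, 0 < d & forall h, `|h| < d ->
  nrm (V h (V s f) - V s f - h%:C *: A (V s f)) <= e * `|h|.
Proof.
move=> e0; set y := V s f; have [_ AyE] := A_band_exp s f; rewrite -/y in AyE.
have M0 := mbound_gt0 hE; have y0 := nrm_ge0 y.
pose K := 4 * M * (4 * n%:R ^+ 2 * expR n%:R) * nrm y + 1.
have K0 : 0 < K by rewrite ltr_wpDl// !mulr_ge0 ?expR_ge0// ltW.
exists (Num.min 1 (e / K)) => [|h]; first by rewrite lt_min ltr01 divr_gt0.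
rewrite lt_min => /andP[h1]; rewrite ltr_pdivlMr// => hK.
have a1 : approximable (cut (B n) (fun=> 1)) by apply: approx_cut1; exact: borel_band hE n.
have ah := approx_band_exp h; have ai := approx_band_id hE n.
have aV : approximable (cut (B n) (fun z => cexp (h%:C * z) - 1)).
  by apply: eq_approx (approx_cut_comb (-1) a1 ah) => z; rewrite /cut; ring.
have ahi : approximable (cut (B n) (fun z => h%:C * z)).
  by apply: eq_approx (approx_mul (approx_const h%:C) ai) => z; rewrite /cut; ring.
rewrite AyE -[X in _ - X - _]E_band_exp -/y (E_disc_band hE) /V.
rewrite -(Phi_cutB hE _ ah a1) -(Phi_cutZ hE _ _ ai) -(Phi_cutB hE _ aV ahi).
apply: (@le_trans _ _ (4 * M * (4 * n%:R ^+ 2 * expR n%:R * `|h| ^+ 2) * nrm y)); last first.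
  have : `|h| * (`|h| * K) <= `|h| * e by rewrite ler_wpM2l// ltW.
  rewrite /K; have : 0 <= `|h| * `|h| by rewrite mulr_ge0.
  rewrite expr2; lra.
apply: Phi_cut_bound; [|by rewrite !mulr_ge0 ?expR_ge0|].
  by apply: eq_approx (approx_cut_comb (-1) ahi aV) => z; rewrite /cut; ring.
move=> z [_ zn]; apply: (le_trans (cexp_bound2 _)); rewrite nrmM nrm_real exprMn.
have zn2 : nrm z ^+ 2 <= n%:R ^+ 2 by rewrite lerXn2r// nnegrE ?nrm_ge0.
have e2 : expR `|complex.Re (h%:C * z)| <= expR n%:R.
  by rewrite ler_expR; apply: (le_trans (Re_scale_le h zn)); rewrite ler_piMl// ltW.
have -> : 4 * n%:R ^+ 2 * expR n%:R * `|h| ^+ 2 = 4 * (`|h| ^+ 2 * n%:R ^+ 2) * expR n%:R by ring.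
apply: ler_pM; rewrite ?expR_ge0 ?mulr_ge0 ?nrm_ge0//.
by rewrite ler_wpM2l// ler_wpM2l// sqr_ge0.
Qed.

(* [s |-> T s (V (- s) f)] has derivative zero, since [T] and [V] have the same
   generator on the range of the spectral projection. *)
Lemma T_band_exp_inv (t : R) f : 0 <= t -> T t (V (- t) f) = E (disc n) f.
Proof.
move=> t0; have [[bT T0 TD cT] _] := hT.
have [K K1 hK] := C0_bounded_on (t + 1) hT.1; have K0 : 0 < K by lra.
suff -> : T t (V (- t) f) = T 0 (V (- 0) f) by rewrite T0 oppr0 band_exp0.
apply/esym; apply: (@derivative0_constant _ _ (fun s => T s (V (- s) f)) 0 t t0).
move=> s /andP[s0 st] e e0; set y := V (- s) f.
have [yA _] := A_band_exp (- s) f.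
(* At most three remainders of size [e1 h] occur, each magnified by at most [K^2]. *)
pose e1 := e / (3 * K ^+ 2); have e10 : 0 < e1 by rewrite divr_gt0// mulr_gt0// exprn_gt0.
have e1E : e1 * (3 * K ^+ 2) = e by rewrite divfK// gt_eqF// mulr_gt0// exprn_gt0.
have [d1 d10 hd1] := T_expansion yA e10.
have /cvg_nrmP/(_ e1 e10)/right_nearP[d2 d20 hd2] := cT (A y).
have [d3 d30 hd3] := band_expansion (- s) f e10.
exists (Num.min 1 (Num.min d1 (Num.min d2 d3))); first by rewrite !lt_min ltr01 d10 d20 d30.
move=> s' /andP[s'0 s't]; rewrite !lt_min => /and4P[h1 hd1' hd2' hd3'].
have [->|ss'] := eqVneq s' s; first by rewrite !subrr nrm0 normr0 mulr0.
have KK : K <= K ^+ 2 by rewrite expr2 ler_peMr// ltW.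
(* [T] runs forward only, so its value at the earlier time is factored out: the increment is
   [T s (T h (V (- h) y) - y)] if [s < s'], and [T s' (V h y - T h y)] otherwise. *)
have [lt_ss'|lt_s's|/eqP] := ltgtP s s'; last by rewrite eq_sym (negbTE ss').
- pose h := s' - s; have h0 : 0 < h by rewrite subr_gt0.
  have hE' : `|s' - s| = h by rewrite gtr0_norm.
  rewrite hE' in h1 hd1' hd2' hd3' *.
  have -> : V (- s') f = V (- h) y by rewrite /y -band_expD; congr (V _ f); rewrite /h; ring.
  have sh : s + h = s' by rewrite /h; ring.
  have -> : T s' (V (- h) y) = T s (T h (V (- h) y)) by rewrite -TD ?sh// ltW.
  have [lTs _] := bT s s0; have [lTh _] := bT h (ltW h0).
  rewrite -linB//; apply: (le_trans (hK _ _ _)); first by rewrite s0; lra.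
  have v1 := hd3 (- h); rewrite normrN (gtr0_norm h0) rmorphN scaleNr opprK in v1.
  have v2 := v1 hd3'; have v3 := hd1 h h0 hd1'; have v4 := hd2 h h0 hd2'.
  have -> : T h (V (- h) y) - y = T h (V (- h) y - y + h%:C *: A y) + (T h y - y - h%:C *: A y)
      - h%:C *: (T h (A y) - A y).
    rewrite (linD lTh) (linB lTh) (linZ lTh) scalerBr; exact: telescope_sub.
  have k1 : nrm (T h (V (- h) y - y + h%:C *: A y)) <= K * (e1 * h).
    apply: (le_trans (hK _ _ _)); first by rewrite (ltW h0); lra.
    by rewrite ler_pM2l.
  apply: (@le_trans _ _ (K * (K * (e1 * h) + e1 * h + h * e1))).
    rewrite ler_pM2l//; apply: (le_trans (nrmB _ _)); rewrite nrmZ nrm_real (gtr0_norm h0).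
    apply: lerD; last by rewrite ler_pM2l// ltW.
    by apply: (le_trans (nrmD _ _)); exact: lerD.
  rewrite -e1E; have eh : 0 <= e1 * h by rewrite mulr_ge0// ltW.
  have := ler_wpM2r eh KK; rewrite expr2; lra.
- pose h := s - s'; have h0 : 0 < h by rewrite subr_gt0.
  have hE' : `|s' - s| = h by rewrite ltr0_norm ?opprB// subr_lt0.
  rewrite hE' in h1 hd1' hd2' hd3' *.
  have -> : V (- s') f = V h y by rewrite /y -band_expD; congr (V _ f); rewrite /h; ring.
  have sh : s' + h = s by rewrite /h; ring.
  have -> : T s y = T s' (T h y) by rewrite -TD ?sh// ltW.
  have [lTs _] := bT s' s'0.
  rewrite -linB//; apply: (le_trans (hK _ _ _)); first by rewrite s'0; lra.
  have v1 := hd3 h; rewrite (gtr0_norm h0) in v1.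
  have v2 := v1 hd3'; have v3 := hd1 h h0 hd1'.
  have -> : V h y - T h y = (V h y - y - h%:C *: A y) - (T h y - y - h%:C *: A y).
    by rewrite opprB [RHS]addrA subrK opprB addrA subrK.
  apply: (@le_trans _ _ (K * (e1 * h + e1 * h))).
    by rewrite ler_pM2l//; apply: (le_trans (nrmB _ _)); exact: lerD.
  rewrite -e1E; have eh : 0 <= e1 * h by rewrite mulr_ge0// ltW.
  have := ler_wpM2r eh KK; rewrite expr2.
  have := ler_wpM2r eh (ltW K0); lra.
Qed.

Lemma T_band (t : R) f : 0 <= t -> T t (E (disc n) f) = V t f.
Proof.
move=> t0; have := T_band_exp_inv (V t f) t0.
by rewrite -band_expD addNr band_exp0 E_band_exp.
Qed.

End Band.

(** That [T t] respects the projections is not assumed. It is read off on the vectors [E (disc m) f]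
    with [m >= n], where [T t] is known, and passes to the limit in [m]. *)
Lemma E_disc_T n (t : R) f : 0 <= t -> E (disc n) (T t f) = band_exp n t f.
Proof.
move=> t0; have Tf : T t (E (disc m) f) @[m --> \oo] --> T t f.
  by apply: bounded_linear_cvg (disc_cvg hE (f := f)); exact: T_bounded_linear.
apply: (cvg_uniq (bounded_linear_cvg (E_bounded hE (borel_discn n)) Tf)).
apply: cvg_near_cst; exists n => // m /= nm.
rewrite T_band// /band_exp E_Phi_cut//; [|exact: approx_band_exp|exact: borel_discn].
congr (Phi (cut _ _) f); rewrite setICA; congr (D `&` _); apply/setIidl.
by move=> z /= zn; apply: (le_trans zn); rewrite ler_nat.
Qed.

(** Both sides agree after [E (disc n)] for every [n]. The bound on the real part is what makes
    [semigroup E t] an integral of a bounded function. *)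
Lemma T_unique (a : R) : (forall z, D z -> complex.Re z <= a) ->
  forall (t : R) f, 0 <= t -> T t f = semigroup E t f.
Proof.
move=> ha t f t0; apply: (cvg_uniq (disc_cvg hE (f := T t f))).
apply: cvg_near_eq (disc_cvg hE (f := semigroup E t f)); near=> n.
rewrite E_disc_T// /semigroup E_Phi_cut//; [|exact: (approx_cexp hE ha)|exact: borel_discn].
by rewrite /band_exp setIC.
Unshelve. all: by end_near. Qed.

End Uniqueness.

(** * Necessity of the spectral condition *)

Section Necessity.
Context {R : realType}.
Local Notation C := R[i].

Lemma fact_le_expn n : (n`! <= n ^ n)%N.
Proof.
elim: n => // n ih; rewrite factS expnS leq_mul2l /=.
by apply: (leq_trans ih); case: n {ih} => // n; rewrite leq_exp2r.
Qed.

(* The moment bound is optimised at [k ~ (r / (alpha e)) ^ (1 / beta)]. *)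
Lemma parabola_of_moments (beta K al : R) : 1 <= beta -> 0 < K -> 0 < al ->
  exists b a : R, 0 < b /\ forall x r : R, 0 <= r ->
    (forall k, r ^+ k * expR x <= K * al ^+ k * (k`!%:R `^ beta)) -> x <= a - b * r `^ beta^-1.
Proof.
move=> beta1 K0 al0; have beta0 : 0 < beta by lra.
(* With this [c] and [k!^beta <= (c r)^k], the quotient [alpha^k k!^beta / r^k] is at most
   [e^(- k)]. *)
pose c : R := (al * expR 1)^-1; have c0 : 0 < c by rewrite invr_gt0 mulr_gt0// expR_gt0.
(* The summand 1 pays for rounding [q] down to the integer [k]. *)
exists (c `^ beta^-1), (ln K + 1); split; first exact: powR_gt0.
move=> x r r0 hr; pose q := (c * r) `^ beta^-1.
have q0 : 0 <= q by exact: powR_ge0.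
have qb : q `^ beta = c * r.
  by rewrite /q -powRrM mulVf ?gt_eqF// powRr1// mulr_ge0// ltW.
have qE : q = c `^ beta^-1 * r `^ beta^-1 by rewrite /q powRM// ltW.
rewrite -qE; set k := Num.truncn q; have /andP[kq qk] := truncn_itv q0.
suff main : expR x <= K * expR (- k%:R).
  have : x <= ln K - k%:R.
    rewrite -[leLHS]expRK -[- _]expRK -lnM ?posrE ?expR_gt0// ler_ln ?posrE ?mulr_gt0 ?expR_gt0//.
  by rewrite -natr1 in qk; rewrite -/k in qk; lra.
(* If [r = 0] then [q = 0], so [k = 0] and the power is 1. *)
have rk : 0 < r ^+ k.
  have [rr|rr] := ltP 0 r; first exact: exprn_gt0.
  have r0' : r = 0 by apply/eqP; rewrite eq_le rr r0.
  rewrite /k /q r0' mulr0 powR0 ?truncn0 ?expr0// invr_neq0// gt_eqF//.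
(* [k! <= k^k] and [k <= q] give [k!^beta <= (q^beta)^k]. *)
have hk : k`!%:R `^ beta <= (c * r) ^+ k.
  have h1 : (k`!%:R : R) <= k%:R ^+ k by rewrite -natrX ler_nat fact_le_expn.
  apply: (le_trans (powR_le_mono (ltW beta0) _ h1)) => //.
  rewrite -powR_exprn// -qb lerXn2r ?nnegrE ?powR_ge0//.
  by apply: powR_le_mono => //; exact: ltW.
rewrite -(ler_pM2l rk); apply: (le_trans (hr k)).
apply: (@le_trans _ _ (K * al ^+ k * (c * r) ^+ k)).
  by rewrite ler_wpM2l// mulr_ge0 ?exprn_ge0// ltW.
have -> : expR (- k%:R) = (expR 1)^-1 ^+ k :> R by rewrite -expRN -expRM_natl mulrN mulr1.
have -> : r ^+ k * (K * (expR 1)^-1 ^+ k) = K * (al * (c * r)) ^+ k.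
  have -> : al * (c * r) = (expR 1)^-1 * r :> R.
    by rewrite /c; field; rewrite !gt_eqF ?expR_gt0.
  by rewrite exprMn mulrCA [r ^+ k * _]mulrC.
by rewrite [(al * _) ^+ k]exprMn mulrA.
Qed.

Context {X : completeNormedModType R[i]}.
Implicit Types (d : set C) (f x y : X).
Variables (A : operator X) (E : set C -> X -> X) (T : R -> X -> X).
Hypothesis hE : spectral_measure E.
Hypothesis hsupp : spectral_support E = spectrum A.
Hypothesis hA : op_eq A (spectral_integral E (spectrum A) id).
Hypothesis hT : generates A T.
Local Notation M := (mbound hE).
Local Notation Phi := (bounded_spectral_integral E).
Local Notation D := (spectral_support E).
Local Notation B n := (D `&` disc n).

Lemma band_moments n : bounded_moments (B n).
Proof.
move=> k s t s0 st; exists (n%:R ^+ k * expR (t * n%:R)).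
  by rewrite mulr_ge0 ?expR_ge0 ?exprn_ge0.
move=> u z /andP[su ut] [_ zn]; apply: ler_pM; rewrite ?expR_ge0 ?exprn_ge0 ?nrm_ge0//.
  by rewrite lerXn2r// nnegrE ?nrm_ge0.
rewrite ler_expR; apply: (@le_trans _ _ (u * n%:R)); last by rewrite ler_wpM2r.
rewrite ler_wpM2l//; first lra.
by apply: (le_trans (ler_norm _)); apply: (le_trans (nrm_Re _)).
Qed.

Lemma E_disc_derivRn n k (t : R) f : 0 < t -> smooth_on_pos (fun t => T t f) ->
  E (disc n) (derivRn k (fun t => T t f) t) = orbit_derivative E (B n) k t f.
Proof.
move=> t0 sm; have bn := @borel_discn R n; have lE := E_linear hE bn.
elim: k t t0 => [|k ih] t t0.
  rewrite (E_disc_T hE hsupp hA hT)//; last exact: ltW.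
  by congr (Phi _ f); apply: eq_cut => z _; rewrite expr0 mul1r.
have hder := sm k t t0.
apply: (cvg_uniq (bounded_linear_cvg (E_bounded hE bn) hder)).
suff eqE : \forall h \near (0 : R)^', diff_quot (orbit_derivative E (B n) k ^~ f) t h =
    E (disc n) (diff_quot (derivRn k (fun t => T t f)) t h).
  have key : diff_quot (orbit_derivative E (B n) k ^~ f) t h @[h --> 0^'] -->
      orbit_derivative E (B n) k.+1 t f.
    exact: (orbit_derivativeP hE (borel_band hE n) (@band_moments n)).
  exact: (cvg_near_eq eqE key).
near=> h; have : `|h| < t by near: h; exact: dnbhs0_lt.
rewrite ltr_norml => /andP[h1 h2].
rewrite /diff_quot (linZ lE) (linB lE) !ih//; lra.
Unshelve. all: by end_near. Qed.

Variable beta : R.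
Hypothesis beta1 : 1 <= beta.
Hypothesis gT : gevrey_roumieu beta T.

(** For fixed [f] these vectors are projections of derivatives of the orbit at time 1, so the Gevrey
    bound costs only a factor [M], whatever [n] is. In the weights [m + 1] plays both [K] and
    [alpha]. *)
Lemma uniform_moments : exists K al : R, [/\ 0 < K, 0 < al & forall k n f,
  nrm (orbit_derivative E (B n) k 1 f) <= K * al ^+ k * (k`!%:R `^ beta) * nrm f].
Proof.
have M0 := mbound_gt0 hE.
have [||m [c [c0 hm]]] := @uniform_bound _ X (nat * nat)%type
    (fun j => orbit_derivative E (B j.2) j.1 1) (fun _ _ => True)
    (fun m j => m.+1%:R * m.+1%:R ^+ j.1 * (j.1`!%:R `^ beta)).
- move=> m [k n] _; apply: (Phi_bounded_linear hE).
  by apply: (approx_moment (borel_band hE n) (@band_moments n)).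
- move=> f; have [sm gf] := gT f.
  have [al [K [al0 K0 hK]]] := gf 1 1 ltr01 (lexx 1).
  exists (Num.truncn (al + M * K)) => -[k n] _ /=.
  set m := (Num.truncn _).+1; have mb : al + M * K < m%:R by exact: truncnS_gt.
  have MK0 : 0 < M * K by rewrite mulr_gt0.
  rewrite -E_disc_derivRn//; apply: (le_trans (mboundP hE _ (@borel_discn R n))).
  have := hK k 1; rewrite lexx nrmE lecR => /(_ isT) h.
  apply: (le_trans (ler_wpM2l (ltW M0) h)); rewrite !mulrA ler_wpM2r ?powR_ge0//.
  apply: ler_pM; rewrite ?exprn_ge0 ?(ltW MK0) ?(ltW al0)//; first lra.
  by rewrite lerXn2r ?nnegrE ?(ltW al0)//; lra.
exists (c * m.+1%:R), m.+1%:R; split=> //; first by rewrite mulr_gt0.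
by move=> k n f; have := hm (k, n) I f; rewrite /= !mulrA.
Qed.

Lemma support_moment_bound (K al : R) (l : C) k : D l ->
  (forall k n f, nrm (orbit_derivative E (B n) k 1 f) <= K * al ^+ k * (k`!%:R `^ beta) * nrm f) ->
  nrm l ^+ k * expR (complex.Re l) <= K * al ^+ k * (k`!%:R `^ beta).
Proof.
move=> Dl hK; have M0 := mbound_gt0 hE; set Q := K * _ * _.
pose F (z : C) := z ^+ k * cexp (1%:C * z).
have FlE : nrm l ^+ k * expR (complex.Re l) = nrm (F l) by rewrite /F nrm_moment mul1r.
rewrite FlE; apply/ler_addgt0Pr => e e0.
(* The oscillation of [F] allowed on the small disc; it cancels the constant of [Phi_cut_bound]. *)
have e1 : 0 < e / (4 * M) by rewrite divr_gt0// mulr_gt0.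
have cF : ccont F by apply: ccont_mul; [exact: ccont_exprn | exact: ccont_cexp_scale].
have [r r0 hr] := cF l _ e1.
pose r1 := Num.min 1 r; have r10 : 0 < r1 by rewrite lt_min ltr01.
pose U := [set w | nrm (w - l) < r1]; have bU : borelC U by exact: borel_ball.
have [f Ef] := supportP Dl r10; set x := E U f in Ef.
have xU : E U x = x by rewrite /x -EI// setIid.
(* Since [U] has radius at most 1, it lies inside this disc, and the truncation does not affect
   [x]. *)
pose n := (Num.truncn (nrm l + 1)).+1.
have Un : U `<=` disc n.
  move=> w; rewrite /U /= lt_min => /andP[w1 _].
  have := nrmD (w - l) l; rewrite subrK => h; have : nrm l + 1 < n%:R by exact: truncnS_gt.
  rewrite /disc /=; lra.
have x0 : 0 < nrm x by rewrite lt_neqAle nrm_ge0 eq_sym nrm_eq0 Ef.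
have bBU : borelC (B n `&` U) by apply: borel_setI => //; exact: borel_band hE n.
have xBU : E (B n `&` U) x = x.
  rewrite -setIA (setIidr Un) EI//; last exact: borel_support hE.
  by rewrite xU (E_support hE).
have aF : approximable (cut (B n) F).
  exact: (approx_moment (borel_band hE n) (@band_moments n) k ltr01).
have aFU : approximable (cut (B n `&` U) F) by exact: approx_cut_sub.
have a1 : approximable (cut (B n `&` U) (fun=> 1)) by exact: approx_cut1.
have LE : orbit_derivative E (B n) k 1 x = Phi (cut (B n `&` U) F) x.
  by rewrite /orbit_derivative -{1}xU Phi_cut_E.
have FlZ : F l *: x = Phi (cut (B n `&` U) (fun z => F l * 1)) x.
  by rewrite (Phi_cutZ hE _ _ a1) (Phi_cut1 hE)// xBU.
have aFl : approximable (cut (B n `&` U) (fun z => F l * 1)).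
  by apply: eq_approx (approx_mul (approx_const (F l)) a1) => z; rewrite /cut; ring.
have diff : nrm (Phi (cut (B n `&` U) F) x - F l *: x) <= 4 * M * (e / (4 * M)) * nrm x.
  rewrite FlZ -(Phi_cutB hE _ aFU aFl); apply: Phi_cut_bound; [|exact: ltW|].
    by apply: eq_approx (approx_cut_comb (-1) aFl aFU) => z; rewrite /cut; ring.
  move=> z [_]; rewrite /U /= lt_min => /andP[_ zr]; rewrite mulr1.
  by apply: ltW; exact: hr.
have M4 : 4 * M * (e / (4 * M)) = e by rewrite mulrC divfK// gt_eqF// mulr_gt0.
rewrite M4 -LE nrm_subC in diff.
have := nrmD (F l *: x - orbit_derivative E (B n) k 1 x) (orbit_derivative E (B n) k 1 x).
rewrite subrK nrmZ => h; rewrite -(ler_pM2r x0).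
by have := hK k n x; rewrite -/Q; lra.
Qed.

Lemma gevrey_spectrum : exists b a : R, 0 < b /\
  spectrum A `<=` [set z : C | complex.Re z <= a - b * `|complex.Im z| `^ beta^-1].
Proof.
have [K [al [K0 al0 hK]]] := uniform_moments.
have [b [a [b0 hab]]] := parabola_of_moments beta1 K0 al0.
exists b, a; split=> // z; rewrite -hsupp => Dz /=.
have := hab (complex.Re z) (nrm z) (nrm_ge0 z) (fun k => support_moment_bound k Dz hK).
(* The moments bound [|z|], which dominates the imaginary part in the description of the region. *)
move=> /le_trans; apply; rewrite lerD2l lerN2 ler_pM2l//.
by apply: powR_le_mono (nrm_Im z) => //; rewrite invr_ge0 (le_trans ler01).
Qed.

End Necessity.

(** * Scalar type operators from bounded functions *)

Section ImageMeasure.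
Context {R : realType} {X : completeNormedModType R[i]}.
Local Notation C := R[i].
Implicit Types (d : set C) (f x y : X) (H : C -> C).
Variable E : set C -> X -> X.
Hypothesis hE : spectral_measure E.
Local Notation M := (mbound hE).
Local Notation Phi := (bounded_spectral_integral E).

Variables (G : C -> C) (c : R).
Hypotheses (bG : borel_fun G) (hc : forall z, nrm (G z) <= c).

Definition image_measure d : X -> X := E (G @^-1` d).
Local Notation E' := image_measure.

Lemma image_spectral_measure : spectral_measure E'.
Proof.
split; rewrite /image_measure.
- by move=> d bd; apply: (E_bounded hE); exact: bG.
- by move=> f; rewrite preimage_set0 (E0 hE).
- by move=> f; rewrite preimage_setT (ET hE).
- by move=> d d' bd bd' f; rewrite preimage_setI (EI hE)//; exact: bG.
- move=> d bd td f; rewrite preimage_bigcup; apply: (E_bigcup hE).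
    by move=> n; exact: bG.
  move/trivIsetP: td => td; apply/trivIsetP => i j _ _ ij.
  by rewrite -preimage_setI td// preimage_set0.
Qed.
Local Notation hE' := image_spectral_measure.

Lemma approx_comp H : approximable H -> approximable (H \o G).
Proof.
move=> aH e e0; have [I [p [h [bp hp]]]] := aH e e0.
by exists I, (p \o G), h; split=> [i|z]; [exact: (bG (bp i)) | exact: hp].
Qed.

(** Change of variables. A step function over [p] for the image measure and its pullback over
    [p \o G] have the same simple integral, close to both sides; [K] accounts for the two different
    bounds of the measures. *)
Lemma Phi_image H f : approximable H -> bounded_spectral_integral E' H f = Phi (H \o G) f.
Proof.
move=> aH; apply: nrm_le0_eq => e e0.
have M0 := mbound_gt0 hE; have M'0 := mbound_gt0 hE'; have f0 := nrm_ge0 f.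
pose K := 4 * mbound hE' * nrm f + 4 * M * nrm f + 1.
have K0 : 0 < K by rewrite ltr_wpDl// addr_ge0// !mulr_ge0// ltW.
have eK : 0 < e / K by rewrite divr_gt0.
have [I [p [h [bp hp]]]] := aH _ eK.
have h1 := PhiP hE' f aH bp hp.
have bpG : bpart (p \o G) by move=> i; exact: (bG (bp i)).
have h2 := PhiP hE f (approx_comp aH) bpG (fun z => hp (G z)).
apply: (le_trans (nrm_tri (simple_int E' p h f) _ _)).
rewrite [X in _ + X]nrm_subC; have eKK : e / K * K = e by rewrite divfK// gt_eqF.
(* The two simple integrals are convertible, as the fibres of [p \o G] are preimages of those of
   [p]. *)
rewrite -[simple_int E' p h f]/(simple_int E (p \o G) h f) in h1 *.
set u := e / K in h1 h2 eKK; have u0 : 0 < u by [].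
by move: eKK; rewrite /K; lra.
Qed.

Let aG : approximable G := approx_borel bG hc.

(** [K \o G] is the inverse of [z - G] off the preimage of a null disc around [z], and 0 on it. The
    product is the indicator of a set whose complement is null, so it integrates to the identity. *)
Lemma image_resolvent z : ~ spectral_support E' z -> resolvent_set (everywhere_op (Phi G)) z.
Proof.
move=> /(support_complP hE')[e e0 he].
pose out : set C := [set w | e <= nrm (w - z)]; have bout : borelC out by exact: borel_outside.
have ah : approximable (cut out (fun w => (w - z)^-1)).
  apply: (@approx_cut _ _ _ e^-1) => //; first exact: borel_fun_inv.
  move=> w; rewrite /out /= => ew; rewrite nrmV lef_pV2// posrE//; exact: lt_le_trans ew.
pose K w := -1 * cut out (fun w => (w - z)^-1) (G w).
have aK : approximable K by apply: approx_mul; [exact: approx_const | exact: (approx_comp ah)].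
have main f : z *: Phi K f - Phi G (Phi K f) = f.
  have azK := approx_mul (approx_const z) aK.
  rewrite -(Phi_mul hE _ aG aK) -(PhiZ hE z _ aK) -(PhiB hE _ azK (approx_mul aG aK)).
  have outE : ~` [set w | nrm (w - z) < e] = out.
    by apply/seteqP; split=> w /=; [move/negP; rewrite -leNgt | rewrite /out /= leNgt => /negP].
  have := EC hE' f (borel_ball z e); rewrite he subr0 outE => {2}<-.
  rewrite /image_measure -(Phi_indic hE); last exact: bG.
  congr (Phi _ f); apply/funext => w; rewrite /K indicE.
  have [ow|ow] := pselect (out (G w)).
    rewrite mem_set// cutT//; have zG : G w - z != 0.
      by rewrite -nrm_eq0 gt_eqF//; exact: lt_le_trans ow.
    by rewrite -mulrBl mulN1r mulrN -mulNr opprB divff.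
  by rewrite memNset// cutF// !mulr0 subr0.
exists (Phi K); split; [exact: Phi_bounded_linear| |].
- by move=> f; split=> //; exact: main.
- move=> f _; have lK := Phi_linear hE aK.
  by rewrite (linB lK) (linZ lK) /= (Phi_comm hE _ aK aG); exact: main.
Qed.

(** Vectors in the range of [E'] of a small disc are approximate eigenvectors. A resolvent bounded
    by [K] would give [nrm x <= 4 M e K nrm x], and [e = 1 / (8 M K)] makes the factor 1/2. *)
Lemma image_spectrum z : spectral_support E' z -> ~ resolvent_set (everywhere_op (Phi G)) z.
Proof.
move=> Dz [S [bS _ SR]]; have [K K0 hK] := bounded_linear_bound bS.
have M0 := mbound_gt0 hE; pose e := (8 * M * K)^-1.
have e0 : 0 < e by rewrite invr_gt0 !mulr_gt0.
have [f] := supportP Dz e0; set x := E' _ f => Ef.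
pose P : set C := G @^-1` [set w | nrm (w - z) < e].
have bP : borelC P by apply: bG; exact: borel_ball.
have xP : E P x = x by rewrite /x /image_measure -(EI hE)// setIid.
have x0 : 0 < nrm x by rewrite lt_neqAle nrm_ge0 eq_sym nrm_eq0 Ef.
have aP : approximable (cut P (fun w => z * 1 + -1 * G w)).
  apply: eq_approx (approx_mul (approx_indic bP) (approx_add (approx_const z) (approx_mul (approx_const (-1)) aG))) => w.
  by rewrite /cut; ring.
have zGx : z *: x - Phi G x = Phi (cut P (fun w => z * 1 + -1 * G w)) x.
  rewrite -{1 2}xP -(Phi_indic hE)//.
  have aI := approx_indic bP.
  rewrite -(Phi_mul hE _ aG aI) -(PhiZ hE)// -(PhiB hE); last 2 first.
  - by apply: approx_mul => //; exact: approx_const.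
  - exact: approx_mul.
  by congr (Phi _ x); apply/funext => w; rewrite /cut; ring.
have hx : nrm (z *: x - Phi G x) <= 4 * M * e * nrm x.
  rewrite zGx; apply: Phi_cut_bound => //; first exact: ltW.
  move=> w; rewrite /P /= nrm_subC => /ltW; apply: le_trans.
  by rewrite mulr1 mulN1r.
have := hK (z *: x - Phi G x); rewrite SR// => h.
have : K * nrm (z *: x - Phi G x) <= K * (4 * M * e * nrm x) by rewrite ler_pM2l.
have -> : K * (4 * M * e * nrm x) = nrm x / 2 by rewrite /e; field; rewrite !gt_eqF.
lra.
Qed.

Lemma image_support_spectrum : spectral_support E' = spectrum (everywhere_op (Phi G)).
Proof.
apply/seteqP; split=> z; first exact: image_spectrum.
by move=> nz; apply: contrapT => /image_resolvent.
Qed.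

Lemma scalar_type_Phi : scalar_type_spectral (everywhere_op (Phi G)).
Proof.
have [lS cS] := Phi_bounded_linear hE aG.
split.
- by split=> // a f g _ _; split=> //=; exact: lS.
- by move=> O [x Ox] _; exists x.
- rewrite /closed_op (_ : mkset _ = (fun p : X * X => p.2 - Phi G p.1) @^-1` [set 0]).
    apply: closed_comp; last exact/accessible_closed_set1/hausdorff_accessible/norm_hausdorff.
    move=> p _; apply: cvgB; first exact: cvg_snd.
    by apply: continuous_comp; [exact: cvg_fst | exact: cS].
  apply/seteqP; split=> p /=; first by move=> [_ ->]; rewrite subrr.
  by move/eqP; rewrite subr_eq0 => /eqP.
exists E'; split; [exact: hE'|exact: image_support_spectrum|].
(* As [|G| <= c], truncation at [n >= c] changes nothing on the support, and the preimage of its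
   complement is null. *)
have ev n f : c <= n%:R ->
    bounded_spectral_integral E' (truncation (spectrum (everywhere_op (Phi G))) id n) f = Phi G f.
  move=> cn; rewrite (truncation_id image_support_spectrum) Phi_image; last exact: (approx_band_id hE').
  rewrite -[RHS](E_support hE') /image_measure -(Phi_indic hE); last exact: bG (borel_support hE').
  rewrite -(Phi_mul hE)//; last by apply: approx_indic; exact: bG (borel_support hE').
  congr (Phi _ f); apply/funext => w; rewrite /= indicE.
  have [Dw|Dw] := pselect (spectral_support E' (G w)).
    rewrite cutT ?mem_set ?mul1r//; split=> //; exact: le_trans (hc w) cn.
  by rewrite cutF ?memNset ?mul0r// => -[].
have cv f : bounded_spectral_integral E' (truncation (spectrum (everywhere_op (Phi G))) id n) f @[n --> \oo] --> Phi G f.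
  apply: cvg_near_cst; exists (Num.truncn c).+1 => // n /= cn; apply: ev.
  by apply: (le_trans (ltW (truncnS_gt _))); rewrite ler_nat.
split=> [|f _].
  by apply/seteqP; split=> f _ //=; apply/cvg_ex; exists (Phi G f); exact: cv.
by symmetry; apply: cvg_lim => //; exact: norm_hausdorff.
Qed.

End ImageMeasure.

Theorem theorem4p2 (R : realType) (X : completeNormedModType R[i])
    (beta : R) (hbeta : 1 <= beta)
    (A : operator X) (hA : scalar_type_spectral A) :
  ((exists T : R -> X -> X, generates A T /\ gevrey_roumieu beta T)
   <->
   (exists b a : R, 0 < b /\
      spectrum A `<=`
        [set z : R[i] |
          complex.Re z <= a - b * `|complex.Im z| `^ beta^-1]))
  /\
  (forall T : R -> X -> X, generates A T -> gevrey_roumieu beta T ->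
     forall t : R, 0 <= t -> scalar_type_spectral (everywhere_op (T t))).
Proof.
have [_ _ _ [E [hE hsupp hAE]]] := hA.
have half (a b : R) z : 0 < b -> complex.Re z <= a - b * `|complex.Im z| `^ beta^-1 -> complex.Re z <= a.
  by move=> b0; have := mulr_ge0 (ltW b0) (powR_ge0 `|complex.Im z| beta^-1); lra.
split; first split.
- by move=> [T [gT rT]]; exact: (gevrey_spectrum hE hsupp hAE gT hbeta rT).
- move=> [b [a [b0 hab]]]; exists (semigroup E).
  have ha z : spectral_support E z -> complex.Re z <= a.
    by rewrite hsupp => /hab; exact: half.
  split; first exact: semigroup_generates ha.
  by apply: (semigroup_gevrey hE hbeta b0 (a := a)) => z; rewrite hsupp => /hab.
move=> T gT rT t t0.
have [b [a [b0 hab]]] := gevrey_spectrum hE hsupp hAE gT hbeta rT.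
have ha z : spectral_support E z -> complex.Re z <= a.
  by rewrite hsupp => /hab; exact: half.
(* The region just obtained bounds the real part on the support, as [T_unique] requires. *)
have -> : T t = semigroup E t.
  by apply/funext => f; exact: (T_unique hE hsupp hAE gT ha).
apply: (@scalar_type_Phi _ _ _ hE _ (expR (t * `|a|))).
  by apply: borel_fun_cut; [exact: borel_support hE | exact: borel_fun_cexp_scale].
move=> z; have [Dz|Dz] := pselect (spectral_support E z); last by rewrite cutF// nrm0 expR_ge0.
by rewrite cutT//; exact: (nrm_cexp_scale ha).
Qed.
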